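(* Let $N\ge 2$ and $T=\bigcup_{k=1}^N[a_k,b_k]\subset\mathbb R$ with $a_k<b_k<a_{k+1}<b_{k+1}$ for $k=1,\dots,N-1$. Let $q,\tilde q\in C(T)$ be complex-valued functions, and let $M(\lambda)$ and $\tilde M(\lambda)$ be the Weyl functions of the Sturm--Liouville equation $-y^{\Delta\Delta}(x)+q(x)y(\sigma(x))=\lambda y(\sigma(x))$ on $T$ with potential $q$ and of the same equation with $q$ replaced by $\tilde q$, respectively. If $M(\lambda)=\tilde M(\lambda)$ (as meromorphic functions of $\lambda\in\mathbb C$), then $q=\tilde q$ on $T$. Thus, specification of the Weyl function $M(\lambda)$ uniquely determines the potential $q$.
   Context: Time-scale notions on $T=\bigcup_{k=1}^N[a_k,b_k]$. The jump function is $\sigma(x)=\inf\{s\in T: s>x\}$ for $x\in T$, $x\neq\sup T$, and $\sigma(\sup T)=\sup T=b_N$; so $\sigma(b_k)=a_{k+1}$ for $k=1,\dots,N-1$ and $\sigma(x)=x$ for all other $x\in T$. A function $f$ on $T$ is $\Delta$-differentiable at $t\in T$ with $\Delta$-derivative $f^\Delta(t)$ if for every $\varepsilon>0$ there is $\delta>0$ such that $|f(\sigma(t))-f(s)-f^{\Delta}(t)(\sigma(t)-s)|\le\varepsilon|\sigma(t)-s|$ for all $s\in(t-\delta,t+\delta)\cap T$. Put $f^{\Delta\Delta}=(f^\Delta)^\Delta$. $C(T)$ denotes the continuous functions on $T$. The Sturm--Liouville equation with potential $q\in C(T)$ (complex-valued) and spectral parameter $\lambda\in\mathbb C$ is $$-y^{\Delta\Delta}(x)+q(x)y(\sigma(x))=\lambda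 y(\sigma(x)),\quad x\in T.$$ A solution is a function $y$ on $T$ that is twice $\Delta$-differentiable on $T$ and satisfies this equation for all $x\in T$. Equivalently, $-y''+qy=\lambda y$ on each $[a_k,b_k]$, $k=1,\dots,N$, (one-sided derivatives at the endpoints) and, for $k=1,\dots,N-1$, $$y(a_{k+1})=y(b_k)+(a_{k+1}-b_k)y'(b_k),\qquad y'(a_{k+1})=y'(b_k)+(a_{k+1}-b_k)(q(b_k)-\lambda)y(a_{k+1}),$$ where $y'(b_k)$ is the left derivative and $y'(a_{k+1})$ the right derivative; in this case $y^\Delta(x)=y'(x)$ on $T$ with this convention. Let $S(x,\lambda)$ and $C(x,\lambda)$ be the solutions with $S(a_1,\lambda)=C^\Delta(a_1,\lambda)=0$ and $S^\Delta(a_1,\lambda)=C(a_1,\lambda)=1$; for fixed $x$ they are entire in $\lambda$. Put $\Delta_0(\lambda)=S(b_N,\lambda)$ and $\Delta_1(\lambda)=C(b_N,\lambda)$. For $\lambda$ with $\Delta_1(\lambda)\ne0$, let $\Phi(x,\lambda)$ be the solution satisfying $\Phi^\Delta(a_1,\lambda)=1$, $\Phi(b_N,\lambda)=0$. The Weyl function is $M(\lambda):=\Phi(a_1,\lambda)$; it is the meromorphic function $M(\lambda)=-\Delta_0(\lambda)/\Delta_1(\lambda)$. *)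

(* Defs.v *)
From Stdlib Require Import Reals Lra Lia ClassicalEpsilon.
From Coquelicot Require Import Coquelicot.

Open Scope R_scope.
Open Scope C_scope.

Definition intervals (N : nat) (a b : nat -> R) (x : R) : Prop :=
  exists k : nat, (1 <= k <= N)%nat /\ (a k <= x <= b k)%R.

(* Functions on a time scale [T] are total functions on [R] whose values
   outside [T] are irrelevant: every notion below only uses values on [T]. *)

(* The case distinction is needed because [{s in T | s > sup T}] is empty. *)
Definition jump (T : R -> Prop) (x : R) : R :=
  if Req_EM_T x (real (Lub_Rbar T)) then real (Lub_Rbar T)
  else real (Glb_Rbar (fun s => T s /\ (x < s)%R)).

Definition is_delta_deriv (T : R -> Prop) (f : R -> C) (t : R) (d : C) : Prop :=
  forall eps : R, (0 < eps)%R ->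
  exists delta : R, (0 < delta)%R /\
  forall s : R, T s -> (t - delta < s < t + delta)%R ->
    (Cmod (f (jump T t) - f s - d * RtoC (jump T t - s))
       <= eps * Rabs (jump T t - s))%R.

Definition ex_delta_deriv (T : R -> Prop) (f : R -> C) (t : R) : Prop :=
  exists d : C, is_delta_deriv T f t d.

Definition delta_deriv (T : R -> Prop) (f : R -> C) (t : R) : C :=
  epsilon (inhabits (RtoC 0)) (is_delta_deriv T f t).

Definition is_solution (T : R -> Prop) (q : R -> C) (lam : C) (y : R -> C) : Prop :=
  (forall x, T x -> ex_delta_deriv T y x) /\
  (forall x, T x -> ex_delta_deriv T (delta_deriv T y) x) /\
  (forall x, T x ->
     - delta_deriv T (delta_deriv T y) x + q x * y (jump T x)
     = lam * y (jump T x)).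

(* The functions below are picked among the functions on [R] satisfying the
   stated conditions; these determine the values on [T]
   (for [weyl_solution], when [Delta1 N a b q lam <> 0]). *)

Definition cosine_solution (N : nat) (a b : nat -> R) (q : R -> C) (lam : C)
    : R -> C :=
  let T := intervals N a b in
  epsilon (inhabits (fun _ : R => RtoC 0)) (fun y =>
    is_solution T q lam y /\ y (a 1%nat) = 1 /\ delta_deriv T y (a 1%nat) = 0).

Definition Delta1 (N : nat) (a b : nat -> R) (q : R -> C) (lam : C) : C :=
  cosine_solution N a b q lam (b N).

Definition weyl_solution (N : nat) (a b : nat -> R) (q : R -> C) (lam : C)
    : R -> C :=
  let T := intervals N a b in
  epsilon (inhabits (fun _ : R => RtoC 0)) (fun y =>
    is_solution T q lam y /\ delta_deriv T y (a 1%nat) = 1 /\ y (b N) = 0).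

(* Only meaningful when [Delta1 N a b q lam <> 0]; the zeros of [Delta1] are
   the poles. *)
Definition weyl_function (N : nat) (a b : nat -> R) (q : R -> C) (lam : C) : C :=
  weyl_solution N a b q lam (a 1%nat).

(* Equality as meromorphic functions: the values agree wherever both functions
   are defined, i.e. off the (discrete) union of the two sets of poles. *)
Definition weyl_function_eq (N : nat) (a b : nat -> R) (q qt : R -> C) : Prop :=
  forall lam : C,
    Delta1 N a b q lam <> 0 -> Delta1 N a b qt lam <> 0 ->
    weyl_function N a b q lam = weyl_function N a b qt lam.

(* Main.v *)
Require Import Defs.
From Stdlib Require Import Reals Lra Lia ClassicalEpsilon PSeries_reg.
From Coquelicot Require Import Coquelicot.

Open Scope R_scope.
Open Scope C_scope.

(* Only the values [lambda = - k ^ 2] with [k] real and large are used.  For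
   these, a solution [y] vanishing at [b_N] has [Re (y' * conj y) <= 0]
   everywhere, so that on the first interval [a, b], of length [l], it differs
   little from a decaying exponential: [|y' + k y| (b)] is at most
   [8 k exp (- k l) |y a|].  Comparing it with the solutions
   [exp (- k (x - a)) p] and [exp (- k (x - a)) pt] for [q] and [qt] that
   satisfy [p = pt = 1], [p' = pt' = 0] at [b], equality of the Weyl functions
   says that the integral over [a, b] of [(q - qt) exp (- 2 k (x - a)) p pt] is
   of order [k exp (- 2 k l)].  Here [p pt - 1] is a superposition of
   [exp (- 2 k r)], [r >= 0], with bounded density; this is expressed by
   testing against finite differences in [k], without constructing the density.
   An [m]-th difference in [k], with [m] and the step coupled, turns
   [exp (- 2 k r)] into an approximate Dirac mass at any prescribed point
   [t - a] and makes the error negligible, whence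
   [|q - qt| (t) <= M * int_a^t |q - qt|], and [q = qt] on [a, b] by Gronwall.
   Then the two solutions are proportional at [b], hence at the left end of the
   next interval, and the argument is repeated there. *)

(** * Calculus of complex-valued functions of a real variable *)

(** Real [k] suffices because the energy argument also shows that [Delta1] does not vanish at
    [- k ^ 2] for large [k], so no analytic continuation enters. The obstacle is that the error of
    order [k exp (- 2 k l)] is known only in modulus: nothing is known about its derivatives in [k],
    so an inversion of the Laplace transform by derivatives is out of reach. A difference of step
    [nu] needs only the modulus and costs a factor [1 + exp (- nu d)] on a quantity of size
    [exp (- k d)]. With about [exp (2 nu tau)] differences the total factor stays bounded as soon as
    [d > 2 tau]. This is compatible with [d < 2 l] for every [tau < l], so every interior point of
    the interval can be reached. A density of modulus at most [M], shifted by [r], would be sent by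
    the probe to a number of modulus at most [M * bump_tail nu m r]; this inequality is the only
    form in which densities occur. *)

Definition cderiv (f : R -> C) (x : R) (d : C) : Prop :=
  is_derive (fun t => Re (f t)) x (Re d) /\ is_derive (fun t => Im (f t)) x (Im d).

Lemma C_eq (z w : C) : Re z = Re w -> Im z = Im w -> z = w.
Proof. destruct z, w; simpl; intros -> ->; reflexivity. Qed.

Lemma is_derive_eq (f : R -> R) (x l l' : R) : is_derive f x l -> l = l' -> is_derive f x l'.
Proof. intros H <-; exact H. Qed.

Lemma cderiv_eq (f : R -> C) (x : R) (d d' : C) : cderiv f x d -> d = d' -> cderiv f x d'.
Proof. intros H <-; exact H. Qed.

Lemma cderiv_ext (f g : R -> C) (x : R) (d : C) :
  (forall t, f t = g t) -> cderiv f x d -> cderiv g x d.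
Proof.
  intros E [H1 H2]; split; (eapply is_derive_ext; [| eassumption]); intro t; simpl; now rewrite E.
Qed.

Lemma cderiv_const (c : C) (x : R) : cderiv (fun _ => c) x 0.
Proof. split; apply (is_derive_const (K:=R_AbsRing) (V:=R_NormedModule)). Qed.

Lemma cderiv_RtoC (f : R -> R) (x d : R) :
  is_derive f x d -> cderiv (fun t => RtoC (f t)) x (RtoC d).
Proof.
  intro H; split; simpl; [exact H | apply (is_derive_const (K:=R_AbsRing) (V:=R_NormedModule))].
Qed.

Lemma cderiv_plus (f g : R -> C) (x : R) (d e : C) :
  cderiv f x d -> cderiv g x e -> cderiv (fun t => f t + g t) x (d + e).
Proof.
  intros [H1 H2] [H3 H4]; split; simpl.
  - now apply (is_derive_plus (K:=R_AbsRing) (V:=R_NormedModule) (fun t => Re (f t)) (fun t => Re (g t))).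
  - now apply (is_derive_plus (K:=R_AbsRing) (V:=R_NormedModule) (fun t => Im (f t)) (fun t => Im (g t))).
Qed.

Lemma cderiv_opp (f : R -> C) (x : R) (d : C) :
  cderiv f x d -> cderiv (fun t => - f t) x (- d).
Proof.
  intros [H1 H2]; split; simpl.
  - now apply (is_derive_opp (K:=R_AbsRing) (V:=R_NormedModule) (fun t => Re (f t))).
  - now apply (is_derive_opp (K:=R_AbsRing) (V:=R_NormedModule) (fun t => Im (f t))).
Qed.

Lemma cderiv_minus (f g : R -> C) (x : R) (d e : C) :
  cderiv f x d -> cderiv g x e -> cderiv (fun t => f t - g t) x (d - e).
Proof. intros H1 H2; apply cderiv_plus; [| apply cderiv_opp]; assumption. Qed.

Lemma is_derive_Rmult (f g : R -> R) (x d e : R) :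
  is_derive f x d -> is_derive g x e ->
  is_derive (fun t => f t * g t)%R x (d * g x + f x * e)%R.
Proof.
  intros H1 H2; apply (is_derive_mult f g x d e H1 H2); intros; apply Rmult_comm.
Qed.

Lemma cderiv_mult (f g : R -> C) (x : R) (d e : C) :
  cderiv f x d -> cderiv g x e -> cderiv (fun t => f t * g t) x (d * g x + f x * e).
Proof.
  intros [H1 H2] [H3 H4]; split; simpl.
  - eapply is_derive_eq.
    + apply (is_derive_minus (K:=R_AbsRing) (V:=R_NormedModule));
        apply is_derive_Rmult; eassumption.
    + unfold minus, plus, opp, Re, Im; simpl; ring.
  - eapply is_derive_eq.
    + apply (is_derive_plus (K:=R_AbsRing) (V:=R_NormedModule));
        apply is_derive_Rmult; eassumption.
    + unfold minus, plus, opp, Re, Im; simpl; ring.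
Qed.

Lemma cderiv_scal (c : C) (f : R -> C) (x : R) (d : C) :
  cderiv f x d -> cderiv (fun t => c * f t) x (c * d).
Proof.
  intro H; eapply cderiv_eq; [apply cderiv_mult; [apply cderiv_const | exact H] | simpl; ring].
Qed.

Lemma is_derive_norm_sq (f : R -> C) (x : R) (d : C) :
  cderiv f x d -> is_derive (fun t => Cmod (f t) ^ 2)%R x (2 * Re (d * Cconj (f x)))%R.
Proof.
  intros [H1 H2].
  apply (is_derive_ext (fun t => Re (f t) * Re (f t) + Im (f t) * Im (f t))%R).
  - intro t; rewrite Cmod2_alt; unfold Re, Im; simpl; ring.
  - eapply is_derive_eq.
    + apply (is_derive_plus (K:=R_AbsRing) (V:=R_NormedModule));
        apply is_derive_Rmult; eassumption.
    + unfold plus, Re, Im; simpl; ring.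
Qed.

Lemma is_derive_continuity (f : R -> R) (x d : R) : is_derive f x d -> continuity_pt f x.
Proof.
  intro H; apply derivable_continuous_pt; exists d; apply is_derive_Reals, H.
Qed.

Lemma deriv_nonpos_decr (f f' : R -> R) (x y : R) :
  (x <= y)%R -> (forall t, (x <= t <= y)%R -> is_derive f t (f' t) /\ (f' t <= 0)%R) ->
  (f y <= f x)%R.
Proof.
  intros Hxy H.
  destruct (MVT_gen f x y f') as [c [Hc E]].
  - intros t Ht; rewrite Rmin_left, Rmax_right in Ht by assumption; apply H; lra.
  - intros t Ht; rewrite Rmin_left, Rmax_right in Ht by assumption.
    eapply is_derive_continuity, H; lra.
  - rewrite Rmin_left, Rmax_right in Hc by assumption.
    destruct (H c Hc) as [_ H0].
    assert (f' c * (y - x) <= 0)%R by nra. lra.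
Qed.

Lemma deriv_nonneg_incr (f f' : R -> R) (x y : R) :
  (x <= y)%R -> (forall t, (x <= t <= y)%R -> is_derive f t (f' t) /\ (0 <= f' t)%R) ->
  (f x <= f y)%R.
Proof.
  intros Hxy H.
  enough (- f y <= - f x)%R by lra.
  apply (deriv_nonpos_decr (fun t => - f t)%R (fun t => - f' t)%R); [exact Hxy |].
  intros t Ht; destruct (H t Ht); split; [| lra].
  now apply (is_derive_opp (K:=R_AbsRing) (V:=R_NormedModule) f).
Qed.

Lemma Re_le_Cmod (z : C) : (Re z <= Cmod z)%R.
Proof. eapply Rle_trans; [apply Rle_abs | apply re_le_Cmod]. Qed.

Lemma Cmod_sub_sym (z w : C) : Cmod (z - w) = Cmod (w - z).
Proof. rewrite <- Cmod_opp; f_equal; ring. Qed.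

(** Multiplication by the unit number [u] pointing against the argument of [f y - f x] makes this
    increment real, and [Re (u * f) - g] is nonincreasing. Below, [g] is always an explicit
    primitive of the bound, so this lemma does the work of integral estimates. *)
Lemma mean_value_ineq (f f' : R -> C) (g g' : R -> R) (x y : R) :
  (x <= y)%R ->
  (forall t, (x <= t <= y)%R -> cderiv f t (f' t)) ->
  (forall t, (x <= t <= y)%R -> is_derive g t (g' t)) ->
  (forall t, (x <= t <= y)%R -> (Cmod (f' t) <= g' t)%R) ->
  (Cmod (f y - f x) <= g y - g x)%R.
Proof.
  intros Hxy Hf Hg Hle.
  destruct (Req_dec (Cmod (f y - f x)) 0) as [E | E].
  - rewrite E.
    enough (g x <= g y)%R by lra.
    apply (deriv_nonneg_incr g g'); [exact Hxy |].
    intros t Ht; split; [now apply Hg |].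
    eapply Rle_trans; [apply Cmod_ge_0 | apply Hle, Ht].
  - set (n := Cmod (f y - f x)) in *.
    assert (Hn : (0 < n)%R) by (pose proof (Cmod_ge_0 (f y - f x)); fold n in H; lra).
    set (u := / RtoC n * Cconj (f y - f x)).
    assert (Hu : Cmod u = 1%R).
    { unfold u; rewrite Cmod_mult, Cmod_conj, Cmod_inv by (intro H; apply RtoC_inj in H; lra).
      rewrite Cmod_R, Rabs_pos_eq by lra; fold n; field; lra. }
    assert (Hd : (Re (u * f y) - g y <= Re (u * f x) - g x)%R).
    { apply (deriv_nonpos_decr (fun t => Re (u * f t) - g t)%R
               (fun t => Re (u * f' t) - g' t)%R); [exact Hxy |].
      intros t Ht; split.
      - apply (is_derive_minus (K:=R_AbsRing) (V:=R_NormedModule)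
                 (fun t => Re (u * f t)) g); [| now apply Hg].
        apply (cderiv_scal u), Hf, Ht.
      - pose proof (Re_le_Cmod (u * f' t)). rewrite Cmod_mult, Hu in H.
        specialize (Hle t Ht). lra. }
    assert (E2 : Re (u * (f y - f x)) = n).
    { unfold u.
      replace (/ RtoC n * Cconj (f y - f x) * (f y - f x))
        with (/ RtoC n * ((f y - f x) * Cconj (f y - f x))) by ring.
      rewrite <- Cmod2_conj. fold n.
      replace (/ RtoC n * RtoC (n ^ 2)) with (RtoC n); [reflexivity |].
      rewrite <- RtoC_inv, <- RtoC_mult by exact E. f_equal. field. lra. }
    replace (u * (f y - f x)) with (u * f y - u * f x) in E2 by ring.
    change (Re (u * f y - u * f x)) with (Re (u * f y) - Re (u * f x))%R in E2. lra.
Qed.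

Lemma RtoC_neq_0 (r : R) : r <> 0%R -> RtoC r <> 0.
Proof. intros H E; apply RtoC_inj in E; contradiction. Qed.

Lemma cderiv_conj (f : R -> C) (x : R) (d : C) :
  cderiv f x d -> cderiv (fun t => Cconj (f t)) x (Cconj d).
Proof.
  intros [H1 H2]; split; simpl; [exact H1 |].
  now apply (is_derive_opp (K:=R_AbsRing) (V:=R_NormedModule) (fun t => Im (f t))).
Qed.

Lemma is_derive_exp_affine (c x0 x : R) :
  is_derive (fun t => exp (c * (t - x0)))%R x (c * exp (c * (x - x0)))%R.
Proof. auto_derive; [trivial | now rewrite Rmult_1_r]. Qed.

Lemma Cmod_exp (r : R) : Cmod (RtoC (exp r)) = exp r.
Proof. rewrite Cmod_R; apply Rabs_pos_eq, Rlt_le, exp_pos. Qed.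

(** The derivatives are two-sided even at [a] and [b]; [wderiv_extend] supplies functions for which
    this holds. *)
Definition ode (a b : R) (c Y Y1 : R -> C) : Prop :=
  forall x, (a <= x <= b)%R -> cderiv Y x (Y1 x) /\ cderiv Y1 x (c x * Y x).

(** * Solutions with nonpositive energy at the right end *)

Section Decay.
Variables (a b Q k : R) (q Y Y1 : R -> C).
Hypothesis Hab : (a < b)%R.
Hypothesis HQ : forall x, (a <= x <= b)%R -> (Cmod (q x) <= Q)%R.
Hypothesis Hode : ode a b (fun x => q x + RtoC (k ^ 2)) Y Y1.
Hypothesis Hk : (0 < k)%R.
Hypothesis HkQ : (4 * Q <= k ^ 2)%R.

(** The derivative of the energy is [(Re q + k ^ 2) |Y| ^ 2 + |Y1| ^ 2], nonnegative because [k ^ 2]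
    dominates [q]. *)
Lemma energy_incr (x : R) : (a <= x <= b)%R ->
  (Re (Y1 x * Cconj (Y x)) <= Re (Y1 b * Cconj (Y b)))%R.
Proof.
  intro Hx.
  apply (deriv_nonneg_incr (fun t => Re (Y1 t * Cconj (Y t)))
           (fun t => Re ((q t + RtoC (k ^ 2)) * Y t * Cconj (Y t) + Y1 t * Cconj (Y1 t)))); [lra |].
  intros t Ht. destruct (Hode t) as [D0 D1]; [lra |]. split.
  - apply (cderiv_mult _ _ _ _ _ D1 (cderiv_conj _ _ _ D0)).
  - assert (Hq := HQ t ltac:(lra)).
    assert (Hr : (- Q <= Re (q t))%R).
    { pose proof (re_le_Cmod (q t)) as H.  pose proof (Rle_abs (- Re (q t))) as H1. rewrite Rabs_Ropp in H1. lra. }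
    pose proof (pow2_ge_0 (Cmod (q t))). pose proof (Cmod_ge_0 (q t)).
    replace (Re _) with ((Re (q t) + k ^ 2) * (Re (Y t) ^ 2 + Im (Y t) ^ 2)
                         + (Re (Y1 t) ^ 2 + Im (Y1 t) ^ 2))%R
      by (destruct (q t), (Y t), (Y1 t); simpl; ring).
    assert (0 <= Re (q t) + k ^ 2)%R by nra.
    assert (0 <= Re (Y t) ^ 2 + Im (Y t) ^ 2)%R by nra.
    assert (0 <= Re (Y1 t) ^ 2 + Im (Y1 t) ^ 2)%R by nra.
    nra.
Qed.

(** The two modes of the free equation: [z' = - k z + q Y] and [w' = k w + q Y]. *)
Let z (x : R) : C := Y1 x - RtoC k * Y x.
Let w (x : R) : C := Y1 x + RtoC k * Y x.

Hypothesis Hend : (Re (Y1 b * Cconj (Y b)) <= 0)%R.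

(** [|w| ^ 2 - |z| ^ 2 = 4 k Re (Y1 * conj Y)], and the energy is at most its value at [b]. *)
Lemma growing_le_decaying (x : R) : (a <= x <= b)%R -> (Cmod (w x) <= Cmod (z x))%R.
Proof.
  intro Hx. pose proof (energy_incr x Hx) as H.
  apply Rsqr_incr_0; [| apply Cmod_ge_0 | apply Cmod_ge_0].
  rewrite 2 Rsqr_pow2, 2 Cmod2_alt. unfold w, z.
  destruct (Y x) as [u v], (Y1 x) as [u1 v1]; simpl in *. nra.
Qed.

Lemma value_le_decaying (x : R) : (a <= x <= b)%R -> (k * Cmod (Y x) <= Cmod (z x))%R.
Proof.
  intro Hx. pose proof (growing_le_decaying x Hx) as H.
  assert (E : (2 * k * Cmod (Y x) = Cmod (w x - z x))%R).
  { unfold w, z. replace (Y1 x + RtoC k * Y x - (Y1 x - RtoC k * Y x)) with (RtoC (2 * k) * Y x).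
    - rewrite Cmod_mult, Cmod_R, Rabs_pos_eq by lra. reflexivity.
    - rewrite RtoC_mult. ring. }
  pose proof (Cmod_triangle (w x) (- z x)) as T. rewrite Cmod_opp in T.
  unfold Cminus in E. lra.
Qed.

(** [z] with its decay removed: [F' = exp (k (x - a)) q Y] has modulus at most [(Q / k) |F|], by
    [value_le_decaying]. *)
Let F (x : R) : C := RtoC (exp (k * (x - a))) * z x.

Lemma scaled_deriv (x : R) : (a <= x <= b)%R ->
  cderiv F x (RtoC (exp (k * (x - a))) * (q x * Y x)).
Proof.
  intro Hx. destruct (Hode x Hx) as [D0 D1].
  eapply cderiv_eq.
  - apply cderiv_mult.
    + apply cderiv_RtoC, is_derive_exp_affine.
    + apply cderiv_minus; [exact D1 | apply cderiv_scal, D0].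
  - unfold z. rewrite RtoC_mult, RtoC_pow. ring.
Qed.

Lemma scaled_deriv_bound (x : R) : (a <= x <= b)%R ->
  (Rabs (2 * Re (RtoC (exp (k * (x - a))) * (q x * Y x) * Cconj (F x)))
     <= 2 * (Q / k) * Cmod (F x) ^ 2)%R.
Proof.
  intro Hx. rewrite Rabs_mult, (Rabs_pos_eq 2) by lra.
  eapply Rle_trans; [apply Rmult_le_compat_l; [lra | apply re_le_Cmod] |].
  rewrite Rmult_assoc. apply Rmult_le_compat_l; [lra |].
  rewrite 3 Cmod_mult, Cmod_conj.
  unfold F. rewrite Cmod_mult, Cmod_exp.
  set (e := exp (k * (x - a))). assert (He : (0 < e)%R) by apply exp_pos.
  pose proof (value_le_decaying x Hx) as H1. pose proof (HQ x Hx) as H2.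
  pose proof (Cmod_ge_0 (Y x)) as H3. pose proof (Cmod_ge_0 (q x)) as H4.
  pose proof (Cmod_ge_0 (z x)) as H5.
  assert (H6 : (Cmod (Y x) <= Cmod (z x) / k)%R).
  { apply Rmult_le_reg_l with k; [lra |]. replace (k * (Cmod (z x) / k))%R with (Cmod (z x)) by (field; lra). lra. }
  assert (H7 : (Cmod (q x) * Cmod (Y x) <= Q * (Cmod (z x) / k))%R) by (apply Rmult_le_compat; lra).
  replace (Q / k * (e * Cmod (z x)) ^ 2)%R with (e * (Q * (Cmod (z x) / k)) * (e * Cmod (z x)))%R by (field; lra).
  apply Rmult_le_compat_r; [nra |]. nra.
Qed.

Hypothesis Hlen : (2 * Q * (b - a) <= k)%R.

(** Gronwall in both directions for [|F| ^ 2], which is differentiable also where [F] vanishes. Its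
    logarithmic rate is at most [c = 2 Q / k] with [c (b - a) <= 1], so it changes by a factor of at
    most [e <= 4], and [|F|] by at most 2. *)
Lemma scaled_growth (x y : R) : (a <= x <= b)%R -> (a <= y <= b)%R ->
  (Cmod (F x) <= 2 * Cmod (F y))%R.
Proof.
  assert (HQ0 : (0 <= Q)%R).
  { eapply Rle_trans; [apply Cmod_ge_0 | apply (HQ a); lra]. }
  set (c := (2 * (Q / k))%R).
  assert (Hc : (0 <= c)%R) by (apply Rmult_le_pos; [lra | apply Rdiv_le_0_compat; lra]).
  assert (Hcl : (c * (b - a) <= 1)%R).
  { unfold c. apply Rmult_le_reg_l with k; [lra |].
    replace (k * (2 * (Q / k) * (b - a)))%R with (2 * Q * (b - a))%R by (field; lra). lra. }
  assert (Hsq : forall x y, (a <= x <= b)%R -> (a <= y <= b)%R -> (x <= y)%R ->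
    (Cmod (F y) ^ 2 <= 4 * Cmod (F x) ^ 2 /\ Cmod (F x) ^ 2 <= 4 * Cmod (F y) ^ 2)%R).
  { clear x y; intros x y Hx Hy Hxy.
    assert (Hexp : forall s, (0 <= s <= 1)%R -> (1 <= exp s <= 3)%R).
    { intros s Hs. split.
      - destruct (Req_dec s 0) as [-> | n]; [rewrite exp_0; lra |].
        pose proof (exp_ineq1 s n). lra.
      - eapply Rle_trans; [| apply exp_le_3].
        destruct (Req_dec s 1) as [-> | n]; [lra |]. apply Rlt_le, exp_increasing. lra. }
    assert (Hd : forall t, (x <= t <= y)%R -> is_derive (fun t => Cmod (F t) ^ 2)%R t
         (2 * Re (RtoC (exp (k * (t - a))) * (q t * Y t) * Cconj (F t)))%R).
    { intros t Ht. apply is_derive_norm_sq, scaled_deriv. lra. }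
    assert (Ek : forall t, (x <= t <= y)%R -> (1 <= exp (c * (t - x)) <= 3)%R).
    { intros t Ht. apply Hexp. split; [nra |]. eapply Rle_trans; [| apply Hcl].
      apply Rmult_le_compat_l; lra. }
    assert (E0 : exp (c * (x - x)) = 1%R).
    { replace (c * (x - x))%R with 0%R by ring. apply exp_0. }
    assert (E0' : exp (- c * (x - x)) = 1%R).
    { replace (- c * (x - x))%R with 0%R by ring. apply exp_0. }
    assert (Eprod : (exp (- c * (y - x)) * exp (c * (y - x)) = 1)%R).
    { rewrite <- exp_plus. replace (- c * (y - x) + c * (y - x))%R with 0%R by ring. apply exp_0. }
    pose proof (Ek y ltac:(lra)) as Eky.
    pose proof (pow2_ge_0 (Cmod (F x))) as Px. pose proof (pow2_ge_0 (Cmod (F y))) as Py.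
    split.
    - assert (I : (exp (- c * (y - x)) * Cmod (F y) ^ 2 <= exp (- c * (x - x)) * Cmod (F x) ^ 2)%R).
      { apply (deriv_nonpos_decr (fun t => exp (- c * (t - x)) * Cmod (F t) ^ 2)%R
           (fun t => - c * exp (- c * (t - x)) * Cmod (F t) ^ 2 + exp (- c * (t - x)) *
              (2 * Re (RtoC (exp (k * (t - a))) * (q t * Y t) * Cconj (F t))))%R); [exact Hxy |].
        intros t Ht; split.
        - apply (is_derive_Rmult (fun t => exp (- c * (t - x)))%R (fun t => Cmod (F t) ^ 2)%R);
            [apply is_derive_exp_affine | apply Hd, Ht].
        - pose proof (scaled_deriv_bound t ltac:(lra)) as B. fold c in B.
          pose proof (Rle_abs (2 * Re (RtoC (exp (k * (t - a))) * (q t * Y t) * Cconj (F t)))) as B'.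
          pose proof (exp_pos (- c * (t - x))). nra. }
      rewrite E0', Rmult_1_l in I.
      assert (Cmod (F y) ^ 2 <= exp (c * (y - x)) * Cmod (F x) ^ 2)%R.
      { apply Rmult_le_compat_l with (r := exp (c * (y - x))) in I; [| lra].
        rewrite <- Rmult_assoc, (Rmult_comm (exp (c * _))), Eprod in I. lra. }
      nra.
    - assert (I : (exp (c * (x - x)) * Cmod (F x) ^ 2 <= exp (c * (y - x)) * Cmod (F y) ^ 2)%R).
      { apply (deriv_nonneg_incr (fun t => exp (c * (t - x)) * Cmod (F t) ^ 2)%R
           (fun t => c * exp (c * (t - x)) * Cmod (F t) ^ 2 + exp (c * (t - x)) *
              (2 * Re (RtoC (exp (k * (t - a))) * (q t * Y t) * Cconj (F t))))%R); [exact Hxy |].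
        intros t Ht; split.
        - apply (is_derive_Rmult (fun t => exp (c * (t - x)))%R (fun t => Cmod (F t) ^ 2)%R);
            [apply is_derive_exp_affine | apply Hd, Ht].
        - pose proof (scaled_deriv_bound t ltac:(lra)) as B. fold c in B.
          pose proof (Rle_abs (- (2 * Re (RtoC (exp (k * (t - a))) * (q t * Y t) * Cconj (F t))))) as B'.
          rewrite Rabs_Ropp in B'.
          pose proof (exp_pos (c * (t - x))). nra. }
      rewrite E0 in I. nra. }
  intros Hx Hy.
  assert (S : (Cmod (F x) ^ 2 <= 4 * Cmod (F y) ^ 2)%R).
  { destruct (Rle_lt_dec x y) as [h | h]; [apply (Hsq x y) | apply (Hsq y x)]; lra. }
  apply Rsqr_incr_0; [rewrite 2 Rsqr_pow2; nra | apply Cmod_ge_0 |].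
  pose proof (Cmod_ge_0 (F y)); lra.
Qed.

Hypothesis Hlen2 : (4 <= k * (b - a))%R.

Lemma scaled_Cmod (x : R) : Cmod (F x) = (exp (k * (x - a)) * Cmod (z x))%R.
Proof. unfold F; rewrite Cmod_mult, Cmod_exp; reflexivity. Qed.

Lemma exp_scaled_start : exp (k * (a - a)) = 1%R.
Proof. replace (k * (a - a))%R with 0%R by ring. apply exp_0. Qed.

Lemma scaled_start : Cmod (F a) = Cmod (z a).
Proof. rewrite scaled_Cmod, exp_scaled_start; ring. Qed.

Lemma decaying_decay (x : R) : (a <= x <= b)%R ->
  (Cmod (z x) <= 2 * exp (- k * (x - a)) * Cmod (z a))%R.
Proof.
  intro Hx. pose proof (scaled_growth x a Hx ltac:(lra)) as G. rewrite scaled_Cmod, scaled_start in G.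
  assert (E : (exp (- k * (x - a)) * exp (k * (x - a)) = 1)%R).
  { rewrite <- exp_plus. replace (- k * (x - a) + k * (x - a))%R with 0%R by ring. apply exp_0. }
  apply Rmult_le_compat_l with (r := exp (- k * (x - a))) in G; [| apply Rlt_le, exp_pos].
  rewrite <- Rmult_assoc, E in G. lra.
Qed.

(** [G = exp (- k (x - a)) w] has derivative [exp (- k (x - a)) q Y], of modulus at most
    [(2 Q / k) exp (- 2 k (x - a)) |z a|]. Its increment is thus at most [Q / k ^ 2 <= 1 / 4] of
    [|z a|]. At [b] two factors [exp (- k (b - a)) <= 1 / 5] leave [2 / 25] of it, and the sum is
    below one half. *)
Lemma growing_small_start : (Cmod (w a) <= Cmod (z a) / 2)%R.
Proof.
  assert (HQ0 : (0 <= Q)%R).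
  { eapply Rle_trans; [apply Cmod_ge_0 | apply (HQ a); lra]. }
  set (Z := Cmod (z a)). assert (HZ : (0 <= Z)%R) by apply Cmod_ge_0.
  set (G := fun x => RtoC (exp (- k * (x - a))) * w x).
  assert (HG : (Cmod (G b - G a) <= Q / k ^ 2 * Z)%R).
  { eapply Rle_trans.
    - apply (mean_value_ineq G (fun x => RtoC (exp (- k * (x - a))) * (q x * Y x))
               (fun x => - (Q / k ^ 2) * Z * exp (- (2 * k) * (x - a)))%R
               (fun x => - (Q / k ^ 2) * Z * (- (2 * k) * exp (- (2 * k) * (x - a))))%R); [lra | | |].
      + intros x Hx. destruct (Hode x Hx) as [D0 D1]. eapply cderiv_eq.
        * apply cderiv_mult.
          -- apply cderiv_RtoC, is_derive_exp_affine.
          -- apply cderiv_plus; [exact D1 | apply cderiv_scal, D0].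
        * unfold w. rewrite RtoC_mult, RtoC_opp, RtoC_pow. ring.
      + intros x Hx. apply (is_derive_scal (fun x => exp (- (2 * k) * (x - a)))%R), is_derive_exp_affine.
      + intros x Hx. rewrite 2 Cmod_mult, Cmod_exp.
        pose proof (value_le_decaying x Hx) as H1. pose proof (HQ x Hx) as H2.
        pose proof (Cmod_ge_0 (Y x)) as H3. pose proof (Cmod_ge_0 (q x)) as H4.
        pose proof (decaying_decay x Hx) as H5. fold Z in H5.
        set (e := exp (- k * (x - a))) in *. assert (He : (0 < e)%R) by apply exp_pos.
        assert (E2 : exp (- (2 * k) * (x - a)) = (e * e)%R).
        { unfold e. rewrite <- exp_plus. f_equal. ring. }
        rewrite E2.
        assert (H6 : (Cmod (Y x) <= 2 * e * Z / k)%R).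
        { apply Rmult_le_reg_l with k; [lra |].
          replace (k * (2 * e * Z / k))%R with (2 * e * Z)%R by (field; lra). lra. }
        assert (H7 : (Cmod (q x) * Cmod (Y x) <= Q * (2 * e * Z / k))%R) by (apply Rmult_le_compat; lra).
        replace (- (Q / k ^ 2) * Z * (- (2 * k) * (e * e)))%R with (e * (Q * (2 * e * Z / k)))%R
          by (field; lra).
        apply Rmult_le_compat_l; lra.
    - replace (- (2 * k) * (a - a))%R with 0%R by ring. rewrite exp_0.
      assert (H : (0 <= Q / k ^ 2 * Z)%R).
      { apply Rmult_le_pos; [apply Rdiv_le_0_compat; nra | exact HZ]. }
      pose proof (exp_pos (- (2 * k) * (b - a))). nra. }
  assert (Eb : (exp (- k * (b - a)) <= / 5)%R).
  { replace (- k * (b - a))%R with (- (k * (b - a)))%R by ring. rewrite exp_Ropp.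
    apply Rinv_le_contravar; [lra |]. pose proof (exp_ineq1 (k * (b - a)) ltac:(lra)). lra. }
  assert (Gb : (Cmod (G b) <= 2 * / 5 * / 5 * Z)%R).
  { unfold G. rewrite Cmod_mult, Cmod_exp.
    pose proof (growing_le_decaying b ltac:(lra)) as W. pose proof (decaying_decay b ltac:(lra)) as W2. fold Z in W2.
    pose proof (Cmod_ge_0 (w b)). pose proof (exp_pos (- k * (b - a))).
    assert (Cmod (w b) <= 2 * / 5 * Z)%R by nra. nra. }
  assert (Ga : Cmod (G a) = Cmod (w a)).
  { unfold G. rewrite Cmod_mult, Cmod_exp. replace (- k * (a - a))%R with 0%R by ring. rewrite exp_0. ring. }
  pose proof (Cmod_triangle (G b) (- (G b - G a))) as T.
  replace (G b + - (G b - G a)) with (G a) in T by ring. rewrite Cmod_opp, Ga in T.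
  assert (Q / k ^ 2 <= / 4)%R.
  { apply Rmult_le_reg_l with (k ^ 2)%R; [nra |].
    replace (k ^ 2 * (Q / k ^ 2))%R with Q by (field; lra). lra. }
  nra.
Qed.

Lemma decaying_le_value : (Cmod (z a) <= 4 * k * Cmod (Y a))%R.
Proof.
  pose proof growing_small_start as H.
  pose proof (Cmod_triangle (w a) (- (RtoC (2 * k) * Y a))) as T.
  replace (w a + - (RtoC (2 * k) * Y a)) with (z a) in T
    by (unfold w, z; rewrite RtoC_mult; ring).
  rewrite Cmod_opp, Cmod_mult, Cmod_R, Rabs_pos_eq in T by lra. lra.
Qed.

(** One factor [exp (- k l)] of the final error; the second one comes from [jost_wronskian]. *)
Lemma growing_small_end :
  (Cmod (Y1 b + RtoC k * Y b) <= 8 * k * exp (- k * (b - a)) * Cmod (Y a))%R.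
Proof.
  pose proof (growing_le_decaying b ltac:(lra)) as H1. pose proof (decaying_decay b ltac:(lra)) as H2.
  pose proof decaying_le_value as H3. pose proof (exp_pos (- k * (b - a))).
  unfold w in H1. nra.
Qed.

(** [Y a = 0] would force [z a = 0], while [Y1 a = 0] would give [w a = - z a], against
    [growing_small_start]. The statement on [Y1] is what keeps [Delta1] away from zero. *)
Lemma decay_nonzero : (Y a <> 0 \/ Y1 a <> 0) -> Y a <> 0 /\ Y1 a <> 0.
Proof.
  intro H. pose proof decaying_le_value as H1. pose proof growing_small_start as H2.
  assert (Hz : (0 < Cmod (z a))%R).
  { destruct (Req_dec (Cmod (z a)) 0) as [E | E]; [| pose proof (Cmod_ge_0 (z a)); lra].
    pose proof (Cmod_ge_0 (w a)) as W.
    assert (Ew : w a = 0) by (apply Cmod_eq_0; lra).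
    apply Cmod_eq_0 in E.
    pose proof (value_le_decaying a ltac:(lra)) as Hy. rewrite E, Cmod_0 in Hy.
    pose proof (Cmod_ge_0 (Y a)).
    assert (EY : Y a = 0) by (apply Cmod_eq_0; nra).
    unfold w in Ew. rewrite EY in Ew, H.
    assert (Y1 a = 0) by (rewrite <- Ew; ring). destruct H; contradiction. }
  split; intro E.
  - rewrite E, Cmod_0 in H1. lra.
  - replace (w a) with (- z a) in H2 by (unfold w, z; rewrite E; ring).
    rewrite Cmod_opp in H2. lra.
Qed.

(** [scaled_growth] plays the part of uniqueness for the initial value problem at [b]; the result
    hands nontriviality on to the next interval. *)
Lemma decay_nonzero_end : (Y a <> 0 \/ Y1 a <> 0) -> Y b <> 0 \/ Y1 b <> 0.
Proof.
  intro H.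
  destruct (excluded_middle_informative (Y b = 0)) as [E0 | E0]; [| now left].
  destruct (excluded_middle_informative (Y1 b = 0)) as [E1 | E1]; [| now right].
  exfalso. destruct (decay_nonzero H) as [Ha _]. apply Ha, Cmod_eq_0.
  pose proof (scaled_growth a b ltac:(lra) ltac:(lra)) as G. rewrite scaled_start, scaled_Cmod in G.
  assert (Ez : z b = 0) by (unfold z; rewrite E0, E1; ring).
  rewrite Ez, Cmod_0 in G. pose proof (value_le_decaying a ltac:(lra)). pose proof (Cmod_ge_0 (Y a)). nra.
Qed.
End Decay.

(** * Finite differences in the spectral parameter *)

(** [(-1) ^ m] times the forward difference; with this sign the images of decaying exponentials are
    nonnegative. *)
Fixpoint fdiff (nu : R) (m : nat) (F : R -> C) (k : R) : C :=
  match m with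
  | O => F k
  | S m' => fdiff nu m' F k - fdiff nu m' F (k + nu)
  end.

Section FiniteDifferences.
Variable nu : R.
Hypothesis Hnu : (0 <= nu)%R.

Lemma fdiff_ext (m : nat) (F G : R -> C) (k : R) :
  (forall k', (k <= k')%R -> F k' = G k') -> fdiff nu m F k = fdiff nu m G k.
Proof.
  revert k; induction m as [| m IH]; intros k H; simpl.
  - apply H; lra.
  - rewrite (IH k H), (IH (k + nu)%R); [reflexivity |]. intros; apply H; lra.
Qed.

Lemma fdiff_plus (m : nat) (F G : R -> C) (k : R) :
  fdiff nu m (fun k => F k + G k) k = fdiff nu m F k + fdiff nu m G k.
Proof.
  revert k; induction m as [| m IH]; intro k; simpl; [reflexivity | rewrite 2 IH; ring].
Qed.

Lemma fdiff_scal (m : nat) (c : C) (F : R -> C) (k : R) :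
  fdiff nu m (fun k => c * F k) k = c * fdiff nu m F k.
Proof.
  revert k; induction m as [| m IH]; intro k; simpl; [reflexivity | rewrite 2 IH; ring].
Qed.

Lemma fdiff_deriv (m : nat) (F : R -> R -> C) (F' : R -> C) (x k : R) :
  (forall k', (k <= k')%R -> cderiv (fun s => F s k') x (F' k')) ->
  cderiv (fun s => fdiff nu m (F s) k) x (fdiff nu m F' k).
Proof.
  revert k; induction m as [| m IH]; intros k H; simpl.
  - apply H; lra.
  - apply cderiv_minus; apply IH; intros; apply H; lra.
Qed.

Lemma fdiff_exp (m : nat) (d k : R) :
  fdiff nu m (fun k => RtoC (exp (- (k * d)))) k
  = RtoC (exp (- (k * d)) * (1 - exp (- (nu * d))) ^ m).
Proof.
  revert k; induction m as [| m IH]; intro k; simpl.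
  - f_equal; ring.
  - rewrite 2 IH, <- RtoC_minus. f_equal.
    replace (- ((k + nu) * d))%R with (- (k * d) + - (nu * d))%R by ring.
    rewrite exp_plus. ring.
Qed.

(** No cancellation is available for a function bounded only in modulus, so each difference costs a
    factor [1 + exp (- (nu * d))], which is close to 1 for large [nu]. *)
Lemma fdiff_bound (m : nat) (F : R -> C) (B d k : R) :
  (forall k', (k <= k')%R -> (Cmod (F k') <= B * exp (- (k' * d)))%R) ->
  (Cmod (fdiff nu m F k) <= B * exp (- (k * d)) * (1 + exp (- (nu * d))) ^ m)%R.
Proof.
  revert k; induction m as [| m IH]; intros k H; simpl.
  - rewrite Rmult_1_r; apply H; lra.
  - eapply Rle_trans; [apply Cmod_triangle |]. rewrite Cmod_opp.
    assert (I1 := IH k H).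
    assert (I2 := IH (k + nu)%R ltac:(intros; apply H; lra)).
    replace (- ((k + nu) * d))%R with (- (k * d) + - (nu * d))%R in I2 by ring.
    rewrite exp_plus in I2. lra.
Qed.

Lemma fdiff_bounded (I : Type) (m : nat) (F : I -> R -> C) (k : R) :
  (forall k', (k <= k')%R -> exists B, forall i, (Cmod (F i k') <= B)%R) ->
  exists B, forall i, (Cmod (fdiff nu m (F i) k) <= B)%R.
Proof.
  revert k; induction m as [| m IH]; intros k H; simpl.
  - apply H; lra.
  - destruct (IH k H) as [B1 H1].
    destruct (IH (k + nu)%R ltac:(intros; apply H; lra)) as [B2 H2].
    exists (B1 + B2)%R; intro i.
    eapply Rle_trans; [apply Cmod_triangle |]. rewrite Cmod_opp.
    specialize (H1 i); specialize (H2 i); lra.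
Qed.
End FiniteDifferences.

(** The nodes are [nu, 2 nu, ..., (m + 1) nu], so only [k >= nu] matters; the prefactor normalizes
    the mass of [bump]. *)
Definition probe (nu : R) (m : nat) (F : R -> C) : C :=
  RtoC (2 * nu * INR (S m)) * fdiff nu m F nu.

(* The image of [exp (- 2 k r)] under [probe]; it has total mass [1] on
   [r >= 0], and [bump_tail] is its mass beyond [r]. *)
Definition bump (nu : R) (m : nat) (r : R) : R :=
  (2 * nu * INR (S m) * exp (- (2 * nu * r)) * (1 - exp (- (2 * nu * r))) ^ m)%R.

Definition bump_tail (nu : R) (m : nat) (r : R) : R :=
  (1 - (1 - exp (- (2 * nu * r))) ^ S m)%R.

Section Probe.
Variables (nu : R) (m : nat).
Hypothesis Hnu : (0 < nu)%R.

Lemma probe_ext (F G : R -> C) :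
  (forall k, (nu <= k)%R -> F k = G k) -> probe nu m F = probe nu m G.
Proof. intro H; unfold probe; f_equal; apply fdiff_ext; [lra | exact H]. Qed.

Lemma probe_plus (F G : R -> C) :
  probe nu m (fun k => F k + G k) = probe nu m F + probe nu m G.
Proof. unfold probe; rewrite fdiff_plus; ring. Qed.

Lemma probe_scal (c : C) (F : R -> C) :
  probe nu m (fun k => c * F k) = c * probe nu m F.
Proof. unfold probe; rewrite fdiff_scal; ring. Qed.

Lemma probe_deriv (F : R -> R -> C) (F' : R -> C) (x : R) :
  (forall k, (nu <= k)%R -> cderiv (fun s => F s k) x (F' k)) ->
  cderiv (fun s => probe nu m (F s)) x (probe nu m F').
Proof. intro H; apply cderiv_scal, fdiff_deriv; [lra | exact H]. Qed.

Lemma scale_pos : (0 < 2 * nu * INR (S m))%R.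
Proof.
  apply Rmult_lt_0_compat; [lra |]. rewrite S_INR. pose proof (pos_INR m); lra.
Qed.

Lemma probe_bound (F : R -> C) (B d : R) :
  (forall k, (nu <= k)%R -> (Cmod (F k) <= B * exp (- (k * d)))%R) ->
  (Cmod (probe nu m F)
     <= 2 * nu * INR (S m) * (B * exp (- (nu * d)) * (1 + exp (- (nu * d))) ^ m))%R.
Proof.
  intro H. pose proof scale_pos as P. unfold probe. rewrite Cmod_mult, Cmod_R, Rabs_pos_eq by lra.
  apply Rmult_le_compat_l; [lra |]. apply fdiff_bound; [lra | exact H].
Qed.

Lemma probe_bounded (I : Type) (F : I -> R -> C) :
  (forall k, (nu <= k)%R -> exists B, forall i, (Cmod (F i k) <= B)%R) ->
  exists B, (0 <= B)%R /\ forall i, (Cmod (probe nu m (F i)) <= B)%R.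
Proof.
  intro H. pose proof scale_pos as P.
  destruct (fdiff_bounded nu ltac:(lra) I m F nu H) as [B HB].
  exists (2 * nu * INR (S m) * Rmax 0 B)%R. split.
  - apply Rmult_le_pos; [lra | apply Rmax_l].
  - intro i. unfold probe. rewrite Cmod_mult, Cmod_R, Rabs_pos_eq by lra.
    apply Rmult_le_compat_l; [lra |]. eapply Rle_trans; [apply HB | apply Rmax_r].
Qed.

Lemma probe_exp (r : R) :
  probe nu m (fun k => RtoC (exp (- (2 * k * r)))) = RtoC (bump nu m r).
Proof.
  unfold probe, bump.
  rewrite (fdiff_ext nu ltac:(lra) m _ (fun k => RtoC (exp (- (k * (2 * r)))))).
  - rewrite fdiff_exp, <- RtoC_mult. f_equal.
    replace (nu * (2 * r))%R with (2 * nu * r)%R by ring. ring.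
  - intros; do 3 f_equal; ring.
Qed.

Lemma exp_neg_bounds (r : R) : (0 <= r)%R -> (0 < exp (- (2 * nu * r)) <= 1)%R.
Proof.
  intro Hr. split; [apply exp_pos |].
  rewrite <- exp_0. destruct Hr as [Hr | <-].
  2: right; f_equal; ring.
  apply Rlt_le, exp_increasing. assert (0 < nu * r)%R by (apply Rmult_lt_0_compat; lra). lra.
Qed.

Lemma bump_nonneg (r : R) : (0 <= r)%R -> (0 <= bump nu m r)%R.
Proof.
  intro Hr. pose proof (exp_neg_bounds r Hr). pose proof scale_pos.
  unfold bump. apply Rmult_le_pos; [apply Rmult_le_pos; lra | apply pow_le; lra].
Qed.

Lemma bump_tail_deriv (r : R) : is_derive (bump_tail nu m) r (- bump nu m r)%R.
Proof.
  unfold bump_tail, bump. auto_derive; [trivial |].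
  change (Init.Nat.pred (S m)) with m. rewrite S_INR.
  set (e := exp _). set (p := ((1 + - e) ^ m)%R).
  change ((1 - e) ^ m)%R with p.
  replace (match m with 0%nat => 1%R | S _ => (INR m + 1)%R end) with (INR m + 1)%R
    by (destruct m; simpl; ring).
  match goal with |- ?x = ?y => change (@eq R x y) end. ring.
Qed.

Lemma bump_tail_bounds (r : R) : (0 <= r)%R -> (0 <= bump_tail nu m r <= 1)%R.
Proof.
  intro Hr. pose proof (exp_neg_bounds r Hr) as H. unfold bump_tail.
  assert (0 <= (1 - exp (- (2 * nu * r))) ^ S m <= 1)%R; [| lra].
  split; [apply pow_le; lra |]. apply Rle_trans with (1 ^ S m)%R; [apply pow_incr; lra | rewrite pow1; lra].
Qed.

Lemma bump_tail_decr (r s : R) : (0 <= r <= s)%R -> (bump_tail nu m s <= bump_tail nu m r)%R.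
Proof.
  intro H. apply (deriv_nonpos_decr (bump_tail nu m) (fun t => - bump nu m t)%R); [lra |].
  intros t Ht. split; [apply bump_tail_deriv |]. pose proof (bump_nonneg t ltac:(lra)); lra.
Qed.
End Probe.

(** * Products of Jost solutions as superpositions of exponentials *)

Lemma cderiv_bounded (f f' : R -> C) (a b : R) :
  (a <= b)%R -> (forall x, (a <= x <= b)%R -> cderiv f x (f' x)) ->
  exists B, forall x, (a <= x <= b)%R -> (Cmod (f x) <= B)%R.
Proof.
  intros Hab H.
  destruct (continuity_ab_maj (fun x => Cmod (f x) ^ 2)%R a b Hab) as [x0 [Hx0 _]].
  - intros x Hx. eapply is_derive_continuity, is_derive_norm_sq, H, Hx.
  - exists (1 + Cmod (f x0) ^ 2)%R. intros x Hx. specialize (Hx0 x Hx). simpl in *. nra.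
Qed.

(* [p] is [exp (k (x - b))] times the solution of [y'' = (q + k ^ 2) y] with
   [y b = 1] and [y' b = - k]. *)
Definition jost (a b k : R) (q p p1 : R -> C) : Prop :=
  (forall x, (a <= x <= b)%R ->
     cderiv p x (p1 x) /\ cderiv p1 x (RtoC (2 * k) * p1 x + q x * p x)) /\
  p b = 1 /\ p1 b = 0.

(** Chosen so that [Q * (1 + l)] is at most half of it, which makes the iteration in [transmutation]
    contract; the summand 1 keeps it positive when [Q = 0]. *)
Definition jost_rate (Q l : R) : R := (2 * Q * (1 + l) + 1)%R.

(** The Laplace kernel. Multiplying a superposition of exponentials by [damp k r] translates its
    density by [r]. *)
Definition damp (k r : R) : C := RtoC (exp (- (2 * k * r))).

Lemma damp_plus (k r s : R) : damp k (r + s) = damp k r * damp k s.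
Proof.
  unfold damp. rewrite <- RtoC_mult, <- exp_plus. do 2 f_equal. ring.
Qed.

Lemma damp_0 (k : R) : damp k 0 = 1.
Proof. unfold damp. replace (- (2 * k * 0))%R with 0%R by ring. now rewrite exp_0. Qed.

Lemma damp_shift_deriv (k a r : R) :
  cderiv (fun r => damp k (r - a)) r (- (RtoC (2 * k) * damp k (r - a))).
Proof.
  unfold damp. rewrite <- RtoC_mult, <- RtoC_opp. apply cderiv_RtoC.
  eapply is_derive_eq; [auto_derive; [trivial | reflexivity] |].
  match goal with |- ?x = ?y => change (@eq R x y) end. unfold Rminus. ring.
Qed.

Lemma damp_deriv (k r : R) : cderiv (damp k) r (- (RtoC (2 * k) * damp k r)).
Proof.
  pose proof (damp_shift_deriv k 0 r) as D. rewrite Rminus_0_r in D.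
  revert D. apply cderiv_ext. intro t. now rewrite Rminus_0_r.
Qed.

Lemma damp_le_1 (k r : R) : (0 <= k)%R -> (0 <= r)%R -> (Cmod (damp k r) <= 1)%R.
Proof.
  intros Hk Hr. unfold damp. rewrite Cmod_exp. rewrite <- exp_0.
  assert (0 <= k * r)%R by (apply Rmult_le_pos; assumption).
  destruct (Req_dec (k * r) 0) as [E | E].
  - right; f_equal. rewrite Rmult_assoc, E. ring.
  - apply Rlt_le, exp_increasing. nra.
Qed.

Section Transmutation.
Variables (a b Q nu M : R) (m : nat) (q : R -> C) (w : R -> C) (p p1 : R -> R -> C).
Hypothesis Hab : (a < b)%R.
Hypothesis Hnu : (0 < nu)%R.
Hypothesis HQ : forall x, (a <= x <= b)%R -> (Cmod (q x) <= Q)%R.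
Hypothesis Hp : forall k, (nu <= k)%R -> jost a b k q (fun x => p x k) (fun x => p1 x k).
Hypothesis HM : (0 <= M)%R.
(** What the probe sees of a weight [w] that is a unit mass at 0 plus a density of modulus at most
    [M]. It is applied with [w = 1] and then with [w = p x] for fixed [x], which yields products. *)
Hypothesis Hw : forall r, (0 <= r)%R ->
  (Cmod (probe nu m (fun k => damp k r * w k)%C) <= bump nu m r + M * bump_tail nu m r)%R.

Let l := (b - a)%R.
Let g (x r : R) : C := probe nu m (fun k => damp k r * (w k * (p x k - 1))).

(* Crude: only needed to start the iteration in [transmutation]. *)
Lemma correction_bounded : exists B, (0 <= B)%R /\
  forall x r, (a <= x <= b)%R -> (0 <= r)%R -> (Cmod (g x r) <= B)%R.
Proof.
  destruct (probe_bounded nu m Hnu {xr : R * R | (a <= fst xr <= b)%R /\ (0 <= snd xr)%R}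
              (fun i k => damp k (snd (proj1_sig i)) * (w k * (p (fst (proj1_sig i)) k - 1))))
    as [B [HB H]].
  - intros k Hk. destruct (Hp k Hk) as [D _].
    destruct (cderiv_bounded (fun x => p x k - 1) (fun x => p1 x k) a b ltac:(lra)) as [B HB].
    + intros x Hx. eapply cderiv_eq; [apply cderiv_minus; [apply D, Hx | apply cderiv_const] | ring].
    + exists (Cmod (w k) * B)%R. intros [[x r] [Hx Hr]]; simpl in *.
      rewrite 2 Cmod_mult. pose proof (damp_le_1 k r ltac:(lra) Hr) as H1.
      pose proof (HB x Hx) as H2. pose proof (Cmod_ge_0 (w k)) as H3.
      pose proof (Cmod_ge_0 (p x k - 1)) as H4. pose proof (Cmod_ge_0 (damp k r)) as H5.
      assert (Cmod (w k) * Cmod (p x k - 1) <= Cmod (w k) * B)%R by nra.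
      assert (0 <= Cmod (w k) * Cmod (p x k - 1))%R by nra. nra.
  - exists B; split; [exact HB |]. intros x r Hx Hr.
    apply (H (exist _ (x, r) (conj Hx Hr))).
Qed.

Let Lam := jost_rate Q l.
(** A weight of Bielecki type: integrating it from [x] to [b] gains [1 / Lam], so one contraction
    covers the whole interval. *)
Let W (s : R) : R := exp (Lam * (b - s)).

Lemma potential_bound_nonneg : (0 <= Q)%R.
Proof. eapply Rle_trans; [apply Cmod_ge_0 | apply (HQ a); lra]. Qed.

Lemma rate_pos : (0 < Lam)%R.
Proof. pose proof potential_bound_nonneg. unfold Lam, jost_rate, l. nra. Qed.

Lemma weight_ge_1 (s : R) : (a <= s <= b)%R -> (1 <= W s)%R.
Proof.
  intro Hs. unfold W. pose proof rate_pos.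
  pose proof (exp_ineq1_le (Lam * (b - s))). nra.
Qed.

(* Variation of constants: for fixed [x], the derivative in [s] of
   [p s - p1 s * (1 - exp (-2k(s-x))) / (2k)] is
   [- q s * p s * (1 - exp (-2k(s-x))) / (2k)]. *)
Lemma correction_step (A B : R) : (0 <= A)%R -> (0 <= B)%R ->
  (forall x r, (a <= x <= b)%R -> (0 <= r)%R ->
     (Cmod (g x r) <= (A * bump_tail nu m r + B) * W x)%R) ->
  forall x r, (a <= x <= b)%R -> (0 <= r)%R ->
     (Cmod (g x r) <= Q / Lam * ((1 + l * M + l * A) * bump_tail nu m r + l * B) * W x)%R.
Proof.
  intros HA HB IH x r Hx Hr.
  pose proof rate_pos as HL. pose proof potential_bound_nonneg as HQ0.
  pose proof (bump_tail_bounds nu m Hnu r Hr) as Ht.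
  set (K := ((1 + l * M + l * A) * bump_tail nu m r + l * B)%R).
  assert (Hl : (0 < l)%R) by (unfold l; lra).
  set (h := fun s => probe nu m (fun k => damp k r * (w k *
     (p s k - p1 s k * (RtoC (/ (2 * k)) * (1 - damp k (s - x))) - 1)))).
  (* [(1 - damp k rho) / (2 k)] is the integral of [damp k] over [[0, rho]]. The derivative of [V]
     in [rho] is therefore free of [1 / (2 k)] and is controlled by [Hw] and [IH]. *)
  set (V := fun s rho => probe nu m (fun k => damp k r * (w k *
     (p s k * (RtoC (/ (2 * k)) * (1 - damp k rho)))))).
  assert (Hinv : forall k, (nu <= k)%R -> RtoC (/ (2 * k)) * RtoC (2 * k) = 1).
  { intros k Hk. rewrite <- RtoC_mult. f_equal. field. lra. }
  assert (Dh : forall s, (a <= s <= b)%R -> cderiv h s (- q s * V s (s - x)%R)).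
  { intros s Hs. unfold V. rewrite <- probe_scal. apply probe_deriv; [exact Hnu |].
    intros k Hk. destruct (Hp k Hk) as [D _]. destruct (D s Hs) as [D0 D1].
    eapply cderiv_eq.
    - apply cderiv_scal, cderiv_scal, cderiv_minus; [apply cderiv_minus | apply cderiv_const].
      + exact D0.
      + apply cderiv_mult; [exact D1 |].
        apply cderiv_scal, cderiv_minus; [apply cderiv_const | apply damp_shift_deriv].
    - transitivity (damp k r * (w k * (p1 s k
         - ((RtoC (/ (2 * k)) * RtoC (2 * k)) * p1 s k * (1 - damp k (s - x))
            + q s * p s k * (RtoC (/ (2 * k)) * (1 - damp k (s - x)))
            + p1 s k * ((RtoC (/ (2 * k)) * RtoC (2 * k)) * damp k (s - x)))))); [ring |].
      rewrite (Hinv k Hk). ring. }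
  assert (BV : forall s, (x <= s <= b)%R -> (Cmod (V s (s - x)%R) <= K * W s)%R).
  { intros s Hs. pose proof (weight_ge_1 s ltac:(lra)) as HW.
    (* Everything except the peak [bump]: the density of [w] and the correction [g], both estimated
       at [rho = 0] because [bump_tail] decreases. *)
    set (N := (M * bump_tail nu m r + (A * bump_tail nu m r + B) * W s)%R).
    assert (HN : (0 <= N)%R).
    { unfold N. apply Rplus_le_le_0_compat; [nra |]. apply Rmult_le_pos; [nra | lra]. }
    assert (E0 : V s 0%R = 0).
    { unfold V. transitivity (probe nu m (fun k => 0 * 0)).
      - apply probe_ext; [exact Hnu |]. intros k Hk. rewrite damp_0. ring.
      - rewrite probe_scal. ring. }
    assert (I : (Cmod (V s (s - x)%R - V s 0%R)
        <= (- bump_tail nu m (r + (s - x)) + N * (s - x)) - (- bump_tail nu m (r + 0) + N * 0))%R).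
    { apply (mean_value_ineq (V s) (fun rho => probe nu m (fun k => damp k (r + rho) * (w k * p s k)))
         (fun rho => - bump_tail nu m (r + rho) + N * rho)%R
         (fun rho => bump nu m (r + rho) + N)%R); [lra | | |].
      - intros rho Hrho. apply probe_deriv; [exact Hnu |]. intros k Hk. eapply cderiv_eq.
        + do 4 apply cderiv_scal. apply cderiv_minus; [apply cderiv_const | apply damp_deriv].
        + rewrite damp_plus.
          transitivity (damp k r * (w k * (p s k * ((RtoC (/ (2 * k)) * RtoC (2 * k)) * damp k rho)))); [ring |].
          rewrite (Hinv k Hk). ring.
      - intros rho Hrho. eapply is_derive_eq.
        + apply (is_derive_plus (K:=R_AbsRing) (V:=R_NormedModule)
             (fun rho => - bump_tail nu m (r + rho))%R (fun rho => N * rho)%R).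
          * apply (is_derive_opp (K:=R_AbsRing) (V:=R_NormedModule) (fun rho => bump_tail nu m (r + rho))).
            apply (is_derive_comp (K:=R_AbsRing) (V:=R_NormedModule) (bump_tail nu m) (fun rho => r + rho)%R).
            -- apply bump_tail_deriv.
            -- apply (is_derive_plus (K:=R_AbsRing) (V:=R_NormedModule) (fun _ => r) (fun rho => rho)).
               ++ apply (is_derive_const (K:=R_AbsRing) (V:=R_NormedModule)).
               ++ apply (is_derive_id (K:=R_AbsRing)).
          * apply (is_derive_scal (fun rho => rho)), (is_derive_id (K:=R_AbsRing)).
        + unfold plus, opp, scal, zero, one; simpl; unfold mult; simpl. ring.
      - intros rho Hrho.
        assert (Hrr : (0 <= r + rho)%R) by lra.
        assert (E : probe nu m (fun k => damp k (r + rho) * (w k * p s k))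
                    = probe nu m (fun k => damp k (r + rho) * w k) + g s (r + rho)%R).
        { unfold g. rewrite <- probe_plus. apply probe_ext; [exact Hnu |]. intros; ring. }
        rewrite E. eapply Rle_trans; [apply Cmod_triangle |].
        pose proof (Hw (r + rho)%R Hrr) as H1.
        pose proof (IH s (r + rho)%R ltac:(lra) Hrr) as H2.
        pose proof (bump_tail_decr nu m Hnu r (r + rho) ltac:(lra)) as H3.
        unfold N.
        assert (M * bump_tail nu m (r + rho) <= M * bump_tail nu m r)%R by nra.
        assert ((A * bump_tail nu m (r + rho) + B) * W s <= (A * bump_tail nu m r + B) * W s)%R
          by (apply Rmult_le_compat_r; nra).
        lra. }
    rewrite E0 in I. replace (V s (s - x)%R - 0) with (V s (s - x)%R) in I by ring.
    rewrite Rplus_0_r, Rmult_0_r in I.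
    pose proof (bump_tail_bounds nu m Hnu (r + (s - x)) ltac:(lra)) as T2.
    assert (N * (s - x) <= N * l)%R by (apply Rmult_le_compat_l; [exact HN | unfold l; lra]).
    assert (E1 : (N * l = l * M * bump_tail nu m r + (l * A * bump_tail nu m r + l * B) * W s)%R)
      by (unfold N; ring).
    assert (H5 : (bump_tail nu m r * (1 + l * M) <= bump_tail nu m r * (1 + l * M) * W s)%R).
    { assert (0 <= bump_tail nu m r * (1 + l * M))%R by (apply Rmult_le_pos; nra). nra. }
    unfold K. nra. }
  assert (HK : (0 <= K)%R).
  { unfold K. assert (0 <= l * M)%R by nra. assert (0 <= l * A)%R by nra.
    assert (0 <= l * B)%R by nra. nra. }
  (* [W' = - Lam * W], so passing from [h'] to [h] costs [1 / Lam]. At [b] the terminal values make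
     [h] vanish, and at [x] the damping bracket vanishes, so that [h x = g x r]. *)
  assert (I : (Cmod (h b - h x) <= (- (Q / Lam * K) * W b) - (- (Q / Lam * K) * W x))%R).
  { apply (mean_value_ineq h (fun s => - q s * V s (s - x)%R) (fun s => - (Q / Lam * K) * W s)%R
       (fun s => - (Q / Lam * K) * (- Lam * W s))%R); [lra | | |].
    - intros s Hs. apply Dh; lra.
    - intros s Hs. apply (is_derive_scal W). unfold W.
      eapply is_derive_eq; [auto_derive; [trivial | reflexivity] |].
      match goal with |- ?x = ?y => change (@eq R x y) end. unfold Rminus. ring.
    - intros s Hs. rewrite Cmod_mult, Cmod_opp.
      replace (- (Q / Lam * K) * (- Lam * W s))%R with (Q * (K * W s))%R by (field; lra).
      apply Rmult_le_compat; [apply Cmod_ge_0 | apply Cmod_ge_0 | apply HQ; lra | apply BV; lra]. }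
  assert (Eb : h b = 0).
  { unfold h. transitivity (probe nu m (fun k => 0 * 0)).
    - apply probe_ext; [exact Hnu |]. intros k Hk. destruct (Hp k Hk) as [_ [E1 E2]].
      rewrite E1, E2. ring.
    - rewrite probe_scal. ring. }
  assert (Ex : h x = g x r).
  { unfold h, g. apply probe_ext; [exact Hnu |]. intros k Hk.
    replace (x - x)%R with 0%R by ring. rewrite damp_0. ring. }
  rewrite Eb, Ex in I. replace (0 - g x r) with (- g x r) in I by ring. rewrite Cmod_opp in I.
  assert (0 <= Q / Lam * K)%R.
  { apply Rmult_le_pos; [apply Rdiv_le_0_compat; lra | exact HK]. }
  pose proof (weight_ge_1 b ltac:(lra)). nra.
Qed.

(** Since [Q / Lam * (1 + l) <= 1 / 2], [correction_step] reproduces the bound with [A = 1 + l * M]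
    and at least halves [B]. Starting from the crude bound, [B] tends to 0: a Neumann series is
    summed at the level of its bounds. *)
Lemma transmutation (x r : R) : (a <= x <= b)%R -> (0 <= r)%R ->
  (Cmod (probe nu m (fun k => damp k r * (w k * (p x k - 1)))%C)
     <= (1 + (b - a) * M) * exp (jost_rate Q (b - a) * (b - x)) * bump_tail nu m r)%R.
Proof.
  intros Hx Hr. fold l. fold Lam. change (exp (Lam * (b - x))) with (W x). fold (g x r).
  pose proof rate_pos as HL. pose proof potential_bound_nonneg as HQ0.
  assert (Hl : (0 < l)%R) by (unfold l; lra).
  set (A := (1 + l * M)%R). assert (HA : (1 <= A)%R) by (unfold A; nra).
  destruct correction_bounded as [B [HB0 HB]].
  assert (H1 : (Q / Lam * (1 + l) <= / 2)%R).
  { apply Rmult_le_reg_l with Lam; [exact HL |].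
    replace (Lam * (Q / Lam * (1 + l)))%R with (Q * (1 + l))%R by (field; lra).
    unfold Lam, jost_rate. lra. }
  assert (H0 : (0 <= Q / Lam)%R) by (apply Rdiv_le_0_compat; lra).
  assert (Hn : forall n x r, (a <= x <= b)%R -> (0 <= r)%R ->
     (Cmod (g x r) <= (A * bump_tail nu m r + B * (/ 2) ^ n) * W x)%R).
  { induction n as [| n IH]; clear x r Hx Hr; intros x r Hx Hr;
      pose proof (weight_ge_1 x Hx) as HW; pose proof (bump_tail_bounds nu m Hnu r Hr) as Ht.
    - simpl. specialize (HB x r Hx Hr).
      assert (0 <= A * bump_tail nu m r)%R by nra. nra.
    - assert (P : (0 < (/ 2) ^ n)%R) by (apply pow_lt; lra).
      assert (PB : (0 <= B * (/ 2) ^ n)%R) by nra.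
      eapply Rle_trans; [apply (correction_step A (B * (/ 2) ^ n) ltac:(lra) PB IH x r Hx Hr) |].
      apply Rmult_le_compat_r; [lra |]. fold A.
      replace (Q / Lam * ((A + l * A) * bump_tail nu m r + l * (B * (/ 2) ^ n)))%R
        with (Q / Lam * (1 + l) * (A * bump_tail nu m r) + Q / Lam * l * (B * (/ 2) ^ n))%R by ring.
      replace (B * (/ 2) ^ S n)%R with (/ 2 * (B * (/ 2) ^ n))%R by (simpl; ring).
      assert (0 <= A * bump_tail nu m r)%R by nra.
      assert (Q / Lam * l <= / 2)%R by nra. nra. }
  apply le_epsilon. intros eps Heps.
  pose proof (weight_ge_1 x Hx) as HW.
  destruct (pow_lt_1_zero (/ 2) ltac:(rewrite Rabs_pos_eq; lra) (eps / ((B + 1) * W x))) as [n Hn'].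
  { apply Rdiv_lt_0_compat; [exact Heps | nra]. }
  specialize (Hn' n (le_n n)). rewrite Rabs_pos_eq in Hn' by (apply pow_le; lra).
  specialize (Hn n x r Hx Hr).
  assert (((/ 2) ^ n * ((B + 1) * W x) < eps)%R).
  { apply Rmult_lt_reg_r with (/ ((B + 1) * W x))%R; [apply Rinv_0_lt_compat; nra |].
    rewrite Rmult_assoc, Rinv_r by nra. unfold Rdiv in Hn'. lra. }
  assert (0 < (/ 2) ^ n)%R by (apply pow_lt; lra).
  assert (0 <= (/ 2) ^ n * W x)%R by nra. nra.
Qed.
End Transmutation.

(** * Uniqueness on one interval *)

Lemma exp_pow_INR (x : R) (n : nat) : (exp x ^ n = exp (INR n * x))%R.
Proof.
  induction n as [| n IH].
  - simpl. rewrite Rmult_0_l, exp_0. reflexivity.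
  - rewrite S_INR. simpl pow. rewrite IH, <- exp_plus. f_equal. ring.
Qed.

Lemma bernoulli_minus (u : R) (n : nat) : (0 <= u <= 1)%R -> (1 - INR n * u <= (1 - u) ^ n)%R.
Proof.
  intro Hu. induction n as [| n IH].
  - simpl. lra.
  - rewrite S_INR. simpl pow. pose proof (pos_INR n).
    assert (0 <= INR n * u)%R by (apply Rmult_le_pos; lra). nra.
Qed.

Lemma exp_neg_le_inv (y : R) : (0 < y)%R -> (exp (- y) <= / y)%R.
Proof.
  intro Hy. rewrite exp_Ropp. apply Rinv_le_contravar; [exact Hy |].
  pose proof (exp_ineq1_le y). lra.
Qed.

Lemma inv_mult_le (x c e : R) : (0 < c)%R -> (0 < e)%R -> (/ (c * e) <= x)%R -> (/ (x * c) <= e)%R.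
Proof.
  intros Hc He H.
  assert (Hce : (0 < / (c * e))%R) by (apply Rinv_0_lt_compat, Rmult_lt_0_compat; assumption).
  rewrite <- (Rinv_inv e). apply Rinv_le_contravar; [apply Rinv_0_lt_compat, He |].
  apply Rmult_le_compat_r with (r := c) in H; [| lra].
  replace (/ (c * e) * c)%R with (/ e)%R in H by (field; lra). exact H.
Qed.

(* The step is coupled to [m] by [INR (S m) = exp (2 * nu * tau)]. *)
Lemma bump_concentrates (tau eta d K eps : R) :
  (0 < eta < tau)%R -> (2 * tau < d)%R -> (0 < K)%R -> (0 < eps)%R ->
  exists (nu : R) (m : nat), (K <= nu)%R /\
    (1 - bump_tail nu m (tau - eta) <= eps)%R /\
    (bump_tail nu m (tau + eta) <= eps)%R /\
    (2 * nu * INR (S m) * (exp (- (nu * d)) * (1 + exp (- (nu * d))) ^ m) <= eps)%R.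
Proof.
  intros Heta Hd HK Heps.
  (* With the coupling, [INR (S m) * exp (- (nu * d))] equals [exp (- (2 * nu * del))]. *)
  set (del := (d / 2 - tau)%R). assert (Hdel : (0 < del)%R) by (unfold del; lra).
  (* [X] will be [2 * nu]. The summands serve [K <= nu], the two tails, and the error term; there
     [12 = 4 * 3], with 4 from [exp (- y) <= 4 / y ^ 2] and 3 from [e <= 3]. *)
  set (X0 := (2 * K + / (eta * eps) + 12 / (del * del * eps))%R).
  assert (P1 : (0 < / (eta * eps))%R) by (apply Rinv_0_lt_compat; nra).
  assert (P2 : (0 < 12 / (del * del * eps))%R).
  { apply Rdiv_lt_0_compat; [lra |]. apply Rmult_lt_0_compat; [nra | lra]. }
  (* The integer [m] is chosen first, and [X] is then solved from [INR (S m) = exp (X * tau)]. *)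
  destruct (INR_unbounded (exp (X0 * tau))) as [m Hm].
  assert (HN : (exp (X0 * tau) < INR (S m))%R) by (rewrite S_INR; lra).
  set (X := (ln (INR (S m)) / tau)%R).
  assert (HNpos : (0 < INR (S m))%R) by (pose proof (exp_pos (X0 * tau)); lra).
  assert (HX : (X0 <= X)%R).
  { apply Rmult_le_reg_r with tau; [lra |]. unfold X, Rdiv.
    rewrite Rmult_assoc, Rinv_l, Rmult_1_r by lra.
    rewrite <- (ln_exp (X0 * tau)). apply Rlt_le, ln_increasing; [apply exp_pos | exact HN]. }
  assert (EN : INR (S m) = exp (X * tau)).
  { unfold X, Rdiv. rewrite Rmult_assoc, Rinv_l, Rmult_1_r, exp_ln by lra. reflexivity. }
  assert (HXpos : (0 < X)%R) by (unfold X0 in HX; lra).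
  assert (Hxe : (/ (X * eta) <= eps)%R) by (apply inv_mult_le; unfold X0 in HX; lra).
  exists (X / 2)%R, m. replace (2 * (X / 2))%R with X by lra.
  split; [unfold X0 in HX; lra |].
  unfold bump_tail. replace (2 * (X / 2))%R with X by lra.
  split; [| split].
  (* Left of the peak: [(1 - u) ^ S m <= exp (- (INR (S m) * u)) = exp (- exp (X * eta))]. *)
  - set (u := exp (- (X * (tau - eta)))).
    assert (Hu : (0 < u <= 1)%R).
    { unfold u; split; [apply exp_pos |]. rewrite <- exp_0. apply Rlt_le, exp_increasing. nra. }
    replace (1 - (1 - (1 - u) ^ S m))%R with ((1 - u) ^ S m)%R by ring.
    apply Rle_trans with (exp (- u) ^ S m)%R.
    + apply pow_incr. split; [lra |]. pose proof (exp_ineq1_le (- u)). lra.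
    + rewrite exp_pow_INR, EN. unfold u.
      replace (exp (X * tau) * - exp (- (X * (tau - eta))))%R with (- exp (X * eta))%R.
      * eapply Rle_trans; [apply exp_neg_le_inv, exp_pos |]. eapply Rle_trans; [| exact Hxe].
        apply Rinv_le_contravar; [nra |]. pose proof (exp_ineq1_le (X * eta)). lra.
      * rewrite <- Ropp_mult_distr_r, <- exp_plus. do 2 f_equal. ring.
  (* Right of the peak, Bernoulli bounds the tail by [INR (S m) * u = exp (- (X * eta))]. *)
  - set (u := exp (- (X * (tau + eta)))).
    assert (Hu : (0 <= u <= 1)%R).
    { unfold u; split; [apply Rlt_le, exp_pos |]. rewrite <- exp_0. apply Rlt_le, exp_increasing. nra. }
    pose proof (bernoulli_minus u (S m) Hu) as Hb.
    assert (E : (INR (S m) * u = exp (- (X * eta)))%R).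
    { rewrite EN. unfold u. rewrite <- exp_plus. f_equal. ring. }
    pose proof (exp_neg_le_inv (X * eta) ltac:(nra)). lra.
  (* [(1 + v) ^ m <= exp (m * v)] with [m * v < 1], so the differences amplify the error by at most
     [e]. *)
  - set (v := exp (- (X / 2 * d))).
    assert (Hv : (0 < v)%R) by apply exp_pos.
    assert (E : (INR (S m) * v = exp (- (X * del)))%R).
    { rewrite EN. unfold v. rewrite <- exp_plus. f_equal. unfold del. field. }
    assert (Hp : ((1 + v) ^ m <= 3)%R).
    { apply Rle_trans with (exp v ^ m)%R.
      - apply pow_incr. split; [lra | apply exp_ineq1_le].
      - rewrite exp_pow_INR. eapply Rle_trans; [| apply exp_le_3].
        apply Rlt_le, exp_increasing.
        assert (INR m * v <= INR (S m) * v)%R by (rewrite S_INR; nra).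
        assert (exp (- (X * del)) < 1)%R; [| lra].
        rewrite <- exp_0. apply exp_increasing. nra. }
    assert (H2 : (exp (- (X * del)) <= / ((X * del / 2) * (X * del / 2)))%R).
    { replace (- (X * del))%R with (- (X * del / 2) + - (X * del / 2))%R by field.
      rewrite exp_plus, Rinv_mult.
      assert (0 < X * del / 2)%R by nra.
      apply Rmult_le_compat; try (apply Rlt_le, exp_pos); apply exp_neg_le_inv; assumption. }
    replace (X * INR (S m) * (v * (1 + v) ^ m))%R with (X * (INR (S m) * v) * (1 + v) ^ m)%R by ring.
    rewrite E.
    apply Rle_trans with (X * (/ ((X * del / 2) * (X * del / 2))) * 3)%R.
    + apply Rmult_le_compat; [apply Rmult_le_pos; [lra | apply Rlt_le, exp_pos] | apply pow_le; lra
        | apply Rmult_le_compat_l; lra | exact Hp].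
    + replace (X * / (X * del / 2 * (X * del / 2)) * 3)%R with (/ (X * (del * del / 12)))%R
        by (field; lra).
      apply inv_mult_le; [nra | lra |].
      replace (/ (del * del / 12 * eps))%R with (12 / (del * del * eps))%R by (field; lra).
      unfold X0 in HX; lra.
Qed.

Definition ccont (f : R -> C) (x : R) : Prop :=
  forall eps, (0 < eps)%R -> exists delta, (0 < delta)%R /\
    forall y, (Rabs (y - x) < delta)%R -> (Cmod (f y - f x) < eps)%R.

Lemma antiderivative (g : R -> R) : (forall x, continuity_pt g x) ->
  exists G, forall x, is_derive G x (g x).
Proof.
  intro H. exists (fun x => RInt g 0 x). intro x.
  apply (is_derive_RInt (V:=R_NormedModule) g (fun x => RInt g 0 x) 0 x).
  - apply filter_forall. intro y. apply (RInt_correct (V:=R_CompleteNormedModule)).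
    apply (ex_RInt_continuous (V:=R_CompleteNormedModule)). intros z _.
    apply continuity_pt_filterlim, H.
  - apply continuity_pt_filterlim, H.
Qed.

Lemma Cmod_triangle_rev (z w : C) : (Rabs (Cmod z - Cmod w) <= Cmod (z - w))%R.
Proof.
  pose proof (Cmod_triangle (z - w) w) as H1. pose proof (Cmod_triangle (w - z) z) as H2.
  replace (z - w + w) with z in H1 by ring. replace (w - z + z) with w in H2 by ring.
  rewrite (Cmod_sub_sym w z) in H2. apply Rabs_le. lra.
Qed.

Lemma ccont_Cmod (f : R -> C) (x : R) : ccont f x -> continuity_pt (fun t => Cmod (f t)) x.
Proof.
  intros H eps Heps. destruct (H eps Heps) as [d [Hd H']]. exists d; split; [exact Hd |].
  intros y [_ Hy]. simpl in *. unfold Rdist in *.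
  eapply Rle_lt_trans; [apply Cmod_triangle_rev | apply H', Hy].
Qed.

Lemma le_of_le_scaled_eps (x y K : R) :
  (forall e, (0 < e)%R -> (x <= y + K * e)%R) -> (x <= y)%R.
Proof.
  intro H. apply le_epsilon. intros eps Heps.
  assert (HK : (0 < Rabs K + 1)%R) by (pose proof (Rabs_pos K); lra).
  specialize (H (eps / (Rabs K + 1))%R ltac:(apply Rdiv_lt_0_compat; lra)).
  assert (K * (eps / (Rabs K + 1)) <= eps)%R; [| lra].
  apply Rle_trans with ((Rabs K + 1) * (eps / (Rabs K + 1)))%R.
  - apply Rmult_le_compat_r; [apply Rlt_le, Rdiv_lt_0_compat; lra |].
    pose proof (Rle_abs K). lra.
  - right. field. lra.
Qed.

(** * Localization of the difference of the potentials *)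

Section Core.
Variables (a b Q k0 : R) (q qt : R -> C).
Hypothesis Hab : (a < b)%R.
Hypothesis Hk0 : (1 <= k0)%R.
Hypothesis HQ : forall x, (a <= x <= b)%R -> (Cmod (q x) <= Q)%R.
Hypothesis HQt : forall x, (a <= x <= b)%R -> (Cmod (qt x) <= Q)%R.
Hypothesis Hc : forall x, ccont (fun x => q x - qt x) x.
Variables (p p1 pt pt1 : R -> R -> C).
Hypothesis Hp : forall k, (k0 <= k)%R -> jost a b k q (fun x => p x k) (fun x => p1 x k).
Hypothesis Hpt : forall k, (k0 <= k)%R -> jost a b k qt (fun x => pt x k) (fun x => pt1 x k).
Variable C0 : R.
Hypothesis HC0 : (0 <= C0)%R.
Hypothesis Hsmall : forall k, (k0 <= k)%R ->
  (Cmod (p1 a k * pt a k - p a k * pt1 a k) <= C0 * k * exp (- (2 * k * (b - a))))%R.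

Let l := (b - a)%R.
Let E1 := exp (jost_rate Q l * l).
Let M2 := (E1 + (1 + l * E1) * E1)%R.

Lemma rate_exp_le (x : R) : (a <= x <= b)%R -> (exp (jost_rate Q l * (b - x)) <= E1)%R.
Proof.
  intro Hx. assert (HQ0 : (0 <= Q)%R).
  { eapply Rle_trans; [apply Cmod_ge_0 | apply (HQ a); lra]. }
  unfold E1. assert (0 < jost_rate Q l)%R by (unfold jost_rate, l; nra).
  destruct (Req_dec x a) as [-> | n]; [right; reflexivity |].
  apply Rlt_le, exp_increasing. apply Rmult_lt_compat_l; [assumption | unfold l; lra].
Qed.

(** [p * pt - 1 = (p - 1) + p * (pt - 1)]. The estimate of the first term, [transmutation] with
    weight 1, provides the hypothesis on the weight [p] for the second; [M2] is the sum of the two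
    constants. *)
Lemma product_probe (nu : R) (m : nat) (x : R) : (k0 <= nu)%R -> (a <= x <= b)%R ->
  (Cmod (probe nu m (fun k => damp k (x - a) * (p x k * pt x k))%C - RtoC (bump nu m (x - a)))
     <= M2 * bump_tail nu m (x - a))%R.
Proof.
  intros Hnu Hx. assert (Hnu0 : (0 < nu)%R) by lra.
  assert (HE : (0 < E1)%R) by apply exp_pos. assert (Hl : (0 < l)%R) by (unfold l; lra).
  assert (B0 : forall r, probe nu m (fun k => damp k r * 1) = RtoC (bump nu m r)).
  { intro r. rewrite <- probe_exp by exact Hnu0. apply probe_ext; [exact Hnu0 |].
    intros; unfold damp; ring. }
  assert (T1 : forall r, (0 <= r)%R ->
     (Cmod (probe nu m (fun k => damp k r * (1 * (p x k - 1)))%C) <= E1 * bump_tail nu m r)%R).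
  { intros r Hr. eapply Rle_trans.
    - apply (transmutation a b Q nu 0 m q (fun _ => 1) p p1 Hab Hnu0 HQ).
      + intros k Hk; apply Hp; lra.
      + lra.
      + clear r Hr. intros r Hr. rewrite B0, Cmod_R, Rabs_pos_eq; [lra |]. apply bump_nonneg; assumption.
      + exact Hx.
      + exact Hr.
    - fold l. pose proof (rate_exp_le x Hx). pose proof (bump_tail_bounds nu m Hnu0 r Hr). nra. }
  assert (Hw : forall r, (0 <= r)%R ->
     (Cmod (probe nu m (fun k => damp k r * p x k)%C) <= bump nu m r + E1 * bump_tail nu m r)%R).
  { intros r Hr.
    replace (probe nu m (fun k => damp k r * p x k)) with
      (probe nu m (fun k => damp k r * 1) + probe nu m (fun k => damp k r * (1 * (p x k - 1)))).
    - eapply Rle_trans; [apply Cmod_triangle |]. rewrite B0, Cmod_R, Rabs_pos_eq.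
      + pose proof (T1 r Hr). lra.
      + apply bump_nonneg; assumption.
    - rewrite <- probe_plus. apply probe_ext; [exact Hnu0 |]. intros; ring. }
  set (r := (x - a)%R). assert (Hr : (0 <= r)%R) by (unfold r; lra).
  replace (probe nu m (fun k => damp k r * (p x k * pt x k)) - RtoC (bump nu m r)) with
    (probe nu m (fun k => damp k r * (1 * (p x k - 1)))
     + probe nu m (fun k => damp k r * (p x k * (pt x k - 1)))).
  2: { rewrite <- B0. rewrite <- probe_plus.
       replace (probe nu m (fun k => damp k r * (p x k * pt x k))) with
         (probe nu m (fun k => damp k r * (1 * (p x k - 1)) + damp k r * (p x k * (pt x k - 1)))
          + probe nu m (fun k => damp k r * 1)); [ring |].
       rewrite <- probe_plus. apply probe_ext; [exact Hnu0 |]. intros; ring. }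
  eapply Rle_trans; [apply Cmod_triangle |].
  assert (T2 : (Cmod (probe nu m (fun k => damp k r * (p x k * (pt x k - 1)))%C)
     <= (1 + l * E1) * E1 * bump_tail nu m r)%R).
  { eapply Rle_trans.
    - apply (transmutation a b Q nu E1 m qt (fun k => p x k) pt pt1 Hab Hnu0 HQt).
      + intros k Hk; apply Hpt; lra.
      + lra.
      + exact Hw.
      + exact Hx.
      + exact Hr.
    - fold l. pose proof (rate_exp_le x Hx). pose proof (bump_tail_bounds nu m Hnu0 r Hr).
      assert (0 <= l * E1)%R by nra.
      apply Rmult_le_compat_r; [lra |]. apply Rmult_le_compat_l; lra. }
  pose proof (T1 r Hr). unfold M2. lra.
Qed.

Lemma product_const_nonneg : (0 <= M2)%R.
Proof.
  assert (0 < E1)%R by apply exp_pos. assert (0 < l)%R by (unfold l; lra).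
  unfold M2. assert (0 <= l * E1)%R by nra. nra.
Qed.

Variable G : R -> R.
Hypothesis HG : forall x, is_derive G x (Cmod (q x - qt x)).

Lemma diff_bound (x : R) : (a <= x <= b)%R -> (Cmod (q x - qt x) <= 2 * Q)%R.
Proof.
  intro Hx. eapply Rle_trans; [apply Cmod_triangle |]. rewrite Cmod_opp.
  specialize (HQ x Hx). specialize (HQt x Hx). lra.
Qed.

Lemma primitive_incr (x y : R) : (x <= y)%R -> (G x <= G y)%R.
Proof.
  intro H. apply (deriv_nonneg_incr G (fun x => Cmod (q x - qt x))); [exact H |].
  intros t Ht; split; [apply HG | apply Cmod_ge_0].
Qed.

Lemma is_derive_bump_tail_shift (nu : R) (m : nat) (x : R) :
  is_derive (fun x => bump_tail nu m (x - a)) x (- bump nu m (x - a))%R.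
Proof.
  eapply is_derive_eq.
  - apply (is_derive_comp (K:=R_AbsRing) (V:=R_NormedModule) (bump_tail nu m) (fun x => x - a)%R).
    + apply bump_tail_deriv.
    + apply (is_derive_minus (K:=R_AbsRing) (V:=R_NormedModule) (fun x => x) (fun _ => a)).
      * apply (is_derive_id (K:=R_AbsRing)).
      * apply (is_derive_const (K:=R_AbsRing) (V:=R_NormedModule)).
  - unfold minus, plus, opp, scal, zero, one; simpl; unfold mult; simpl. ring.
Qed.

(** One comparison function for the three ranges of [x] in [local_bound]: [u] weighs the mass of
    [bump], [v] the integral of [|q - qt|], [s] the length. *)
Lemma is_derive_lin_bump_tail (nu : R) (m : nat) (u v s x : R) :
  is_derive (fun x => - u * bump_tail nu m (x - a) + v * G x + s * x)%R x
    (u * bump nu m (x - a) + v * Cmod (q x - qt x) + s)%R.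
Proof.
  eapply is_derive_eq.
  - apply (is_derive_plus (K:=R_AbsRing) (V:=R_NormedModule)
       (fun x => - u * bump_tail nu m (x - a) + v * G x)%R (fun x => s * x)%R).
    + apply (is_derive_plus (K:=R_AbsRing) (V:=R_NormedModule)
         (fun x => - u * bump_tail nu m (x - a))%R (fun x => v * G x)%R).
      * apply (is_derive_scal (fun x => bump_tail nu m (x - a))), is_derive_bump_tail_shift.
      * apply (is_derive_scal G), HG.
    + apply (is_derive_scal (fun x => x)), (is_derive_id (K:=R_AbsRing)).
  - unfold plus, one; simpl. ring.
Qed.

(* The derivative of the Wronskian of the two Jost solutions is
   [(q - qt)] times their product; probing it at [t] isolates [q t - qt t]. *)
Lemma local_bound (t : R) : (a < t < b)%R -> (Cmod (q t - qt t) <= M2 * (G t - G a))%R.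
Proof.
  intro Ht. assert (Hl : (0 < l)%R) by (unfold l; lra).
  assert (HQ0 : (0 <= Q)%R).
  { eapply Rle_trans; [apply Cmod_ge_0 | apply (HQ a); lra]. }
  pose proof product_const_nonneg as HM2.
  set (tau := (t - a)%R). assert (Htau : (0 < tau < l)%R) by (unfold tau, l; lra).
  set (D0 := (C0 / (l - tau))%R).
  assert (HD0 : (0 <= D0)%R) by (apply Rdiv_le_0_compat; lra).
  (* In this order, the errors of [Tl], [Wa], [I1], [I2] and [I3] below. *)
  apply (le_of_le_scaled_eps _ _ (2 * Q + D0 + 4 * Q + 1 + 4 * M2 * Q + 4 * Q + 2 * M2 * Q * l)).
  intros e He.
  destruct (Hc t e He) as [d0 [Hd0 Hcont]].
  set (eta := Rmin (Rmin (d0 / 2) e) (Rmin (tau / 2) ((l - tau) / 2))).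
  assert (Heta : (0 < eta /\ eta < d0 /\ eta <= e /\ eta < tau /\ eta < l - tau)%R).
  { pose proof (Rmin_l (Rmin (d0 / 2) e) (Rmin (tau / 2) ((l - tau) / 2))).
    pose proof (Rmin_r (Rmin (d0 / 2) e) (Rmin (tau / 2) ((l - tau) / 2))).
    pose proof (Rmin_l (d0 / 2) e). pose proof (Rmin_r (d0 / 2) e).
    pose proof (Rmin_l (tau / 2) ((l - tau) / 2)). pose proof (Rmin_r (tau / 2) ((l - tau) / 2)).
    fold eta in H, H0. split; [| lra].
    unfold eta. repeat apply Rmin_pos; lra. }
  destruct (bump_concentrates tau eta (tau + l) k0 e) as [nu [m [Hnu [T1 [T2 T3]]]]]; try lra.
  assert (Hnu0 : (0 < nu)%R) by lra.
  set (Wr := fun x => probe nu m (fun k => damp k (x - a) * (p1 x k * pt x k - p x k * pt1 x k))).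
  set (S := fun x => probe nu m (fun k => damp k (x - a) * (p x k * pt x k))).
  assert (DW : forall x, (a <= x <= b)%R -> cderiv Wr x ((q x - qt x) * S x)).
  { intros x Hx. unfold S. rewrite <- probe_scal. apply probe_deriv; [exact Hnu0 |].
    intros k Hk. destruct (Hp k ltac:(lra)) as [A _]. destruct (A x Hx) as [A0 A1].
    destruct (Hpt k ltac:(lra)) as [B _]. destruct (B x Hx) as [B0 B1].
    eapply cderiv_eq.
    - apply cderiv_mult; [apply damp_shift_deriv |]. apply cderiv_minus; apply cderiv_mult; eassumption.
    - cbv beta; ring. }
  assert (Wb : Wr b = 0).
  { unfold Wr. transitivity (probe nu m (fun k => 0 * 0)).
    - apply probe_ext; [exact Hnu0 |]. intros k Hk. destruct (Hp k ltac:(lra)) as [_ [_ A]].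
      destruct (Hpt k ltac:(lra)) as [_ [_ B]]. rewrite A, B. ring.
    - rewrite probe_scal. ring. }
  assert (Wa : (Cmod (Wr a) <= D0 * e)%R).
  { unfold Wr. eapply Rle_trans.
    - apply (probe_bound nu m Hnu0 _ D0 (tau + l)). intros k Hk.
      replace (a - a)%R with 0%R by ring. rewrite damp_0, Cmult_1_l.
      eapply Rle_trans; [apply Hsmall; lra |]. fold l.
      replace (- (2 * k * l))%R with (- (k * (l - tau)) + - (k * (tau + l)))%R by ring.
      rewrite exp_plus.
      assert (Hkl : (0 < k * (l - tau))%R) by (apply Rmult_lt_0_compat; lra).
      pose proof (exp_neg_le_inv (k * (l - tau)) Hkl) as Hi.
      rewrite <- Rmult_assoc. apply Rmult_le_compat_r; [apply Rlt_le, exp_pos |].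
      apply Rle_trans with (C0 * k * / (k * (l - tau)))%R.
      + apply Rmult_le_compat_l; [nra | exact Hi].
      + right. unfold D0. field. lra.
    - replace (2 * nu * INR (Datatypes.S m) * (D0 * exp (- (nu * (tau + l))) * (1 + exp (- (nu * (tau + l)))) ^ m))%R
        with (D0 * (2 * nu * INR (Datatypes.S m) * (exp (- (nu * (tau + l))) * (1 + exp (- (nu * (tau + l)))) ^ m)))%R
        by ring.
      apply Rmult_le_compat_l; [exact HD0 | exact T3]. }
  set (pt' := q t - qt t).
  (* A primitive of [(q - qt) * S - pt' * bump], with the potentials frozen at [t] in the second
     term; its increments are small except for the term with [G]. *)
  set (H := fun x => Wr x + pt' * RtoC (bump_tail nu m (x - a))).
  set (H' := fun x => (q x - qt x) * S x + pt' * RtoC (- bump nu m (x - a))).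
  assert (DH : forall x, (a <= x <= b)%R -> cderiv H x (H' x)).
  { intros x Hx. apply cderiv_plus; [apply DW, Hx |].
    apply cderiv_scal, cderiv_RtoC, is_derive_bump_tail_shift. }
  assert (BH : forall x, (a <= x <= b)%R ->
     (Cmod (H' x) <= Cmod ((q x - qt x) - pt') * bump nu m (x - a)
                     + Cmod (q x - qt x) * (M2 * bump_tail nu m (x - a)))%R).
  { intros x Hx. unfold H'.
    replace ((q x - qt x) * S x + pt' * RtoC (- bump nu m (x - a))) with
      (((q x - qt x) - pt') * RtoC (bump nu m (x - a))
       + (q x - qt x) * (S x - RtoC (bump nu m (x - a)))) by (rewrite RtoC_opp; ring).
    eapply Rle_trans; [apply Cmod_triangle |]. rewrite 2 Cmod_mult, Cmod_R, Rabs_pos_eq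
      by (apply bump_nonneg; lra).
    apply Rplus_le_compat_l, Rmult_le_compat_l; [apply Cmod_ge_0 |].
    apply product_probe; assumption. }
  assert (Bd4 : forall x, (a <= x <= b)%R -> (Cmod ((q x - qt x) - pt') <= 4 * Q)%R).
  { intros x Hx. eapply Rle_trans; [apply Cmod_triangle |]. rewrite Cmod_opp.
    pose proof (diff_bound x Hx). pose proof (diff_bound t ltac:(lra)). unfold pt'. lra. }
  (* Left of the peak the mass is at most [e], but [bump_tail] is close to 1: this range yields the
     main term [M2 * (G t - G a)]. *)
  assert (I1 : (Cmod (H (t - eta)%R - H a) <= 4 * Q * e + M2 * (G t - G a))%R).
  { eapply Rle_trans.
    - apply (mean_value_ineq H H' (fun x => - (4 * Q) * bump_tail nu m (x - a) + M2 * G x + 0 * x)%R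
         (fun x => 4 * Q * bump nu m (x - a) + M2 * Cmod (q x - qt x) + 0)%R).
      + unfold tau in Heta; lra.
      + intros x Hx. apply DH. unfold tau, l in *; lra.
      + intros x Hx. apply is_derive_lin_bump_tail.
      + intros x Hx. assert (Hx' : (a <= x <= b)%R) by (unfold tau, l in *; lra).
        eapply Rle_trans; [apply BH, Hx' |].
        pose proof (Bd4 x Hx'). pose proof (bump_nonneg nu m Hnu0 (x - a) ltac:(lra)).
        pose proof (bump_tail_bounds nu m Hnu0 (x - a) ltac:(lra)). pose proof (Cmod_ge_0 (q x - qt x)).
        assert (M2 * bump_tail nu m (x - a) <= M2)%R by nra. nra.
    - replace (t - eta - a)%R with (tau - eta)%R by (unfold tau; ring).
      pose proof (bump_tail_bounds nu m Hnu0 (a - a) ltac:(lra)).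
      pose proof (primitive_incr (t - eta) t ltac:(lra)). nra. }
  (* Around the peak, continuity gives [e] against a mass of at most 1, and the density term is
     small because the range has length [2 * eta <= 2 * e]. *)
  assert (I2 : (Cmod (H (t + eta)%R - H (t - eta)%R) <= e + 4 * M2 * Q * e)%R).
  { eapply Rle_trans.
    - apply (mean_value_ineq H H' (fun x => - e * bump_tail nu m (x - a) + 0 * G x + (2 * Q * M2) * x)%R
         (fun x => e * bump nu m (x - a) + 0 * Cmod (q x - qt x) + 2 * Q * M2)%R).
      + lra.
      + intros x Hx. apply DH. unfold tau, l in *; lra.
      + intros x Hx. apply is_derive_lin_bump_tail.
      + intros x Hx. assert (Hx' : (a <= x <= b)%R) by (unfold tau, l in *; lra).
        eapply Rle_trans; [apply BH, Hx' |].
        pose proof (Hcont x ltac:(apply Rabs_def1; lra)) as Hd. fold pt' in Hd.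
        pose proof (bump_nonneg nu m Hnu0 (x - a) ltac:(lra)).
        pose proof (bump_tail_bounds nu m Hnu0 (x - a) ltac:(lra)). pose proof (Cmod_ge_0 (q x - qt x)).
        pose proof (diff_bound x Hx').
        assert (0 <= M2 * bump_tail nu m (x - a) <= M2)%R by nra.
        assert (Cmod (q x - qt x) * (M2 * bump_tail nu m (x - a)) <= 2 * Q * M2)%R
          by (apply Rmult_le_compat; lra).
        nra.
    - pose proof (bump_tail_bounds nu m Hnu0 (t - eta - a) ltac:(unfold tau in *; lra)).
      pose proof (bump_tail_bounds nu m Hnu0 (t + eta - a) ltac:(unfold tau in *; lra)).
      assert (Q * M2 * eta <= Q * M2 * e)%R by (apply Rmult_le_compat_l; nra). nra. }
  (* Right of the peak both the mass and [bump_tail] are at most [e]. *)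
  assert (I3 : (Cmod (H b - H (t + eta)%R) <= 4 * Q * e + 2 * M2 * Q * l * e)%R).
  { eapply Rle_trans.
    - apply (mean_value_ineq H H' (fun x => - (4 * Q) * bump_tail nu m (x - a) + 0 * G x + (2 * Q * (M2 * e)) * x)%R
         (fun x => 4 * Q * bump nu m (x - a) + 0 * Cmod (q x - qt x) + 2 * Q * (M2 * e))%R).
      + unfold tau, l in *; lra.
      + intros x Hx. apply DH. unfold tau, l in *; lra.
      + intros x Hx. apply is_derive_lin_bump_tail.
      + intros x Hx. assert (Hx' : (a <= x <= b)%R) by (unfold tau, l in *; lra).
        eapply Rle_trans; [apply BH, Hx' |].
        pose proof (Bd4 x Hx'). pose proof (bump_nonneg nu m Hnu0 (x - a) ltac:(lra)).
        pose proof (bump_tail_bounds nu m Hnu0 (x - a) ltac:(lra)). pose proof (Cmod_ge_0 (q x - qt x)).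
        pose proof (diff_bound x Hx').
        pose proof (bump_tail_decr nu m Hnu0 (tau + eta) (x - a) ltac:(unfold tau in *; lra)).
        assert (0 <= M2 * bump_tail nu m (x - a) <= M2 * e)%R by nra.
        assert (Cmod (q x - qt x) * (M2 * bump_tail nu m (x - a)) <= 2 * Q * (M2 * e))%R
          by (apply Rmult_le_compat; lra).
        nra.
    - replace (t + eta - a)%R with (tau + eta)%R by (unfold tau; ring).
      pose proof (bump_tail_bounds nu m Hnu0 (b - a) ltac:(lra)).
      assert (Q * M2 * e * (b - (t + eta)) <= Q * M2 * e * l)%R.
      { apply Rmult_le_compat_l; [| unfold l; lra]. apply Rmult_le_pos; [nra | lra]. }
      nra. }
  assert (T0 : bump_tail nu m (a - a) = 1%R).
  { unfold bump_tail. replace (- (2 * nu * (a - a)))%R with 0%R by ring. rewrite exp_0. simpl. ring. }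
  assert (Tl : (0 <= bump_tail nu m (b - a) <= e)%R).
  { split; [apply bump_tail_bounds; lra |]. eapply Rle_trans; [| apply T2].
    apply bump_tail_decr; [exact Hnu0 | unfold tau, l in *; lra]. }
  (* Telescoping of [H] over the three ranges, with [Wr b = 0] and [bump_tail] equal to 1 at 0. *)
  assert (Efin : pt' = pt' * RtoC (bump_tail nu m (b - a)) - Wr a
      - ((H b - H (t + eta)%R) + ((H (t + eta)%R - H (t - eta)%R) + (H (t - eta)%R - H a)))).
  { unfold H. rewrite Wb, T0. ring. }
  rewrite Efin.
  pose proof (diff_bound t ltac:(lra)) as Dt. fold pt' in Dt.
  eapply Rle_trans; [apply Cmod_triangle |]. rewrite Cmod_opp.
  pose proof (Cmod_triangle (H b - H (t + eta)%R) ((H (t + eta)%R - H (t - eta)%R) + (H (t - eta)%R - H a))) as X1.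
  pose proof (Cmod_triangle (H (t + eta)%R - H (t - eta)%R) (H (t - eta)%R - H a)) as X2.
  pose proof (Cmod_triangle (pt' * RtoC (bump_tail nu m (b - a))) (- Wr a)) as X3.
  rewrite Cmod_opp, Cmod_mult, Cmod_R, Rabs_pos_eq in X3 by lra.
  assert (Cmod pt' * bump_tail nu m (b - a) <= 2 * Q * e)%R.
  { apply Rmult_le_compat; try lra. apply Cmod_ge_0. }
  unfold Cminus in *. lra.
Qed.

Lemma core_uniqueness (t : R) : (a < t < b)%R -> q t = qt t.
Proof.
  intro Ht. pose proof product_const_nonneg as HM2.
  assert (HQ0 : (0 <= Q)%R).
  { eapply Rle_trans; [apply Cmod_ge_0 | apply (HQ a); lra]. }
  assert (D : (G t - G a <= 0)%R).
  { apply (le_of_le_scaled_eps _ _ (exp (M2 * l) * (2 * Q) * (t - a))).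
    intros e He. set (s := Rmin e (/ 2)).
    assert (Hs : (0 < s <= e /\ s < 1)%R).
    { unfold s. pose proof (Rmin_l e (/ 2)). pose proof (Rmin_r e (/ 2)).
      split; [split; [apply Rmin_pos; lra |] |]; lra. }
    (* [local_bound] holds only in the open interval, so Gronwall starts at [a'] slightly to the
       right of [a], where [G a' - G a] is of order [e]. *)
    set (a' := (a + s * (t - a))%R). assert (Ha' : (a < a' < t)%R) by (unfold a'; nra).
    assert (B1 : (G a' - G a <= 2 * Q * (a' - a))%R).
    { enough (G a' - 2 * Q * a' <= G a - 2 * Q * a)%R by lra.
      apply (deriv_nonpos_decr (fun x => G x - 2 * Q * x)%R (fun x => Cmod (q x - qt x) - 2 * Q)%R); [lra |].
      intros x Hx; split.
      - apply (is_derive_minus (K:=R_AbsRing) (V:=R_NormedModule) G (fun x => 2 * Q * x)%R); [apply HG |].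
        eapply is_derive_eq; [apply (is_derive_scal (fun x => x)), (is_derive_id (K:=R_AbsRing)) |].
        unfold one; simpl. ring.
      - pose proof (diff_bound x ltac:(lra)). lra. }
    assert (B2 : (exp (- M2 * (t - a')) * (G t - G a) <= exp (- M2 * (a' - a')) * (G a' - G a))%R).
    { apply (deriv_nonpos_decr (fun x => exp (- M2 * (x - a')) * (G x - G a))%R
        (fun x => (- M2 * exp (- M2 * (x - a'))) * (G x - G a) + exp (- M2 * (x - a')) * (Cmod (q x - qt x) - 0))%R);
        [lra |].
      intros x Hx; split.
      - apply (is_derive_Rmult (fun x => exp (- M2 * (x - a')))%R (fun x => G x - G a)%R).
        + apply is_derive_exp_affine.
        + apply (is_derive_minus (K:=R_AbsRing) (V:=R_NormedModule) G (fun _ => G a)); [apply HG |].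
          apply (is_derive_const (K:=R_AbsRing) (V:=R_NormedModule)).
      - pose proof (local_bound x ltac:(lra)). pose proof (exp_pos (- M2 * (x - a'))). nra. }
    replace (- M2 * (a' - a'))%R with 0%R in B2 by ring. rewrite exp_0, Rmult_1_l in B2.
    assert (B3 : (G t - G a <= exp (M2 * (t - a')) * (G a' - G a))%R).
    { apply Rmult_le_compat_l with (r := exp (M2 * (t - a'))) in B2; [| apply Rlt_le, exp_pos].
      rewrite <- Rmult_assoc, <- exp_plus in B2.
      replace (M2 * (t - a') + - M2 * (t - a'))%R with 0%R in B2 by ring.
      rewrite exp_0, Rmult_1_l in B2. exact B2. }
    assert (B4 : (exp (M2 * (t - a')) <= exp (M2 * l))%R).
    { destruct (Req_dec M2 0) as [-> | n].
      - right; f_equal; ring.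
      - apply Rlt_le, exp_increasing. unfold l. nra. }
    rewrite Rplus_0_l. eapply Rle_trans; [exact B3 |].
    pose proof (primitive_incr a a' ltac:(lra)). pose proof (exp_pos (M2 * (t - a'))).
    apply Rle_trans with (exp (M2 * l) * (2 * Q * (a' - a)))%R.
    - apply Rmult_le_compat; lra.
    - replace (exp (M2 * l) * (2 * Q) * (t - a) * e)%R with (exp (M2 * l) * (2 * Q * (e * (t - a))))%R by ring.
      apply Rmult_le_compat_l; [apply Rlt_le, exp_pos |].
      apply Rmult_le_compat_l; [lra |]. unfold a'. nra. }
  pose proof (local_bound t Ht) as L. pose proof (Cmod_ge_0 (q t - qt t)).
  assert (E : q t - qt t = 0) by (apply Cmod_eq_0; nra).
  replace (q t) with (q t - qt t + qt t) by ring. rewrite E. ring.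
Qed.
End Core.

(** * Existence of solutions *)

Lemma Cmod_le_Re_Im (z : C) : (Cmod z <= Rabs (Re z) + Rabs (Im z))%R.
Proof.
  replace z with (RtoC (Re z) + Ci * RtoC (Im z)) at 1 by (apply C_eq; simpl; ring).
  eapply Rle_trans; [apply Cmod_triangle |].
  rewrite Cmod_mult, Cmod_Ci, 2 Cmod_R. lra.
Qed.

Lemma im_le_Cmod (z : C) : (Rabs (Im z) <= Cmod z)%R.
Proof. eapply Rle_trans; [apply Rmax_r | apply (Rmax_Cmod z)]. Qed.

Lemma half_pow_small (B eps : R) : (0 <= B)%R -> (0 < eps)%R ->
  exists N, forall n, (N <= n)%nat -> (B * (/ 2) ^ n < eps)%R.
Proof.
  intros HB Heps.
  destruct (pow_lt_1_zero (/ 2) ltac:(rewrite Rabs_pos_eq; lra) (eps / (B + 1))) as [N HN].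
  { apply Rdiv_lt_0_compat; lra. }
  exists N. intros n Hn. specialize (HN n Hn).
  assert (P : (0 < (/ 2) ^ n)%R) by (apply pow_lt; lra).
  rewrite Rabs_pos_eq in HN by lra.
  apply Rmult_lt_compat_r with (r := (B + 1)%R) in HN; [| lra].
  unfold Rdiv in HN. rewrite Rmult_assoc, Rinv_l in HN by lra. nra.
Qed.

Lemma geometric_limit (u : nat -> R) (B : R) :
  (forall n, (Rabs (u (S n) - u n) <= B * (/ 2) ^ n)%R) ->
  exists l, forall n, (Rabs (l - u n) <= 2 * B * (/ 2) ^ n)%R.
Proof.
  intro H.
  assert (HB : (0 <= B)%R).
  { specialize (H O). simpl in H. pose proof (Rabs_pos (u 1%nat - u O)). lra. }
  assert (T : forall n k, (Rabs (u (n + k)%nat - u n) <= 2 * B * ((/ 2) ^ n - (/ 2) ^ (n + k)))%R).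
  { intros n k. induction k as [| k IH].
    - rewrite Nat.add_0_r. replace (u n - u n)%R with 0%R by ring. rewrite Rabs_R0. right; ring.
    - rewrite Nat.add_succ_r. specialize (H (n + k)%nat).
      replace (u (S (n + k)) - u n)%R with ((u (S (n + k)) - u (n + k)%nat) + (u (n + k)%nat - u n))%R by ring.
      eapply Rle_trans; [apply Rabs_triang |]. simpl pow in *. lra. }
  assert (T2 : forall n p, (n <= p)%nat -> (Rabs (u p - u n) <= 2 * B * (/ 2) ^ n)%R).
  { intros n p Hp. replace p with (n + (p - n))%nat by lia.
    eapply Rle_trans; [apply T |].
    assert (0 <= (/ 2) ^ (n + (p - n)))%R by (apply pow_le; lra). nra. }
  assert (Hc : ex_finite_lim_seq u).
  { apply ex_lim_seq_cauchy_corr. intro eps.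
    destruct (half_pow_small (4 * B) eps ltac:(lra) (cond_pos eps)) as [N HN].
    exists N. intros n p Hn Hp.
    replace (u n - u p)%R with ((u n - u N) - (u p - u N))%R by ring.
    eapply Rle_lt_trans; [apply Rabs_triang |]. rewrite Rabs_Ropp.
    pose proof (T2 N n Hn). pose proof (T2 N p Hp). specialize (HN N (le_n N)). lra. }
  destruct Hc as [l Hl]. exists l. intro n.
  apply le_epsilon. intros eps Heps.
  apply is_lim_seq_Reals in Hl. destruct (Hl eps Heps) as [N HN].
  specialize (HN (N + n)%nat ltac:(lia)). unfold Rdist in HN.
  replace (l - u n)%R with (- (u (N + n)%nat - l) + (u (N + n)%nat - u n))%R by ring.
  eapply Rle_trans; [apply Rabs_triang |]. rewrite Rabs_Ropp.
  pose proof (T2 n (N + n)%nat ltac:(lia)). lra.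
Qed.

Lemma geometric_limit_C (D : R -> Prop) (f : nat -> R -> C) (B : R) :
  (forall n x, D x -> (Cmod (f (S n) x - f n x) <= B * (/ 2) ^ n)%R) ->
  exists g : R -> C, forall n x, D x -> (Cmod (g x - f n x) <= 4 * B * (/ 2) ^ n)%R.
Proof.
  intro H.
  assert (H' : forall x, exists l : C, D x -> forall n, (Cmod (l - f n x) <= 4 * B * (/ 2) ^ n)%R).
  { intro x. destruct (excluded_middle_informative (D x)) as [Dx | Dx].
    - destruct (geometric_limit (fun n => Re (f n x)) B) as [lr Hr].
      { intro n. eapply Rle_trans; [apply (re_le_Cmod (f (S n) x - f n x)) | apply H, Dx]. }
      destruct (geometric_limit (fun n => Im (f n x)) B) as [li Hi].
      { intro n. eapply Rle_trans; [apply (im_le_Cmod (f (S n) x - f n x)) | apply H, Dx]. }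
      exists (lr, li). intros _ n. eapply Rle_trans; [apply Cmod_le_Re_Im |]. simpl.
      specialize (Hr n). specialize (Hi n). unfold Rminus in *. simpl in *. unfold Re, Im in *. lra.
    - exists 0. intro; contradiction. }
  exists (fun x => proj1_sig (constructive_indefinite_description _ (H' x))).
  intros n x Dx. destruct (constructive_indefinite_description _ (H' x)) as [l Hl]. simpl. now apply Hl.
Qed.

Lemma CVU_cderiv (c : R) (d : posreal) (f f' : nat -> R -> C) (g g' : R -> C) (B : R) :
  (forall n x, Boule c d x -> cderiv (f n) x (f' n x)) ->
  (forall n x, Boule c d x -> (Cmod (g x - f n x) <= B * (/ 2) ^ n)%R) ->
  (forall n x, Boule c d x -> (Cmod (g' x - f' n x) <= B * (/ 2) ^ n)%R) ->
  forall x, Boule c d x -> cderiv g x (g' x).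
Proof.
  intros Hd H H' x Hx.
  assert (HB : (0 <= B)%R).
  { specialize (H O x Hx). simpl in H. pose proof (Cmod_ge_0 (g x - f O x)). lra. }
  split; apply is_derive_Reals.
  - apply (CVU_derivable (fun n t => Re (f n t)) (fun n t => Re (f' n t)) (fun t => Re (g t))
             (fun t => Re (g' t)) c d); [| | | exact Hx].
    + intros eps Heps. destruct (half_pow_small B eps HB Heps) as [N HN]. exists N.
      intros n y Hn Hy. eapply Rle_lt_trans; [apply (re_le_Cmod (g' y - f' n y)) |].
      eapply Rle_lt_trans; [apply H', Hy | apply HN, Hn].
    + intros y Hy eps Heps. destruct (half_pow_small B eps HB Heps) as [N HN]. exists N.
      intros n Hn. unfold Rdist. rewrite Rabs_minus_sym.
      eapply Rle_lt_trans; [apply (re_le_Cmod (g y - f n y)) |].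
      eapply Rle_lt_trans; [apply H, Hy | apply HN, Hn].
    + intros n y Hy. apply is_derive_Reals, Hd, Hy.
  - apply (CVU_derivable (fun n t => Im (f n t)) (fun n t => Im (f' n t)) (fun t => Im (g t))
             (fun t => Im (g' t)) c d); [| | | exact Hx].
    + intros eps Heps. destruct (half_pow_small B eps HB Heps) as [N HN]. exists N.
      intros n y Hn Hy. eapply Rle_lt_trans; [apply (im_le_Cmod (g' y - f' n y)) |].
      eapply Rle_lt_trans; [apply H', Hy | apply HN, Hn].
    + intros y Hy eps Heps. destruct (half_pow_small B eps HB Heps) as [N HN]. exists N.
      intros n Hn. unfold Rdist. rewrite Rabs_minus_sym.
      eapply Rle_lt_trans; [apply (im_le_Cmod (g y - f n y)) |].
      eapply Rle_lt_trans; [apply H, Hy | apply HN, Hn].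
    + intros n y Hy. apply is_derive_Reals, Hd, Hy.
Qed.

Definition continuous_parts (f : R -> C) : Prop :=
  forall x, continuity_pt (fun t => Re (f t)) x /\ continuity_pt (fun t => Im (f t)) x.

Lemma ccont_parts (f : R -> C) : (forall x, ccont f x) -> continuous_parts f.
Proof.
  intros H x. split; intros eps Heps; destruct (H x eps Heps) as [d [Hd H']];
    exists d; (split; [exact Hd |]); intros y [_ Hy]; simpl in *; unfold Rdist in *;
    (eapply Rle_lt_trans; [| apply (H' y Hy)]).
  - apply (re_le_Cmod (f y - f x)).
  - apply (im_le_Cmod (f y - f x)).
Qed.

Lemma cderiv_parts (f f' : R -> C) : (forall x, cderiv f x (f' x)) -> continuous_parts f.
Proof. intros H x. destruct (H x) as [H1 H2]. split; eapply is_derive_continuity; eassumption. Qed.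

Lemma mult_parts (f g : R -> C) :
  continuous_parts f -> continuous_parts g -> continuous_parts (fun x => f x * g x).
Proof.
  intros Hf Hg x. destruct (Hf x) as [F1 F2], (Hg x) as [G1 G2]. split; simpl.
  - apply (continuity_pt_minus (fun t => Re (f t) * Re (g t))%R (fun t => Im (f t) * Im (g t))%R);
      [apply (continuity_pt_mult (fun t => Re (f t)) (fun t => Re (g t))) |
       apply (continuity_pt_mult (fun t => Im (f t)) (fun t => Im (g t)))]; assumption.
  - apply (continuity_pt_plus (fun t => Re (f t) * Im (g t))%R (fun t => Im (f t) * Re (g t))%R);
      [apply (continuity_pt_mult (fun t => Re (f t)) (fun t => Im (g t))) |
       apply (continuity_pt_mult (fun t => Im (f t)) (fun t => Re (g t)))]; assumption.
Qed.

Lemma antiderivative_C (f : R -> C) (s : R) (v : C) : continuous_parts f ->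
  exists F : R -> C, F s = v /\ forall x, cderiv F x (f x).
Proof.
  intro H.
  destruct (antiderivative (fun t => Re (f t)) (fun x => proj1 (H x))) as [F1 H1].
  destruct (antiderivative (fun t => Im (f t)) (fun x => proj2 (H x))) as [F2 H2].
  exists (fun x => v + ((F1 x, F2 x) - (F1 s, F2 s))). split; [ring |].
  intro x. apply cderiv_eq with (0 + (f x - 0)); [| ring].
  apply cderiv_plus; [apply cderiv_const |]. apply cderiv_minus; [| apply cderiv_const].
  split; [apply H1 | apply H2].
Qed.

(** In the weight [exp (L |x - s|)] integration gains [1 / L], so the Picard iteration converges on
    an interval of any length at once. *)
Lemma primitive_exp_bound (f F : R -> C) (s L A r : R) :
  (0 < L)%R -> (0 <= A)%R -> F s = 0 -> (forall x, cderiv F x (f x)) ->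
  (forall x, (Rabs (x - s) <= r)%R -> (Cmod (f x) <= A * exp (L * Rabs (x - s)))%R) ->
  forall x, (Rabs (x - s) <= r)%R -> (Cmod (F x) <= A / L * exp (L * Rabs (x - s)))%R.
Proof.
  intros HL HA Hs HF Hf x Hx.
  assert (HAL : (0 <= A / L)%R) by (apply Rdiv_le_0_compat; assumption).
  destruct (Rle_lt_dec s x) as [h | h].
  - rewrite Rabs_pos_eq in Hx |- * by lra.
    replace (F x) with (F x - F s) by (rewrite Hs; ring).
    eapply Rle_trans.
    + apply (mean_value_ineq F f (fun t => A / L * exp (L * (t - s)))%R
               (fun t => A / L * (L * exp (L * (t - s))))%R); [exact h | | |].
      * intros; apply HF.
      * intros t Ht. apply (is_derive_scal (fun t => exp (L * (t - s)))%R), is_derive_exp_affine.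
      * intros t Ht. specialize (Hf t). rewrite Rabs_pos_eq in Hf by lra.
        replace (A / L * (L * exp (L * (t - s))))%R with (A * exp (L * (t - s)))%R by (field; lra).
        apply Hf; lra.
    + pose proof (exp_pos (L * (s - s))). nra.
  - rewrite Rabs_left in Hx |- * by lra.
    replace (F x) with (- (F s - F x)) by (rewrite Hs; ring). rewrite Cmod_opp.
    eapply Rle_trans.
    + apply (mean_value_ineq F f (fun t => - (A / L) * exp (- L * (t - s)))%R
               (fun t => - (A / L) * (- L * exp (- L * (t - s))))%R); [lra | | |].
      * intros; apply HF.
      * intros t Ht. apply (is_derive_scal (fun t => exp (- L * (t - s)))%R), is_derive_exp_affine.
      * intros t Ht. specialize (Hf t).
        assert (E : Rabs (t - s) = (- (t - s))%R) by (apply Rabs_left1; lra). rewrite E in Hf.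
        replace (- (A / L) * (- L * exp (- L * (t - s))))%R with (A * exp (L * - (t - s)))%R.
        -- apply Hf; lra.
        -- replace (- L * (t - s))%R with (L * - (t - s))%R by ring. field; lra.
    + replace (- L * (x - s))%R with (L * - (x - s))%R by ring.
      pose proof (exp_pos (- L * (s - s))). nra.
Qed.

(** Picard iteration for the first-order system in [(Y, Y1)]. It serves both the Jost solutions,
    started at the right end, and the solutions on [T], started at the left end of each interval. *)
Lemma ode_exists (c : R -> C) (s r : R) (u v : C) :
  (0 < r)%R -> (forall x, ccont c x) ->
  exists Y Y1 : R -> C, Y s = u /\ Y1 s = v /\
    forall x, (Rabs (x - s) < r)%R -> cderiv Y x (Y1 x) /\ cderiv Y1 x (c x * Y x).
Proof.
  intros Hr Hc. pose proof (ccont_parts c Hc) as Hcp.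
  destruct (continuity_ab_maj (fun x => Cmod (c x)) (s - r) (s + r) ltac:(lra)) as [xm [Hm _]].
  { intros x _. apply ccont_Cmod, Hc. }
  set (K := Cmod (c xm)). assert (HK0 : (0 <= K)%R) by apply Cmod_ge_0.
  assert (HK : forall x, (Rabs (x - s) <= r)%R -> (Cmod (c x) <= K)%R).
  { intros x Hx. apply Rabs_le_between in Hx. apply Hm. lra. }
  (* Continuity is carried along with the iterates because each step needs antiderivatives of the
     preceding pair. *)
  set (good := fun P : (R -> C) * (R -> C) =>
    continuous_parts (fst P) /\ continuous_parts (snd P) /\ fst P s = u /\ snd P s = v).
  set (next := fun P P' : (R -> C) * (R -> C) =>
    (forall x, cderiv (fst P') x (snd P x)) /\ (forall x, cderiv (snd P') x (c x * fst P x))).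
  assert (step : forall P : sig good, {P' : sig good | next (proj1_sig P) (proj1_sig P')}).
  { intros [[f g] [F1 [F2 [F3 F4]]]]. apply constructive_indefinite_description.
    destruct (antiderivative_C g s u F2) as [F [HF HF']].
    destruct (antiderivative_C (fun x => c x * f x) s v (mult_parts _ _ Hcp F1)) as [G [HG HG']].
    assert (HH : good (F, G)).
    { split; [eapply cderiv_parts, HF' |]. split; [eapply cderiv_parts, HG' | split; assumption]. }
    exists (exist _ (F, G) HH). split; assumption. }
  assert (good0 : good (fun _ => u, fun _ => v)).
  { split; [apply (cderiv_parts (fun _ => u) (fun _ => 0)); intro; apply cderiv_const |].
    split; [apply (cderiv_parts (fun _ => v) (fun _ => 0)); intro; apply cderiv_const | split; reflexivity]. }
  set (P := fix P n := match n with O => exist good _ good0 | S n => proj1_sig (step (P n)) end).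
  set (f := fun n => fst (proj1_sig (P n))). set (g := fun n => snd (proj1_sig (P n))).
  assert (Df : forall n x, cderiv (f (S n)) x (g n x)).
  { intros n. apply (proj1 (proj2_sig (step (P n)))). }
  assert (Dg : forall n x, cderiv (g (S n)) x (c x * f n x)).
  { intros n. apply (proj2 (proj2_sig (step (P n)))). }
  assert (If : forall n, f n s = u) by (intro n; apply (proj2_sig (P n))).
  assert (Ig : forall n, g n s = v) by (intro n; apply (proj2_sig (P n))).
  assert (f0 : forall x, f O x = u) by reflexivity.
  assert (g0 : forall x, g O x = v) by reflexivity.
  clearbody f g. clear P good0 step.
  assert (Df0 : forall x, cderiv (f O) x 0).
  { intro x. apply (cderiv_ext (fun _ => u)); [intro; now rewrite f0 | apply cderiv_const]. }
  assert (Dg0 : forall x, cderiv (g O) x 0).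
  { intro x. apply (cderiv_ext (fun _ => v)); [intro; now rewrite g0 | apply cderiv_const]. }
  (* One step multiplies by at most [1 + K], so division by [L] halves the increments. *)
  set (L := (2 * (1 + K))%R). assert (HL : (0 < L)%R) by (unfold L; lra).
  set (A := (Cmod v + K * Cmod u)%R).
  assert (HA : (0 <= A)%R).
  { unfold A. pose proof (Cmod_ge_0 u). pose proof (Cmod_ge_0 v). nra. }
  assert (He : forall x, (1 <= exp (L * Rabs (x - s)))%R).
  { intro x. pose proof (exp_ineq1_le (L * Rabs (x - s))). pose proof (Rabs_pos (x - s)). nra. }
  assert (HAL : (A / L <= A)%R).
  { apply Rmult_le_reg_r with L; [exact HL |]. unfold Rdiv. rewrite Rmult_assoc, Rinv_l by lra.
    unfold L. nra. }
  assert (Hinc : forall n x, (Rabs (x - s) <= r)%R ->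
     (Cmod (f (S n) x - f n x) <= A * (/ 2) ^ n * exp (L * Rabs (x - s)) /\
      Cmod (g (S n) x - g n x) <= A * (/ 2) ^ n * exp (L * Rabs (x - s)))%R).
  { induction n as [| n IH]; intros x Hx.
    - simpl pow. rewrite Rmult_1_r. pose proof (Cmod_ge_0 u). pose proof (Cmod_ge_0 v).
      assert (X : forall z, (Cmod z <= A / L * exp (L * Rabs (x - s)))%R -> (Cmod z <= A * exp (L * Rabs (x - s)))%R).
      { intros z Hz. eapply Rle_trans; [exact Hz |]. apply Rmult_le_compat_r; [| exact HAL]. specialize (He x); lra. }
      split; apply X.
      + apply (primitive_exp_bound (fun _ => v) (fun x => f 1%nat x - f O x) s L A r HL HA); [| | | exact Hx].
        * rewrite 2 If; ring.
        * intro t. eapply cderiv_eq; [apply cderiv_minus; [apply Df | apply Df0] |].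
          rewrite g0. ring.
        * intros t Ht. specialize (He t). unfold A in *. nra.
      + apply (primitive_exp_bound (fun x => c x * u) (fun x => g 1%nat x - g O x) s L A r HL HA); [| | | exact Hx].
        * rewrite 2 Ig; ring.
        * intro t. eapply cderiv_eq; [apply cderiv_minus; [apply Dg | apply Dg0] |].
          rewrite f0. ring.
        * intros t Ht. rewrite Cmod_mult. specialize (He t). specialize (HK t Ht).
          assert (Cmod (c t) * Cmod u <= K * Cmod u)%R by nra.
          assert (A <= A * exp (L * Rabs (t - s)))%R by nra. unfold A in *. lra.
    - assert (Hpow : (0 < (/ 2) ^ n)%R) by (apply pow_lt; lra).
      set (B := ((1 + K) * (A * (/ 2) ^ n))%R).
      assert (HB : (0 <= A * (/ 2) ^ n)%R) by nra.
      assert (HB0 : (0 <= B)%R) by (unfold B; nra).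
      assert (EB : (B / L = A * (/ 2) ^ S n)%R) by (unfold B, L; simpl; field; lra).
      rewrite <- EB.
      split.
      + apply (primitive_exp_bound (fun x => g (S n) x - g n x) (fun x => f (S (S n)) x - f (S n) x) s L B r HL HB0);
          [| | | exact Hx].
        * rewrite 2 If; ring.
        * intro t. apply cderiv_minus; apply Df.
        * intros t Ht. destruct (IH t Ht) as [_ I]. eapply Rle_trans; [exact I |].
          apply Rmult_le_compat_r; [specialize (He t); lra |]. unfold B. nra.
      + apply (primitive_exp_bound (fun x => c x * (f (S n) x - f n x)) (fun x => g (S (S n)) x - g (S n) x) s L B r HL HB0);
          [| | | exact Hx].
        * rewrite 2 Ig; ring.
        * intro t. eapply cderiv_eq; [apply cderiv_minus; apply Dg |]. ring.
        * intros t Ht. destruct (IH t Ht) as [I _]. rewrite Cmod_mult. specialize (HK t Ht).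
          specialize (He t). pose proof (Cmod_ge_0 (c t)).
          apply Rle_trans with (K * (A * (/ 2) ^ n * exp (L * Rabs (t - s))))%R.
          -- apply Rmult_le_compat; [apply Cmod_ge_0 | apply Cmod_ge_0 | exact HK | exact I].
          -- rewrite <- Rmult_assoc. apply Rmult_le_compat_r; [lra |]. unfold B. nra. }
  set (A' := (A * exp (L * r))%R).
  assert (HA' : (0 <= A')%R) by (unfold A'; pose proof (exp_pos (L * r)); nra).
  assert (Hw : forall n x, (Rabs (x - s) <= r)%R -> (A * (/ 2) ^ n * exp (L * Rabs (x - s)) <= A' * (/ 2) ^ n)%R).
  { intros n x Hx. unfold A'.
    replace (A * exp (L * r) * (/ 2) ^ n)%R with (A * (/ 2) ^ n * exp (L * r))%R by ring.
    assert (0 < (/ 2) ^ n)%R by (apply pow_lt; lra).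
    apply Rmult_le_compat_l; [nra |].
    destruct (Req_dec (Rabs (x - s)) r) as [-> | n']; [lra |].
    apply Rlt_le, exp_increasing, Rmult_lt_compat_l; lra. }
  destruct (geometric_limit_C (fun x => (Rabs (x - s) <= r)%R) f A') as [Y HY].
  { intros n x Hx. eapply Rle_trans; [apply (Hinc n x Hx) | apply Hw, Hx]. }
  destruct (geometric_limit_C (fun x => (Rabs (x - s) <= r)%R) g A') as [Y1 HY1].
  { intros n x Hx. eapply Rle_trans; [apply (Hinc n x Hx) | apply Hw, Hx]. }
  assert (Hlim : forall z w : C, (forall n, (Cmod (z - w) <= 4 * A' * (/ 2) ^ n)%R) -> z = w).
  { intros z w H. assert (E : Cmod (z - w) = 0%R).
    { apply Rle_antisym; [| apply Cmod_ge_0]. apply le_epsilon. intros eps Heps.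
      destruct (half_pow_small (4 * A') eps ltac:(lra) Heps) as [N HN].
      specialize (HN N (le_n N)). specialize (H N). lra. }
    apply Cmod_eq_0 in E. replace z with (z - w + w) by ring. rewrite E. ring. }
  assert (Hs0 : (Rabs (s - s) <= r)%R).
  { replace (s - s)%R with 0%R by ring. rewrite Rabs_R0. lra. }
  exists Y, Y1. split; [| split].
  - apply Hlim. intro n. specialize (HY n s Hs0). now rewrite If in HY.
  - apply Hlim. intro n. specialize (HY1 n s Hs0). now rewrite Ig in HY1.
  - set (d := mkposreal r Hr).
    (* A common rate for the iterates and their derivatives: the latter lag by one index and may
       carry the factor [K]. *)
    assert (HS : forall n, (4 * A' * (/ 2) ^ S n <= (4 * (1 + K) * A') * (/ 2) ^ n)%R).
    { intro n. simpl. assert (0 < (/ 2) ^ n)%R by (apply pow_lt; lra).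
      assert (0 <= A' * (/ 2) ^ n)%R by nra. nra. }
    assert (HS' : forall n, (4 * A' * (/ 2) ^ n <= (4 * (1 + K) * A') * (/ 2) ^ n)%R).
    { intro n. assert (0 < (/ 2) ^ n)%R by (apply pow_lt; lra).
      assert (0 <= A' * (/ 2) ^ n)%R by nra. nra. }
    assert (HBd : forall x, Boule s d x -> (Rabs (x - s) <= r)%R).
    { intros x Hx. apply Rlt_le, Hx. }
    intros x Hx. split.
    + apply (CVU_cderiv s d (fun n => f (S n)) g Y Y1 (4 * (1 + K) * A')); [| | | exact Hx].
      * intros n y _. apply Df.
      * intros n y Hy. eapply Rle_trans; [apply (HY (S n)), HBd, Hy | apply HS].
      * intros n y Hy. eapply Rle_trans; [apply HY1, HBd, Hy | apply HS'].
    + apply (CVU_cderiv s d (fun n => g (S n)) (fun n x => c x * f n x) Y1 (fun x => c x * Y x) (4 * (1 + K) * A'));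
        [| | | exact Hx].
      * intros n y _. apply Dg.
      * intros n y Hy. eapply Rle_trans; [apply (HY1 (S n)), HBd, Hy | apply HS].
      * intros n y Hy. replace (c y * Y y - c y * f n y) with (c y * (Y y - f n y)) by ring.
        rewrite Cmod_mult. specialize (HK y (HBd y Hy)). specialize (HY n y (HBd y Hy)).
        pose proof (Cmod_ge_0 (c y)). pose proof (Cmod_ge_0 (Y y - f n y)).
        assert (0 < (/ 2) ^ n)%R by (apply pow_lt; lra).
        assert (0 <= A' * (/ 2) ^ n)%R by nra.
        apply Rle_trans with (K * (4 * A' * (/ 2) ^ n))%R; [apply Rmult_le_compat; assumption | nra].
Qed.

(** * Derivatives within a closed interval *)

(** Shaped like [is_delta_deriv] at a point with [jump T x = x]; at an end of the interval it is the
    one-sided derivative. *)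
Definition wderiv (a b : R) (f : R -> C) (x : R) (d : C) : Prop :=
  forall eps, (0 < eps)%R -> exists delta, (0 < delta)%R /\
  forall s, (a <= s <= b)%R -> (Rabs (s - x) < delta)%R ->
    (Cmod (f x - f s - d * RtoC (x - s)) <= eps * Rabs (x - s))%R.

Definition wcont (a b : R) (f : R -> C) (x : R) : Prop :=
  forall eps, (0 < eps)%R -> exists delta, (0 < delta)%R /\
  forall s, (a <= s <= b)%R -> (Rabs (s - x) < delta)%R -> (Cmod (f x - f s) <= eps)%R.

Lemma cderiv_wderiv (a b : R) (f : R -> C) (x : R) (d : C) : cderiv f x d -> wderiv a b f x d.
Proof.
  intros [H1 H2] eps Heps. apply is_derive_Reals in H1, H2.
  destruct (H1 (eps / 2)%R ltac:(lra)) as [d1 K1]. destruct (H2 (eps / 2)%R ltac:(lra)) as [d2 K2].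
  exists (Rmin d1 d2). split; [apply Rmin_pos; apply cond_pos |].
  intros s _ Hs. destruct (Req_dec s x) as [-> | n].
  - replace (x - x)%R with 0%R by ring. replace (f x - f x - d * RtoC 0) with (RtoC 0) by ring.
    rewrite Cmod_0, Rabs_R0. lra.
  - pose proof (Rmin_l d1 d2). pose proof (Rmin_r d1 d2).
    specialize (K1 (s - x)%R ltac:(lra) ltac:(lra)). specialize (K2 (s - x)%R ltac:(lra) ltac:(lra)).
    replace (x + (s - x))%R with s in K1, K2 by ring.
    assert (Hp : (0 < Rabs (s - x))%R) by (apply Rabs_pos_lt; lra).
    assert (X : forall u v w : R, (Rabs ((v - u) / (s - x) - w) < eps / 2)%R ->
       (Rabs (u - v - w * (x - s)) <= eps / 2 * Rabs (s - x))%R).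
    { intros u v w0 Hu. replace (u - v - w0 * (x - s))%R with (- (((v - u) / (s - x) - w0) * (s - x)))%R by (field; lra).
      rewrite Rabs_Ropp, Rabs_mult. apply Rmult_le_compat_r; lra. }
    apply X in K1. apply X in K2.
    eapply Rle_trans; [apply Cmod_le_Re_Im |].
    rewrite (Rabs_minus_sym x s).
    replace (Re (f x - f s - d * RtoC (x - s))) with (Re (f x) - Re (f s) - Re d * (x - s))%R
      by (unfold Re; simpl; ring).
    replace (Im (f x - f s - d * RtoC (x - s))) with (Im (f x) - Im (f s) - Im d * (x - s))%R
      by (unfold Im; simpl; ring).
    lra.
Qed.

Lemma wderiv_cderiv (r : R) (f : R -> C) (x : R) (d : C) :
  (0 < r)%R -> wderiv (x - r) (x + r) f x d -> cderiv f x d.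
Proof.
  intros Hr H.
  assert (X : forall eps, (0 < eps)%R -> exists delta : posreal, forall h, h <> 0%R -> (Rabs h < delta)%R ->
     (Cmod ((f (x + h)%R - f x) * RtoC (/ h) - d) < eps)%R).
  { intros eps Heps. destruct (H (eps / 2)%R ltac:(lra)) as [d0 [Hd0 K]].
    assert (Hm : (0 < Rmin d0 r)%R) by (apply Rmin_pos; lra).
    exists (mkposreal _ Hm). intros h Hh Hh'. simpl in Hh'.
    pose proof (Rmin_l d0 r). pose proof (Rmin_r d0 r).
    assert (Hr' : (Rabs h < r)%R) by lra. apply Rabs_def2 in Hr'.
    specialize (K (x + h)%R ltac:(lra)). replace (x + h - x)%R with h in K by ring.
    specialize (K ltac:(lra)). replace (x - (x + h))%R with (- h)%R in K by ring.
    rewrite Rabs_Ropp in K.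
    assert (Hp : (0 < Rabs h)%R) by (apply Rabs_pos_lt; exact Hh).
    replace ((f (x + h)%R - f x) * RtoC (/ h) - d) with
      (- ((f x - f (x + h)%R - d * RtoC (- h)) * RtoC (/ h))).
    - rewrite Cmod_opp, Cmod_mult, Cmod_R, Rabs_inv.
      apply Rle_lt_trans with (eps / 2 * Rabs h * / Rabs h)%R.
      + apply Rmult_le_compat_r; [apply Rlt_le, Rinv_0_lt_compat, Hp | exact K].
      + rewrite Rmult_assoc, Rinv_r by lra. lra.
    - transitivity ((f (x + h)%R - f x) * RtoC (/ h) - d * (RtoC h * RtoC (/ h))).
      + rewrite RtoC_opp. ring.
      + rewrite <- RtoC_mult, Rinv_r by exact Hh. ring. }
  split; apply is_derive_Reals; intros eps Heps; destruct (X eps Heps) as [d0 K]; exists d0;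
    intros h Hh Hh'; specialize (K h Hh Hh'); eapply Rle_lt_trans; [| apply K | | apply K].
  - eapply Rle_trans; [| apply re_le_Cmod]. right. f_equal. unfold Re, Rdiv; simpl. ring.
  - eapply Rle_trans; [| apply im_le_Cmod]. right. f_equal. unfold Im, Rdiv; simpl. ring.
Qed.

Lemma wderiv_ext (a b : R) (f g : R -> C) (x : R) (d : C) :
  (a <= x <= b)%R -> (forall t, (a <= t <= b)%R -> f t = g t) -> wderiv a b f x d -> wderiv a b g x d.
Proof.
  intros Hx E H eps Heps. destruct (H eps Heps) as [d0 [Hd0 K]]. exists d0; split; [exact Hd0 |].
  intros s Hs Hs'. rewrite <- 2 E by assumption. apply K; assumption.
Qed.

Lemma wderiv_sub (a b a' b' : R) (f : R -> C) (x : R) (d : C) :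
  (a <= a')%R -> (b' <= b)%R -> wderiv a b f x d -> wderiv a' b' f x d.
Proof.
  intros Ha Hb H eps Heps. destruct (H eps Heps) as [d0 [Hd0 K]]. exists d0; split; [exact Hd0 |].
  intros s Hs. apply K; lra.
Qed.

Lemma wderiv_wcont (a b : R) (f : R -> C) (x : R) (d : C) : wderiv a b f x d -> wcont a b f x.
Proof.
  intros H eps Heps. destruct (H 1%R ltac:(lra)) as [d0 [Hd0 K]].
  pose proof (Cmod_ge_0 d) as Hd.
  exists (Rmin d0 (eps / (1 + Cmod d)))%R. split.
  - apply Rmin_pos; [exact Hd0 | apply Rdiv_lt_0_compat; lra].
  - intros s Hs Hs'. pose proof (Rmin_l d0 (eps / (1 + Cmod d))). pose proof (Rmin_r d0 (eps / (1 + Cmod d))).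
    specialize (K s Hs ltac:(lra)).
    pose proof (Cmod_triangle (f x - f s - d * RtoC (x - s)) (d * RtoC (x - s))) as T.
    replace (f x - f s - d * RtoC (x - s) + d * RtoC (x - s)) with (f x - f s) in T by ring.
    rewrite Cmod_mult, Cmod_R in T. rewrite (Rabs_minus_sym x s) in *.
    assert (Rabs (s - x) * (1 + Cmod d) <= eps)%R; [| nra].
    apply Rle_trans with (eps / (1 + Cmod d) * (1 + Cmod d))%R.
    + apply Rmult_le_compat_r; lra.
    + right. field. lra.
Qed.

(** Continuation by the tangent lines at the ends turns one-sided derivatives into two-sided
    ones. *)
Lemma wderiv_extend (a b : R) (f d : R -> C) : (a < b)%R ->
  (forall x, (a <= x <= b)%R -> wderiv a b f x (d x)) ->
  exists F, (forall x, (a <= x <= b)%R -> F x = f x) /\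
            (forall x, (a <= x <= b)%R -> cderiv F x (d x)).
Proof.
  intros Hab H.
  set (F := fun x => if Rlt_dec x a then f a + d a * RtoC (x - a)
                     else if Rlt_dec b x then f b + d b * RtoC (x - b) else f x).
  assert (EF : forall x, (a <= x <= b)%R -> F x = f x).
  { intros x Hx. unfold F. destruct (Rlt_dec x a); [lra |]. destruct (Rlt_dec b x); [lra | reflexivity]. }
  exists F. split; [exact EF |].
  intros x Hx. apply (wderiv_cderiv 1); [lra |].
  intros eps Heps. destruct (H x Hx eps Heps) as [d0 [Hd0 K]].
  (* Points within [da] of [x] lie beyond [a] only when [x = a]; the value 1 is arbitrary. *)
  set (da := if Req_dec_T x a then 1%R else (x - a)%R).
  set (db := if Req_dec_T x b then 1%R else (b - x)%R).
  assert (Hda : (0 < da)%R) by (unfold da; destruct (Req_dec_T x a); lra).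
  assert (Hdb : (0 < db)%R) by (unfold db; destruct (Req_dec_T x b); lra).
  exists (Rmin d0 (Rmin da db)). split; [repeat apply Rmin_pos; assumption |].
  intros s _ Hs.
  pose proof (Rmin_l d0 (Rmin da db)). pose proof (Rmin_r d0 (Rmin da db)).
  pose proof (Rmin_l da db). pose proof (Rmin_r da db).
  rewrite (EF x Hx).
  assert (Hs1 : (Rabs (s - x) < da)%R) by lra. assert (Hs2 : (Rabs (s - x) < db)%R) by lra.
  apply Rabs_def2 in Hs1. apply Rabs_def2 in Hs2.
  unfold F. destruct (Rlt_dec s a) as [h | h].
  - unfold da in Hs1. destruct (Req_dec_T x a) as [-> | n]; [| lra].
    replace (f a - (f a + d a * RtoC (s - a)) - d a * RtoC (a - s)) with (RtoC 0)
      by (rewrite 2 RtoC_minus; ring).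
    rewrite Cmod_0. pose proof (Rabs_pos (a - s)). nra.
  - destruct (Rlt_dec b s) as [h' | h'].
    + unfold db in Hs2. destruct (Req_dec_T x b) as [-> | n]; [| lra].
      replace (f b - (f b + d b * RtoC (s - b)) - d b * RtoC (b - s)) with (RtoC 0)
        by (rewrite 2 RtoC_minus; ring).
      rewrite Cmod_0. pose proof (Rabs_pos (b - s)). nra.
    + apply K; lra.
Qed.

Lemma wderiv_ode (a b : R) (c Y Y1 : R -> C) : (a < b)%R ->
  (forall x, (a <= x <= b)%R -> wderiv a b Y x (Y1 x) /\ wderiv a b Y1 x (c x * Y x)) ->
  exists F F1, (forall x, (a <= x <= b)%R -> F x = Y x /\ F1 x = Y1 x) /\ ode a b c F F1.
Proof.
  intros Hab H.
  destruct (wderiv_extend a b Y Y1 Hab) as [F [EF DF]]; [intros; now apply H |].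
  destruct (wderiv_extend a b Y1 (fun x => c x * Y x) Hab) as [F1 [EF1 DF1]]; [intros; now apply H |].
  exists F, F1. split; [intros; split; auto |].
  intros x Hx. split.
  - rewrite (EF1 x Hx). apply DF, Hx.
  - rewrite (EF x Hx). apply (DF1 x Hx).
Qed.

(** If [f] is continuous at [b] and its derivative has a limit there, that limit is the derivative.
    This is needed at [b k] before a gap, where delta-differentiability gives continuity but no left
    derivative. *)
Lemma wderiv_right_end (a b : R) (f d : R -> C) : (a < b)%R ->
  (forall x, (a <= x < b)%R -> wderiv a b f x (d x)) ->
  wcont a b f b -> wcont a b d b -> wderiv a b f b (d b).
Proof.
  intros Hab H Hf Hd eps Heps. destruct (Hd eps Heps) as [d0 [Hd0 K]].
  exists d0. split; [exact Hd0 |]. intros s Hs Hs'.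
  destruct (Req_dec s b) as [-> | n].
  { replace (b - b)%R with 0%R by ring. replace (f b - f b - d b * RtoC 0) with (RtoC 0) by ring.
    rewrite Cmod_0, Rabs_R0. lra. }
  assert (Hsb : (s < b)%R) by lra. rewrite (Rabs_pos_eq (b - s)) by lra.
  apply Rabs_def2 in Hs'.
  apply (le_of_le_scaled_eps _ _ (1 + Cmod (d b))).
  intros e He. destruct (Hf e He) as [d1 [Hd1 K1]].
  (* The mean value inequality is applied on [[s, s']], away from [b]; [s'] then tends to [b] as [e]
     tends to 0. *)
  set (s' := (b - Rmin (Rmin (d1 / 2) (e / 2)) ((b - s) / 2))%R).
  assert (Hs1 : (s < s' < b /\ b - s' < d1 /\ b - s' <= e)%R).
  { unfold s'. pose proof (Rmin_l (Rmin (d1 / 2) (e / 2)) ((b - s) / 2)).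
    pose proof (Rmin_r (Rmin (d1 / 2) (e / 2)) ((b - s) / 2)).
    pose proof (Rmin_l (d1 / 2) (e / 2)). pose proof (Rmin_r (d1 / 2) (e / 2)).
    assert (0 < Rmin (Rmin (d1 / 2) (e / 2)) ((b - s) / 2))%R by (repeat apply Rmin_pos; lra). lra. }
  destruct (wderiv_extend s s' f d ltac:(lra)) as [F [EF DF]].
  { intros x Hx. apply (wderiv_sub a b); [lra | lra |]. apply H; lra. }
  assert (I : (Cmod ((F s' - d b * RtoC s') - (F s - d b * RtoC s)) <= eps * s' - eps * s)%R).
  { apply (mean_value_ineq (fun t => F t - d b * RtoC t) (fun t => d t - d b * 1)
             (fun t => eps * t)%R (fun _ => eps * 1)%R); [lra | | |].
    - intros t Ht. apply cderiv_minus; [apply DF, Ht |].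
      apply cderiv_scal, (cderiv_RtoC (fun t => t)), (is_derive_id (K:=R_AbsRing)).
    - intros t Ht. apply (is_derive_scal (fun t => t)), (is_derive_id (K:=R_AbsRing)).
    - intros t Ht. rewrite Cmult_1_r, Cmod_sub_sym, Rmult_1_r. apply K; [lra |].
      apply Rabs_def1; lra. }
  rewrite 2 EF in I by lra.
  specialize (K1 s' ltac:(lra) ltac:(apply Rabs_def1; lra)).
  replace (f b - f s - d b * RtoC (b - s)) with
    ((f b - f s') + (- (d b * RtoC (b - s')) + ((f s' - d b * RtoC s') - (f s - d b * RtoC s))))
    by (rewrite 2 RtoC_minus; ring).
  eapply Rle_trans; [apply Cmod_triangle |].
  eapply Rle_trans; [apply Rplus_le_compat_l, Cmod_triangle |].
  rewrite Cmod_opp, Cmod_mult, Cmod_R, Rabs_pos_eq by lra.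
  pose proof (Cmod_ge_0 (d b)).
  assert (Cmod (d b) * (b - s') <= Cmod (d b) * e)%R by (apply Rmult_le_compat_l; lra). nra.
Qed.

Lemma wcont_mult (a b : R) (f g : R -> C) (x : R) :
  wcont a b f x -> wcont a b g x -> wcont a b (fun t => f t * g t) x.
Proof.
  intros Hf Hg eps Heps.
  set (A := Cmod (f x)). set (B := Cmod (g x)).
  assert (HA : (0 <= A)%R) by apply Cmod_ge_0. assert (HB : (0 <= B)%R) by apply Cmod_ge_0.
  set (e := Rmin 1 (eps / (A + B + 1))).
  assert (He : (0 < e <= 1)%R).
  { unfold e. split; [apply Rmin_pos; [lra | apply Rdiv_lt_0_compat; lra] | apply Rmin_l]. }
  assert (He2 : (e * (A + B + 1) <= eps)%R).
  { apply Rle_trans with (eps / (A + B + 1) * (A + B + 1))%R.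
    - apply Rmult_le_compat_r; [lra | apply Rmin_r].
    - right; field; lra. }
  destruct (Hf e ltac:(lra)) as [d1 [Hd1 K1]]. destruct (Hg e ltac:(lra)) as [d2 [Hd2 K2]].
  exists (Rmin d1 d2). split; [apply Rmin_pos; assumption |].
  intros s Hs Hs'. pose proof (Rmin_l d1 d2). pose proof (Rmin_r d1 d2).
  specialize (K1 s Hs ltac:(lra)). specialize (K2 s Hs ltac:(lra)).
  replace (f x * g x - f s * g s) with
    (f x * (g x - g s) + ((f x - f s) * g x + - ((f x - f s) * (g x - g s)))) by ring.
  eapply Rle_trans; [apply Cmod_triangle |].
  eapply Rle_trans; [apply Rplus_le_compat_l, Cmod_triangle |].
  rewrite Cmod_opp, 3 Cmod_mult. fold A B.
  pose proof (Cmod_ge_0 (f x - f s)). pose proof (Cmod_ge_0 (g x - g s)). nra.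
Qed.

Lemma continuous_on_eps (T : R -> Prop) (q : R -> C) (x : R) :
  continuous_on T q -> T x -> forall eps, (0 < eps)%R ->
  exists delta, (0 < delta)%R /\
    forall y, T y -> (Rabs (y - x) < delta)%R -> (Cmod (q y - q x) < eps)%R.
Proof.
  intros H Hx eps Heps.
  specialize (H x Hx (fun z => (Cmod (z - q x) < eps)%R)).
  destruct H as [d Hd].
  - exists (mkposreal (eps / 2) ltac:(lra)). intros z [Hz1 Hz2].
    eapply Rle_lt_trans; [apply Cmod_le_Re_Im |].
    unfold ball, AbsRing_ball, abs, minus, plus, opp in Hz1, Hz2; simpl in Hz1, Hz2.
    unfold AbsRing_ball, abs, minus, plus, opp in Hz1, Hz2; simpl in Hz1, Hz2.
    unfold Re, Im; simpl. lra.
  - exists d. split; [apply cond_pos |]. intros y Hy Hyx. apply (Hd y); assumption.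
Qed.

(** Composition with the 1-Lipschitz projection onto [[a, b]] gives a coefficient continuous on all
    of [R], as [ode_exists] requires. *)
Lemma clamp_extension (T : R -> Prop) (q : R -> C) (a b : R) :
  (a <= b)%R -> continuous_on T q -> (forall x, (a <= x <= b)%R -> T x) ->
  exists qc, (forall x, ccont qc x) /\ (forall x, (a <= x <= b)%R -> qc x = q x).
Proof.
  intros Hab Hq HT.
  set (cl := fun x => Rmax a (Rmin x b)).
  assert (Hcl : forall x, (a <= cl x <= b)%R).
  { intro x. unfold cl. split; [apply Rmax_l |]. apply Rmax_lub; [exact Hab | apply Rmin_r]. }
  assert (Hlip : forall x y, (Rabs (cl y - cl x) <= Rabs (y - x))%R).
  { intros x y. unfold cl, Rmax, Rmin, Rabs.
    repeat destruct Rle_dec; repeat destruct Rcase_abs; lra. }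
  exists (fun x => q (cl x)). split.
  - intros x eps Heps.
    destruct (continuous_on_eps T q (cl x) Hq (HT _ (Hcl x)) eps Heps) as [d [Hd K]].
    exists d; split; [exact Hd |]. intros y Hy. apply K; [apply HT, Hcl |].
    eapply Rle_lt_trans; [apply Hlip | exact Hy].
  - intros x Hx. f_equal. unfold cl. rewrite Rmin_left, Rmax_right; lra.
Qed.

(** * The time-scale equation as a piecewise equation *)

(* Solutions on [a_j, b_j], ..., [a_N, b_N] of [y'' = c y], with the jump
   conditions that the time-scale equation imposes across the gaps. *)
Definition piecewise_sol (j N : nat) (a b : nat -> R) (c Y Y1 : R -> C) : Prop :=
  (forall k, (j <= k <= N)%nat -> forall x, (a k <= x <= b k)%R ->
     wderiv (a k) (b k) Y x (Y1 x) /\ wderiv (a k) (b k) Y1 x (c x * Y x)) /\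
  (forall k, (j <= k < N)%nat ->
     Y (a (S k)) = Y (b k) + Y1 (b k) * RtoC (a (S k) - b k) /\
     Y1 (a (S k)) = Y1 (b k) + c (b k) * Y (a (S k)) * RtoC (a (S k) - b k)).

Section TimeScale.
Variables (N : nat) (a b : nat -> R).
Hypothesis HN : (1 <= N)%nat.
Hypothesis Hab : forall k, (1 <= k <= N)%nat -> (a k < b k)%R.
Hypothesis Hgap : forall k, (1 <= k < N)%nat -> (b k < a (S k))%R.
Let T := intervals N a b.

Lemma interval_in (k : nat) (x : R) : (1 <= k <= N)%nat -> (a k <= x <= b k)%R -> T x.
Proof. intros Hk Hx. exists k; split; assumption. Qed.

Lemma intervals_ordered (j k : nat) : (1 <= j)%nat -> (j < k <= N)%nat -> (b j < a k)%R.
Proof.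
  intros Hj. induction k as [| k IH]; [lia |]. intro Hk.
  destruct (Nat.eq_dec j k) as [-> | n]; [apply Hgap; lia |].
  apply Rlt_trans with (a k); [apply IH; lia |].
  apply Rlt_trans with (b k); [apply Hab; lia | apply Hgap; lia].
Qed.

Lemma T_le_end (s : R) : T s -> (s <= b N)%R.
Proof.
  intros [k [Hk Hs]]. destruct (Nat.eq_dec k N) as [-> | n]; [lra |].
  pose proof (intervals_ordered k N ltac:(lia) ltac:(lia)). pose proof (Hab N ltac:(lia)). lra.
Qed.

Lemma sup_T : real (Lub_Rbar T) = b N.
Proof.
  rewrite (is_lub_Rbar_unique T (Finite (b N))); [reflexivity |]. split.
  - intros s Hs. apply T_le_end, Hs.
  - intros l Hl. apply (Hl (b N)). apply (interval_in N); [lia |]. pose proof (Hab N ltac:(lia)); lra.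
Qed.

Lemma jump_end : jump T (b N) = b N.
Proof. unfold jump. rewrite sup_T. destruct (Req_EM_T (b N) (b N)); [reflexivity | contradiction]. Qed.

Lemma jump_inside (k : nat) (x : R) : (1 <= k <= N)%nat -> (a k <= x < b k)%R -> jump T x = x.
Proof.
  intros Hk Hx. unfold jump. rewrite sup_T.
  destruct (Req_EM_T x (b N)) as [E | _].
  { exfalso. destruct (Nat.eq_dec k N) as [-> | n]; [lra |].
    pose proof (intervals_ordered k N ltac:(lia) ltac:(lia)). pose proof (Hab N ltac:(lia)). lra. }
  rewrite (is_glb_Rbar_unique _ (Finite x)); [reflexivity |]. split.
  - intros s [_ Hs]. simpl. lra.
  - intros l Hl. destruct l as [l | |]; simpl; [| | exact I].
    + destruct (Rle_lt_dec l x) as [h | h]; [exact h | exfalso].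
      set (s := ((x + Rmin l (b k)) / 2)%R).
      pose proof (Rmin_l l (b k)). pose proof (Rmin_r l (b k)).
      assert (x < Rmin l (b k))%R by (apply Rmin_glb_lt; lra).
      assert (Hs : (x < s < Rmin l (b k))%R) by (unfold s; lra).
      specialize (Hl s). simpl in Hl.
      assert (l <= s)%R; [| lra]. apply Hl. split; [apply (interval_in k); [exact Hk | lra] | lra].
    + apply (Hl (b k)). split; [apply (interval_in k); [exact Hk | lra] | lra].
Qed.

Lemma jump_gap (k : nat) : (1 <= k < N)%nat -> jump T (b k) = a (S k).
Proof.
  intro Hk. unfold jump. rewrite sup_T.
  destruct (Req_EM_T (b k) (b N)) as [E | _].
  { exfalso. pose proof (intervals_ordered k N ltac:(lia) ltac:(lia)). pose proof (Hab N ltac:(lia)). lra. }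
  rewrite (is_glb_Rbar_unique _ (Finite (a (S k)))); [reflexivity |]. split.
  - intros s [[j [Hj Hs]] Hs']. simpl.
    destruct (Nat.lt_trichotomy j k) as [h | [-> | h]].
    + pose proof (intervals_ordered j k ltac:(lia) ltac:(lia)). pose proof (Hab k ltac:(lia)). lra.
    + lra.
    + destruct (Nat.eq_dec j (S k)) as [-> | n]; [lra |].
      pose proof (intervals_ordered (S k) j ltac:(lia) ltac:(lia)). pose proof (Hab (S k) ltac:(lia)). lra.
  - intros l Hl. apply Hl. pose proof (Hab (S k) ltac:(lia)). pose proof (Hgap k Hk).
    split; [apply (interval_in (S k)); [lia | lra] | lra].
Qed.

Lemma interval_isolated (k : nat) (x : R) : (1 <= k <= N)%nat -> (a k <= x <= b k)%R ->
  exists delta, (0 < delta)%R /\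
    forall s, T s -> (x - delta < s < x + delta)%R -> (a k <= s <= b k)%R.
Proof.
  intros Hk Hx.
  (* Width of the gap to the left; the first interval has none, and 1 is arbitrary. Likewise [dr] on
     the right. *)
  set (dl := if Nat.eq_dec k 1 then 1%R else (a k - b (k - 1)%nat)%R).
  set (dr := if Nat.eq_dec k N then 1%R else (a (S k) - b k)%R).
  assert (Hl : (0 < dl)%R).
  { unfold dl. destruct (Nat.eq_dec k 1); [lra |].
    pose proof (intervals_ordered (k - 1) k ltac:(lia) ltac:(lia)). lra. }
  assert (Hr : (0 < dr)%R).
  { unfold dr. destruct (Nat.eq_dec k N); [lra |]. pose proof (Hgap k ltac:(lia)). lra. }
  exists (Rmin dl dr). split; [apply Rmin_pos; assumption |].
  pose proof (Rmin_l dl dr). pose proof (Rmin_r dl dr).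
  intros s [j [Hj Hs]] Hsx.
  destruct (Nat.lt_trichotomy j k) as [h | [-> | h]]; [exfalso | exact Hs | exfalso].
  - unfold dl in *. destruct (Nat.eq_dec k 1); [lia |].
    assert (b j <= b (k - 1)%nat)%R; [| lra].
    destruct (Nat.eq_dec j (k - 1)) as [-> | n']; [lra |].
    pose proof (intervals_ordered j (k - 1) ltac:(lia) ltac:(lia)).
    pose proof (Hab (k - 1)%nat ltac:(lia)). lra.
  - unfold dr in *. destruct (Nat.eq_dec k N); [lia |].
    assert (a (S k) <= a j)%R; [| lra].
    destruct (Nat.eq_dec j (S k)) as [-> | n']; [lra |].
    pose proof (intervals_ordered (S k) j ltac:(lia) ltac:(lia)).
    pose proof (Hab (S k) ltac:(lia)). lra.
Qed.

Lemma jump_cases (k : nat) (x : R) : (1 <= k <= N)%nat -> (a k <= x <= b k)%R ->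
  jump T x = x \/ ((k < N)%nat /\ x = b k /\ jump T x = a (S k)).
Proof.
  intros Hk Hx. destruct (Rle_lt_dec (b k) x) as [h | h].
  - assert (x = b k) as -> by lra. destruct (Nat.eq_dec k N) as [-> | n].
    + left. apply jump_end.
    + right. split; [lia |]. split; [reflexivity | apply jump_gap; lia].
  - left. apply (jump_inside k); [exact Hk | lra].
Qed.

Lemma jump_in (x : R) : T x -> T (jump T x).
Proof.
  intros [k [Hk Hx]]. destruct (jump_cases k x Hk Hx) as [-> | [H1 [_ ->]]].
  - apply (interval_in k); assumption.
  - apply (interval_in (S k)); [lia |]. pose proof (Hab (S k) ltac:(lia)); lra.
Qed.

(** Arbitrarily close to [x] there is a point of [T] other than [jump T x]: a neighbour in the same
    interval, or [b k] itself before a gap. Uniqueness identifies the value chosen by [epsilon] in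
    [delta_deriv]. *)
Lemma delta_deriv_unique (f : R -> C) (x : R) (d e : C) : T x ->
  is_delta_deriv T f x d -> is_delta_deriv T f x e -> d = e.
Proof.
  intros [k [Hk Hx]] Hd He.
  assert (E : (Cmod (d - e) <= 0)%R).
  { apply le_epsilon. intros eps Heps. rewrite Rplus_0_l.
    destruct (Hd (eps / 2)%R ltac:(lra)) as [d1 [Hd1 K1]].
    destruct (He (eps / 2)%R ltac:(lra)) as [d2 [Hd2 K2]].
    assert (Hm : (0 < Rmin d1 d2)%R) by (apply Rmin_pos; assumption).
    pose proof (Rmin_l d1 d2). pose proof (Rmin_r d1 d2).
    assert (Hs : exists s, T s /\ (x - Rmin d1 d2 < s < x + Rmin d1 d2)%R /\ s <> jump T x).
    { destruct (jump_cases k x Hk Hx) as [-> | [H1 [-> ->]]].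
      - pose proof (Hab k Hk). destruct (Rle_lt_dec (b k) x) as [h | h].
        + set (m := Rmin (Rmin d1 d2 / 2) ((b k - a k) / 2)).
          assert (0 < m)%R by (apply Rmin_pos; lra).
          pose proof (Rmin_l (Rmin d1 d2 / 2) ((b k - a k) / 2)).
          pose proof (Rmin_r (Rmin d1 d2 / 2) ((b k - a k) / 2)). fold m in H3, H4.
          exists (x - m)%R. split; [apply (interval_in k); [exact Hk | lra] | split; lra].
        + set (m := Rmin (Rmin d1 d2 / 2) ((b k - x) / 2)).
          assert (0 < m)%R by (apply Rmin_pos; lra).
          pose proof (Rmin_l (Rmin d1 d2 / 2) ((b k - x) / 2)).
          pose proof (Rmin_r (Rmin d1 d2 / 2) ((b k - x) / 2)). fold m in H3, H4.
          exists (x + m)%R. split; [apply (interval_in k); [exact Hk | lra] | split; lra].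
      - exists (b k). split; [apply (interval_in k); assumption |].
        pose proof (Hgap k ltac:(lia)). split; lra. }
    destruct Hs as [s [HTs [Hs1 Hs2]]].
    specialize (K1 s HTs ltac:(lra)). specialize (K2 s HTs ltac:(lra)).
    set (h := (jump T x - s)%R) in *.
    assert (Hh : (0 < Rabs h)%R) by (apply Rabs_pos_lt; unfold h; lra).
    apply Rmult_le_reg_r with (Rabs h); [exact Hh |].
    rewrite <- (Cmod_R h) at 1. rewrite <- Cmod_mult.
    replace ((d - e) * RtoC h) with
      ((f (jump T x) - f s - e * RtoC h) + - (f (jump T x) - f s - d * RtoC h)) by ring.
    eapply Rle_trans; [apply Cmod_triangle |]. rewrite Cmod_opp. lra. }
  assert (E0 : d - e = 0) by (apply Cmod_eq_0, Rle_antisym; [exact E | apply Cmod_ge_0]).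
  replace d with (d - e + e) by ring. rewrite E0. ring.
Qed.

Lemma delta_deriv_eq (f : R -> C) (x : R) (d : C) : T x ->
  is_delta_deriv T f x d -> delta_deriv T f x = d.
Proof.
  intros Hx H. apply (delta_deriv_unique f x); [exact Hx | | exact H].
  unfold delta_deriv. apply epsilon_spec. exists d; exact H.
Qed.

Lemma delta_deriv_spec (f : R -> C) (x : R) :
  ex_delta_deriv T f x -> is_delta_deriv T f x (delta_deriv T f x).
Proof. intro H. unfold delta_deriv. apply epsilon_spec, H. Qed.

Lemma is_delta_deriv_ext (f g : R -> C) (x : R) (d : C) : T x ->
  (forall t, T t -> f t = g t) -> is_delta_deriv T f x d -> is_delta_deriv T g x d.
Proof.
  intros Hx E H eps Heps. destruct (H eps Heps) as [d0 [Hd0 K]]. exists d0; split; [exact Hd0 |].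
  intros s Hs Hs'. rewrite <- 2 E by (try apply jump_in; assumption). apply K; assumption.
Qed.

Lemma delta_wderiv (k : nat) (f : R -> C) (x : R) (d : C) :
  (1 <= k <= N)%nat -> (a k <= x <= b k)%R -> jump T x = x ->
  (is_delta_deriv T f x d <-> wderiv (a k) (b k) f x d).
Proof.
  intros Hk Hx Hj. split; intros H eps Heps; destruct (H eps Heps) as [d0 [Hd0 K]].
  - rewrite Hj in K. exists d0; split; [exact Hd0 |]. intros s Hs Hs'. apply Rabs_def2 in Hs'.
    apply K; [apply (interval_in k); assumption | lra].
  - destruct (interval_isolated k x Hk Hx) as [d1 [Hd1 K1]].
    rewrite Hj. exists (Rmin d0 d1). split; [apply Rmin_pos; assumption |].
    pose proof (Rmin_l d0 d1). pose proof (Rmin_r d0 d1). intros s Hs Hs'.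
    apply K; [apply K1; [exact Hs | lra] | apply Rabs_def1; lra].
Qed.

(** At a right-scattered point, [s = b k] yields the difference quotient across the gap and [s]
    tending to [b k] yields continuity from the left; nothing else is encoded. *)
Lemma delta_gap (k : nat) (f : R -> C) (d : C) : (1 <= k < N)%nat ->
  (is_delta_deriv T f (b k) d <->
   f (a (S k)) = f (b k) + d * RtoC (a (S k) - b k) /\ wcont (a k) (b k) f (b k)).
Proof.
  intro Hk. pose proof (Hgap k Hk) as Hg. pose proof (Hab k ltac:(lia)) as Hl.
  pose proof (jump_gap k Hk) as Hj. set (h := (a (S k) - b k)%R).
  assert (Hb : T (b k)) by (apply (interval_in k); [lia | lra]).
  split.
  - intro H.
    assert (E : f (a (S k)) = f (b k) + d * RtoC h).
    { assert (E0 : (Cmod (f (a (S k)) - f (b k) - d * RtoC h) <= 0)%R).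
      { apply (le_of_le_scaled_eps _ _ h). intros e He. rewrite Rplus_0_l.
        destruct (H e He) as [d0 [Hd0 K]]. rewrite Hj in K.
        specialize (K (b k) Hb ltac:(lra)). fold h in K. rewrite (Rabs_pos_eq h) in K by (unfold h; lra). lra. }
      apply (fun p => Rle_antisym _ _ p (Cmod_ge_0 _)) in E0. apply Cmod_eq_0 in E0.
      replace (f (a (S k))) with (f (a (S k)) - f (b k) - d * RtoC h + (f (b k) + d * RtoC h)) by ring.
      rewrite E0. ring. }
    split; [exact E |].
    intros eps Heps.
    set (L := (a (S k) - a k)%R). assert (HL : (0 < L)%R) by (unfold L; lra).
    destruct (H (eps / (2 * L))%R ltac:(apply Rdiv_lt_0_compat; lra)) as [d0 [Hd0 K]].
    pose proof (Cmod_ge_0 d) as Hd.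
    exists (Rmin d0 (eps / (2 * (Cmod d + 1))))%R. split.
    { apply Rmin_pos; [exact Hd0 | apply Rdiv_lt_0_compat; lra]. }
    intros s Hs Hs'. pose proof (Rmin_l d0 (eps / (2 * (Cmod d + 1)))).
    pose proof (Rmin_r d0 (eps / (2 * (Cmod d + 1)))).
    assert (Hs2 : (Rabs (s - b k) <= eps / (2 * (Cmod d + 1)))%R) by lra.
    apply Rabs_def2 in Hs'. rewrite Hj in K.
    specialize (K s ltac:(apply (interval_in k); [lia | lra]) ltac:(lra)).
    rewrite E, (Rabs_pos_eq (a (S k) - s)) in K by lra.
    replace (f (b k) - f s) with
      ((f (b k) + d * RtoC h - f s - d * RtoC (a (S k) - s)) + d * RtoC (b k - s))
      by (unfold h; rewrite 3 RtoC_minus; ring).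
    eapply Rle_trans; [apply Cmod_triangle |]. rewrite Cmod_mult, Cmod_R, (Rabs_minus_sym (b k) s).
    assert (B1 : (eps / (2 * L) * (a (S k) - s) <= eps / 2)%R).
    { apply Rle_trans with (eps / (2 * L) * L)%R.
      - apply Rmult_le_compat_l; [apply Rlt_le, Rdiv_lt_0_compat; lra | unfold L; lra].
      - right; field; lra. }
    assert (B2 : (Cmod d * Rabs (s - b k) <= eps / 2)%R).
    { apply Rle_trans with ((Cmod d + 1) * (eps / (2 * (Cmod d + 1))))%R.
      - apply Rmult_le_compat; [exact Hd | apply Rabs_pos | lra | exact Hs2].
      - right; field; lra. }
    lra.
  - intros [E Hc] eps Heps.
    assert (Hh : (0 < h)%R) by (unfold h; lra). pose proof (Cmod_ge_0 d) as Hd.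
    destruct (Hc (eps * h / 2)%R ltac:(nra)) as [d0 [Hd0 K]].
    destruct (interval_isolated k (b k) ltac:(lia) ltac:(lra)) as [d1 [Hd1 K1]].
    assert (Hd2 : (0 < eps * h / (2 * (Cmod d + 1)))%R) by (apply Rdiv_lt_0_compat; nra).
    set (d2 := (eps * h / (2 * (Cmod d + 1)))%R) in *.
    exists (Rmin d0 (Rmin d1 d2)). split; [repeat apply Rmin_pos; assumption |].
    pose proof (Rmin_l d0 (Rmin d1 d2)). pose proof (Rmin_r d0 (Rmin d1 d2)).
    pose proof (Rmin_l d1 d2). pose proof (Rmin_r d1 d2).
    intros s Hs Hs'. rewrite Hj.
    pose proof (K1 s Hs ltac:(lra)) as Hsk. specialize (K s Hsk ltac:(apply Rabs_def1; lra)).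
    rewrite E, (Rabs_pos_eq (a (S k) - s)) by lra. fold h.
    replace (f (b k) + d * RtoC h - f s - d * RtoC (a (S k) - s)) with
      ((f (b k) - f s) + - (d * RtoC (b k - s)))
      by (unfold h; rewrite 3 RtoC_minus; ring).
    eapply Rle_trans; [apply Cmod_triangle |]. rewrite Cmod_opp, Cmod_mult, Cmod_R, (Rabs_pos_eq (b k - s)) by lra.
    assert (B2 : (Cmod d * (b k - s) <= eps * h / 2)%R).
    { apply Rle_trans with ((Cmod d + 1) * d2)%R.
      - apply Rmult_le_compat; lra.
      - right; unfold d2; field; lra. }
    assert (eps * h <= eps * (a (S k) - s))%R by (apply Rmult_le_compat_l; unfold h; lra). lra.
Qed.

Section Equation.
Variables (q : R -> C) (lam : C).
Hypothesis Hq : continuous_on T q.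
Let c := fun x => q x - lam.

Lemma coefficient_wcont (k : nat) (x : R) : (1 <= k <= N)%nat -> (a k <= x <= b k)%R -> wcont (a k) (b k) c x.
Proof.
  intros Hk Hx eps Heps.
  destruct (continuous_on_eps T q x Hq (interval_in k x Hk Hx) eps Heps) as [d [Hd K]].
  exists d; split; [exact Hd |]. intros s Hs Hs'.
  replace (c x - c s) with (- (q s - q x)) by (unfold c; ring). rewrite Cmod_opp.
  apply Rlt_le, K; [apply (interval_in k); assumption | exact Hs'].
Qed.

(** Before a gap the time-scale equation involves [y] at [a (S k)], so it becomes the jump condition
    for [y1]. The differential equation at [b k] is instead recovered from the interior by
    continuity, through [wderiv_right_end]. *)
Lemma solution_piecewise (y : R -> C) :
  is_solution T q lam y -> piecewise_sol 1 N a b c y (delta_deriv T y).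
Proof.
  intros [H1 [H2 H3]]. set (y1 := delta_deriv T y) in *.
  assert (D1 : forall x, T x -> is_delta_deriv T y x (y1 x)).
  { intros x Hx. apply delta_deriv_spec, H1, Hx. }
  assert (D2 : forall x, T x -> is_delta_deriv T y1 x (c x * y (jump T x))).
  { intros x Hx. pose proof (delta_deriv_spec y1 x (H2 x Hx)) as D. specialize (H3 x Hx).
    replace (c x * y (jump T x)) with (delta_deriv T y1 x); [exact D |].
    unfold c. replace (delta_deriv T y1 x) with
      (q x * y (jump T x) - (- delta_deriv T y1 x + q x * y (jump T x))) by ring.
    rewrite H3. ring. }
  assert (G1 : forall k, (1 <= k < N)%nat ->
     y (a (S k)) = y (b k) + y1 (b k) * RtoC (a (S k) - b k) /\ wcont (a k) (b k) y (b k)).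
  { intros k Hk. apply delta_gap; [exact Hk |]. apply D1, (interval_in k); [lia |].
    pose proof (Hab k ltac:(lia)); lra. }
  assert (G2 : forall k, (1 <= k < N)%nat ->
     y1 (a (S k)) = y1 (b k) + c (b k) * y (a (S k)) * RtoC (a (S k) - b k) /\ wcont (a k) (b k) y1 (b k)).
  { intros k Hk. rewrite <- (jump_gap k Hk) at 2. apply delta_gap; [exact Hk |].
    apply D2, (interval_in k); [lia |]. pose proof (Hab k ltac:(lia)); lra. }
  split; [| intros k Hk; split; [apply G1 | apply G2]; exact Hk].
  intros k Hk.
  assert (I : forall x, (a k <= x <= b k)%R -> jump T x = x ->
     wderiv (a k) (b k) y x (y1 x) /\ wderiv (a k) (b k) y1 x (c x * y x)).
  { intros x Hx Hj. pose proof (interval_in k x Hk Hx) as Tx. split.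
    - apply (delta_wderiv k); try assumption. apply D1, Tx.
    - apply (delta_wderiv k); try assumption. specialize (D2 x Tx). rewrite Hj in D2. exact D2. }
  intros x Hx. destruct (jump_cases k x Hk Hx) as [Hj | [HkN [-> _]]]; [apply I; assumption |].
  assert (Hkk : (1 <= k < N)%nat) by lia.
  assert (I' : forall x, (a k <= x < b k)%R ->
     wderiv (a k) (b k) y x (y1 x) /\ wderiv (a k) (b k) y1 x (c x * y x)).
  { intros t Ht. apply I; [lra | apply (jump_inside k); assumption]. }
  pose proof (Hab k Hk) as Hl.
  split.
  - apply wderiv_right_end; [exact Hl | intros t Ht; apply I', Ht | apply G1, Hkk | apply G2, Hkk].
  - apply (wderiv_right_end (a k) (b k) y1 (fun x => c x * y x)); [exact Hl | intros t Ht; apply I', Ht | apply G2, Hkk |].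
    apply wcont_mult; [apply coefficient_wcont; [exact Hk | lra] | apply G1, Hkk].
Qed.

Lemma piecewise_solution (Y Y1 : R -> C) : piecewise_sol 1 N a b c Y Y1 ->
  is_solution T q lam Y /\ forall x, T x -> delta_deriv T Y x = Y1 x.
Proof.
  intros [H1 H2].
  assert (D1 : forall x, T x -> is_delta_deriv T Y x (Y1 x)).
  { intros x [k [Hk Hx]]. destruct (jump_cases k x Hk Hx) as [Hj | [HkN [-> _]]].
    - apply (delta_wderiv k); try assumption. apply (H1 k Hk x Hx).
    - apply delta_gap; [lia |]. split; [apply (H2 k ltac:(lia)) |].
      eapply wderiv_wcont, (H1 k Hk). exact Hx. }
  assert (E : forall x, T x -> delta_deriv T Y x = Y1 x).
  { intros x Hx. apply delta_deriv_eq; auto. }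
  assert (D2 : forall x, T x -> is_delta_deriv T (delta_deriv T Y) x (c x * Y (jump T x))).
  { intros x Tx. apply (is_delta_deriv_ext Y1); [exact Tx | intros; symmetry; auto |].
    destruct Tx as [k [Hk Hx]]. destruct (jump_cases k x Hk Hx) as [Hj | [HkN [-> Hj]]].
    - rewrite Hj. apply (delta_wderiv k); try assumption. apply (H1 k Hk x Hx).
    - rewrite Hj. apply delta_gap; [lia |]. split; [apply (H2 k ltac:(lia)) |].
      eapply wderiv_wcont, (H1 k Hk). exact Hx. }
  split; [| exact E]. split; [| split].
  - intros x Hx. exists (Y1 x). auto.
  - intros x Hx. exists (c x * Y (jump T x)). auto.
  - intros x Hx. rewrite (delta_deriv_eq _ _ _ Hx (D2 x Hx)). unfold c. ring.
Qed.

Lemma piecewise_exists (u v : C) : exists Y Y1,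
  piecewise_sol 1 N a b c Y Y1 /\ Y (a 1%nat) = u /\ Y1 (a 1%nat) = v.
Proof.
  assert (Hint : forall k, (1 <= k <= N)%nat -> forall u v, exists Y Y1 : R -> C,
    Y (a k) = u /\ Y1 (a k) = v /\ forall x, (a k <= x <= b k)%R ->
     wderiv (a k) (b k) Y x (Y1 x) /\ wderiv (a k) (b k) Y1 x (c x * Y x)).
  { intros k Hk u' v'. pose proof (Hab k Hk) as Hl.
    destruct (clamp_extension T q (a k) (b k) ltac:(lra) Hq) as [qc [Hc1 Hc2]].
    { intros x Hx. apply (interval_in k); assumption. }
    destruct (ode_exists (fun x => qc x - lam) (a k) (b k - a k + 1) u' v') as [Y [Y1 [E1 [E2 D]]]].
    { lra. }
    { intros x eps Heps. destruct (Hc1 x eps Heps) as [d [Hd K]]. exists d; split; [exact Hd |].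
      intros z Hz. replace (qc z - lam - (qc x - lam)) with (qc z - qc x) by ring. apply K, Hz. }
    exists Y, Y1. split; [exact E1 | split; [exact E2 |]].
    intros x Hx. destruct (D x) as [D1 D2]; [rewrite Rabs_pos_eq; lra |].
    split; apply cderiv_wderiv; [exact D1 |]. unfold c. rewrite <- (Hc2 x Hx). exact D2. }
  assert (Hn : forall n, (1 <= n <= N)%nat -> exists Y Y1,
     piecewise_sol 1 n a b c Y Y1 /\ Y (a 1%nat) = u /\ Y1 (a 1%nat) = v).
  { induction n as [| n IH]; [lia |]. intro Hn.
    destruct (Nat.eq_dec n 0) as [-> | n0].
    - destruct (Hint 1%nat ltac:(lia) u v) as [Y [Y1 [E1 [E2 D]]]].
      exists Y, Y1. split; [| split; assumption]. split; [| intros k Hk; lia].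
      intros k Hk. replace k with 1%nat by lia. exact D.
    - destruct (IH ltac:(lia)) as [Y [Y1 [[P1 P2] [E1 E2]]]].
      set (u' := Y (b n) + Y1 (b n) * RtoC (a (S n) - b n)).
      set (v' := Y1 (b n) + c (b n) * u' * RtoC (a (S n) - b n)).
      destruct (Hint (S n) ltac:(lia) u' v') as [Z [Z1 [F1 [F2 D]]]].
      (* The old solution up to [b n], the new one beyond; [piecewise_sol] does not look inside the
         gap. *)
      set (W := fun x => if Rle_dec x (b n) then Y x else Z x).
      set (W1 := fun x => if Rle_dec x (b n) then Y1 x else Z1 x).
      assert (Old : forall x, (x <= b n)%R -> W x = Y x /\ W1 x = Y1 x).
      { intros x Hx. unfold W, W1. destruct (Rle_dec x (b n)); [split; reflexivity | contradiction]. }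
      assert (Hg := Hgap n ltac:(lia)).
      assert (New : forall x, (a (S n) <= x)%R -> W x = Z x /\ W1 x = Z1 x).
      { intros x Hx. unfold W, W1. destruct (Rle_dec x (b n)); [lra | split; reflexivity]. }
      assert (Bk : forall k, (1 <= k <= n)%nat -> (b k <= b n)%R).
      { intros k Hk. destruct (Nat.eq_dec k n) as [-> | n1]; [lra |].
        pose proof (intervals_ordered k n ltac:(lia) ltac:(lia)). pose proof (Hab n ltac:(lia)). lra. }
      exists W, W1. split; [split |].
      + intros k Hk x Hx. destruct (Nat.eq_dec k (S n)) as [-> | n1].
        * destruct (D x Hx) as [D1 D2]. destruct (New x ltac:(lra)) as [-> ->].
          split; [apply (wderiv_ext _ _ Z) | apply (wderiv_ext _ _ Z1)]; try assumption;
            intros t Ht; symmetry; apply New; lra.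
        * pose proof (Bk k ltac:(lia)). destruct (P1 k ltac:(lia) x Hx) as [D1 D2].
          destruct (Old x ltac:(lra)) as [-> ->].
          split; [apply (wderiv_ext _ _ Y) | apply (wderiv_ext _ _ Y1)]; try assumption;
            intros t Ht; symmetry; apply Old; lra.
      + intros k Hk. destruct (Nat.eq_dec k n) as [-> | n1].
        * destruct (Old (b n) ltac:(lra)) as [-> ->]. destruct (New (a (S n)) ltac:(lra)) as [-> ->].
          rewrite F1, F2. split; reflexivity.
        * pose proof (Bk k ltac:(lia)). pose proof (Bk (S k) ltac:(lia)). pose proof (Hab (S k) ltac:(lia)).
          destruct (Old (b k) ltac:(lra)) as [-> ->]. destruct (Old (a (S k)) ltac:(lra)) as [-> ->].
          apply P2; lia.
      + pose proof (Bk 1%nat ltac:(lia)). pose proof (Hab 1%nat ltac:(lia)).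
        destruct (Old (a 1%nat) ltac:(lra)) as [-> ->]. split; assumption. }
  apply Hn. lia.
Qed.
End Equation.
End TimeScale.

(** * Propagation across the gaps *)

Lemma cderiv_zero_const (f : R -> C) (a b : R) : (a <= b)%R ->
  (forall x, (a <= x <= b)%R -> cderiv f x 0) -> f b = f a.
Proof.
  intros Hab H.
  assert (I : (Cmod (f b - f a) <= 0 - 0)%R).
  { apply (mean_value_ineq f (fun _ => 0) (fun _ => 0%R) (fun _ => 0%R)); [exact Hab | exact H | |].
    - intros. apply (is_derive_const (K:=R_AbsRing) (V:=R_NormedModule)).
    - intros. rewrite Cmod_0. lra. }
  assert (E : f b - f a = 0).
  { apply Cmod_eq_0, Rle_antisym; [lra | apply Cmod_ge_0]. }
  replace (f b) with (f b - f a + f a) by ring. rewrite E. ring.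
Qed.

Lemma ccont_zero_closure (f : R -> C) (a b : R) : (a < b)%R -> (forall x, ccont f x) ->
  (forall x, (a < x < b)%R -> f x = 0) -> forall x, (a <= x <= b)%R -> f x = 0.
Proof.
  intros Hab Hc H x Hx. apply Cmod_eq_0, Rle_antisym; [| apply Cmod_ge_0].
  apply le_epsilon. intros eps Heps. rewrite Rplus_0_l.
  destruct (Hc x eps Heps) as [d [Hd K]].
  assert (Hy : exists y, (a < y < b)%R /\ (Rabs (y - x) < d)%R).
  { set (m := (Rmin d (b - a) / 4)%R).
    assert (Hm : (0 < m < d /\ m < (b - a) / 2)%R).
    { unfold m. pose proof (Rmin_l d (b - a)). pose proof (Rmin_r d (b - a)).
      assert (0 < Rmin d (b - a))%R by (apply Rmin_pos; lra). lra. }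
    destruct (Rle_lt_dec x ((a + b) / 2)) as [h | h].
    - exists (x + m)%R. split; [lra | apply Rabs_def1; lra].
    - exists (x - m)%R. split; [lra | apply Rabs_def1; lra]. }
  destruct Hy as [y [Hy1 Hy2]]. specialize (K y Hy2). rewrite (H y Hy1) in K.
  replace (0 - f x) with (- f x) in K by ring. rewrite Cmod_opp in K. lra.
Qed.

(** * Wronskians with Jost solutions and uniqueness on one interval *)

Lemma jost_exists (a b k : R) (q : R -> C) : (a < b)%R -> (forall x, ccont q x) ->
  exists P : (R -> C) * (R -> C), jost a b k q (fst P) (snd P).
Proof.
  intros Hab Hq.
  destruct (ode_exists (fun x => q x + RtoC (k ^ 2)) b (b - a + 1) 1 (- RtoC k)) as [Y [Y1 [E1 [E2 D]]]].
  { lra. }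
  { intros x eps Heps. destruct (Hq x eps Heps) as [d [Hd K]]. exists d; split; [exact Hd |].
    intros z Hz. replace (q z + RtoC (k ^ 2) - (q x + RtoC (k ^ 2))) with (q z - q x) by ring. apply K, Hz. }
  exists (fun x => RtoC (exp (k * (x - b))) * Y x, fun x => RtoC (exp (k * (x - b))) * (Y1 x + RtoC k * Y x)).
  simpl. split; [| split].
  - intros x Hx. destruct (D x) as [D1 D2]; [apply Rabs_def1; lra |].
    pose proof (cderiv_RtoC _ _ _ (is_derive_exp_affine k b x)) as De.
    split.
    + eapply cderiv_eq; [apply cderiv_mult; [exact De | exact D1] |]. rewrite RtoC_mult. cbv beta. ring.
    + eapply cderiv_eq.
      * apply cderiv_mult; [exact De |]. apply cderiv_plus; [exact D2 | apply cderiv_scal, D1].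
      * rewrite 2 RtoC_mult, RtoC_pow. cbv beta. ring.
  - replace (b - b)%R with 0%R by ring. rewrite Rmult_0_r, exp_0, E1. ring.
  - replace (b - b)%R with 0%R by ring. rewrite Rmult_0_r, exp_0, E1, E2. ring.
Qed.

(* The Wronskian of a solution and the Jost solution [exp (- k (x - b)) p] is
   constant. *)
Lemma jost_wronskian (a b k : R) (q p p1 Y Y1 : R -> C) : (a <= b)%R ->
  jost a b k q p p1 -> ode a b (fun x => q x + RtoC (k ^ 2)) Y Y1 ->
  Y a * (p1 a - RtoC k * p a) - Y1 a * p a
  = - (RtoC (exp (- k * (b - a))) * (Y1 b + RtoC k * Y b)).
Proof.
  intros Hab [Hp [E1 E2]] HY.
  (* The Wronskian up to a constant: the exponential is normalized to 1 at [a], and so equals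
     [exp (- k * (b - a))] at [b]. *)
  set (V := fun x => RtoC (exp (- k * (x - a))) * (Y x * (p1 x - RtoC k * p x) - Y1 x * p x)).
  assert (EV : V b = V a).
  { apply cderiv_zero_const; [exact Hab |]. intros x Hx.
    destruct (Hp x Hx) as [D0 D1]. destruct (HY x Hx) as [F0 F1].
    pose proof (cderiv_RtoC _ _ _ (is_derive_exp_affine (- k) a x)) as De.
    eapply cderiv_eq.
    - apply cderiv_mult; [exact De |]. apply cderiv_minus; [apply cderiv_mult; [exact F0 |] | apply cderiv_mult; [exact F1 | exact D0]].
      apply cderiv_minus; [exact D1 | apply cderiv_scal, D0].
    - rewrite 2 RtoC_mult, RtoC_opp, RtoC_pow. cbv beta. ring. }
  assert (Va : V a = Y a * (p1 a - RtoC k * p a) - Y1 a * p a).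
  { unfold V. replace (a - a)%R with 0%R by ring. rewrite Rmult_0_r, exp_0. ring. }
  rewrite <- Va, <- EV. unfold V. rewrite E1, E2. ring.
Qed.

(** For [m = 0] the probe is evaluation at [k] times [2 * k], so [transmutation] at [r = 0] is a
    pointwise bound, uniform in [k]. *)
Lemma jost_bounded (a b Q k : R) (q : R -> C) (p p1 : R -> R -> C) : (a < b)%R -> (1 <= k)%R ->
  (forall x, (a <= x <= b)%R -> (Cmod (q x) <= Q)%R) ->
  (forall k', (k <= k')%R -> jost a b k' q (fun x => p x k') (fun x => p1 x k')) ->
  (Cmod (p a k) <= 1 + exp (jost_rate Q (b - a) * (b - a)))%R.
Proof.
  intros Hab Hk HQ Hp.
  assert (Hpr : forall F, probe k 0 F = RtoC (2 * k) * F k).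
  { intro F. unfold probe. simpl. now rewrite Rmult_1_r. }
  assert (T : (Cmod (probe k 0 (fun k => damp k 0 * (1 * (p a k - 1)))%C)
     <= (1 + (b - a) * 0) * exp (jost_rate Q (b - a) * (b - a)) * bump_tail k 0 0)%R).
  { apply (transmutation a b Q k 0 0 q (fun _ => 1) p p1); try assumption; try lra.
    intros r Hr. rewrite Rmult_0_l, Rplus_0_r.
    rewrite (probe_ext k 0 ltac:(lra) _ (fun k => RtoC (exp (- (2 * k * r))))).
    - rewrite probe_exp by lra. rewrite Cmod_R, Rabs_pos_eq; [lra |]. apply bump_nonneg; lra.
    - intros; unfold damp; ring. }
  rewrite Hpr, damp_0, Cmod_mult, Cmod_R, Rabs_pos_eq in T by lra.
  replace (1 * (1 * (p a k - 1))) with (p a k - 1) in T by ring.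
  pose proof (bump_tail_bounds k 0 ltac:(lra) 0 ltac:(lra)).
  pose proof (exp_pos (jost_rate Q (b - a) * (b - a))). pose proof (Cmod_ge_0 (p a k - 1)).
  pose proof (Cmod_triangle (p a k - 1) 1) as X. replace (p a k - 1 + 1) with (p a k) in X by ring.
  rewrite Cmod_1 in X. nra.
Qed.

(** Proportional data at [a] allow the Wronskian of the two Jost solutions to be expressed through
    the Wronskian of each solution with its own Jost solution, and these are small. *)
Lemma wronskian_reduction (Y Y1 Z Z1 p p1 pt pt1 k : C) : Y * Z1 = Y1 * Z ->
  Y * Z * (p1 * pt - p * pt1)
  = Z * pt * (Y * (p1 - k * p) - Y1 * p) - Y * p * (Z * (pt1 - k * pt) - Z1 * pt).
Proof.
  intro E. transitivity (Y * Z * (p1 * pt - p * pt1) + p * pt * (Y * Z1 - Y1 * Z)).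
  - rewrite E. ring.
  - ring.
Qed.

(** Each Wronskian in [wronskian_reduction] carries [exp (- k l)] twice, from [jost_wronskian] and
    from the assumed smallness at [b]; this is the rate asked for by [Hsmall]. The end points follow
    by continuity. *)
Lemma interval_uniqueness (a b Q k0 : R) (q qt : R -> C) : (a < b)%R -> (1 <= k0)%R ->
  (forall x, ccont q x) -> (forall x, ccont qt x) ->
  (forall x, (a <= x <= b)%R -> (Cmod (q x) <= Q)%R) ->
  (forall x, (a <= x <= b)%R -> (Cmod (qt x) <= Q)%R) ->
  (forall k, (k0 <= k)%R -> exists Y Y1 Z Z1 : R -> C,
     ode a b (fun x => q x + RtoC (k ^ 2)) Y Y1 /\ ode a b (fun x => qt x + RtoC (k ^ 2)) Z Z1 /\
     Y a <> 0 /\ Z a <> 0 /\ Y a * Z1 a = Y1 a * Z a /\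
     (Cmod (Y1 b + RtoC k * Y b) <= 8 * k * exp (- k * (b - a)) * Cmod (Y a))%R /\
     (Cmod (Z1 b + RtoC k * Z b) <= 8 * k * exp (- k * (b - a)) * Cmod (Z a))%R) ->
  forall x, (a <= x <= b)%R -> q x = qt x.
Proof.
  intros Hab Hk0 Hq Hqt HQ HQt Hyp.
  assert (Hc : forall x, ccont (fun x => q x - qt x) x).
  { intros x eps Heps. destruct (Hq x (eps / 2)%R ltac:(lra)) as [d1 [Hd1 K1]].
    destruct (Hqt x (eps / 2)%R ltac:(lra)) as [d2 [Hd2 K2]].
    exists (Rmin d1 d2). split; [apply Rmin_pos; assumption |]. intros y Hy.
    pose proof (Rmin_l d1 d2). pose proof (Rmin_r d1 d2).
    replace (q y - qt y - (q x - qt x)) with ((q y - q x) + - (qt y - qt x)) by ring.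
    eapply Rle_lt_trans; [apply Cmod_triangle |]. rewrite Cmod_opp.
    specialize (K1 y ltac:(lra)). specialize (K2 y ltac:(lra)). lra. }
  assert (Hin : forall x, (a < x < b)%R -> q x - qt x = 0).
  { destruct (choice _ (fun k => jost_exists a b k q Hab Hq)) as [P HP].
    destruct (choice _ (fun k => jost_exists a b k qt Hab Hqt)) as [Pt HPt].
    destruct (antiderivative (fun x => Cmod (q x - qt x)) (fun x => ccont_Cmod _ x (Hc x))) as [G HG].
    set (E1 := exp (jost_rate Q (b - a) * (b - a))). assert (HE1 : (0 < E1)%R) by apply exp_pos.
    intros x Hx.
    (* [16 = 2 * 8]: two Wronskians, each with the constant 8 of the decay estimate, times the bound
       [1 + E1] on a Jost factor. *)
    rewrite (core_uniqueness a b Q k0 q qt Hab Hk0 HQ HQt Hc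
      (fun x k => fst (P k) x) (fun x k => snd (P k) x)
      (fun x k => fst (Pt k) x) (fun x k => snd (Pt k) x)
      (fun k _ => HP k) (fun k _ => HPt k) (16 * (1 + E1)) ltac:(lra)) with (G := G) (t := x);
      [ring | | exact HG | exact Hx].
    intros k Hk.
    pose proof (jost_bounded a b Q k q (fun x k => fst (P k) x) (fun x k => snd (P k) x)
      Hab ltac:(lra) HQ (fun k _ => HP k)) as B.
    pose proof (jost_bounded a b Q k qt (fun x k => fst (Pt k) x) (fun x k => snd (Pt k) x)
      Hab ltac:(lra) HQt (fun k _ => HPt k)) as Bt.
    cbv beta in B, Bt. fold E1 in B, Bt.
    destruct (Hyp k Hk) as [Y [Y1 [Z [Z1 [OY [OZ [NY [NZ [W [DY DZ]]]]]]]]]].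
    pose proof (jost_wronskian a b k q _ _ Y Y1 ltac:(lra) (HP k) OY) as WY.
    pose proof (jost_wronskian a b k qt _ _ Z Z1 ltac:(lra) (HPt k) OZ) as WZ.
    pose proof (wronskian_reduction (Y a) (Y1 a) (Z a) (Z1 a) (fst (P k) a) (snd (P k) a)
      (fst (Pt k) a) (snd (Pt k) a) (RtoC k) W) as R.
    rewrite WY, WZ in R. apply (f_equal Cmod) in R. rewrite 2 Cmod_mult in R.
    assert (HY : (0 < Cmod (Y a))%R) by (apply Cmod_gt_0, NY).
    assert (HZ : (0 < Cmod (Z a))%R) by (apply Cmod_gt_0, NZ).
    set (e := exp (- k * (b - a))) in *. assert (He : (0 < e)%R) by apply exp_pos.
    replace (exp (- (2 * k * (b - a)))) with (e * e)%R
      by (unfold e; rewrite <- exp_plus; f_equal; ring).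
    apply Rmult_le_reg_l with (Cmod (Y a) * Cmod (Z a))%R; [nra |].
    rewrite R. eapply Rle_trans; [apply Cmod_triangle |].
    rewrite !Cmod_mult, !Cmod_opp, !Cmod_mult, !Cmod_opp, !Cmod_mult, (Cmod_R e), (Rabs_pos_eq e) by lra.
    set (y := Cmod (Y a)) in *. set (z := Cmod (Z a)) in *.
    set (P0 := Cmod (fst (P k) a)) in *. set (Pt0 := Cmod (fst (Pt k) a)) in *.
    set (dy := Cmod (Y1 b + RtoC k * Y b)) in *. set (dz := Cmod (Z1 b + RtoC k * Z b)) in *.
    assert (HP0 : (0 <= P0)%R) by apply Cmod_ge_0. assert (HPt0 : (0 <= Pt0)%R) by apply Cmod_ge_0.
    assert (Hdy : (0 <= dy)%R) by apply Cmod_ge_0. assert (Hdz : (0 <= dz)%R) by apply Cmod_ge_0.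
    assert (S1 : (z * Pt0 * (e * dy) <= z * (1 + E1) * (e * (8 * k * e * y)))%R).
    { apply Rmult_le_compat; [nra | nra | apply Rmult_le_compat_l; lra | apply Rmult_le_compat_l; lra]. }
    assert (S2 : (y * P0 * (e * dz) <= y * (1 + E1) * (e * (8 * k * e * z)))%R).
    { apply Rmult_le_compat; [nra | nra | apply Rmult_le_compat_l; lra | apply Rmult_le_compat_l; lra]. }
    lra. }
  intros x Hx. pose proof (ccont_zero_closure _ a b Hab Hc Hin x Hx) as E. cbv beta in E.
  replace (q x) with (q x - qt x + qt x) by ring. rewrite E. ring.
Qed.

(** The discrete counterpart of [energy_incr]: across the gap the energy grows by
    [h (Re c |A| ^ 2 + |Y1| ^ 2)]. *)
Lemma gap_energy (A A1 Y Y1 c : C) (h : R) : (0 < h)%R -> (0 <= Re c)%R ->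
  A = Y + Y1 * RtoC h -> A1 = Y1 + c * A * RtoC h ->
  (Re (A1 * Cconj A) <= 0)%R -> (Re (Y1 * Cconj Y) <= 0)%R.
Proof.
  intros Hh Hc E E1 H.
  assert (EY : Y = A - Y1 * RtoC h) by (rewrite E; ring).
  assert (I : (Re (Y1 * Cconj Y) = Re (A1 * Cconj A) - h * (Re c * (Re A ^ 2 + Im A ^ 2))
               - h * (Re Y1 ^ 2 + Im Y1 ^ 2))%R).
  { rewrite EY, E1. destruct A as [u v], Y1 as [s t], c as [c1 c2]. simpl. ring. }
  rewrite I.
  assert (0 <= Re A ^ 2 + Im A ^ 2)%R by nra. assert (0 <= Re Y1 ^ 2 + Im Y1 ^ 2)%R by nra.
  assert (0 <= Re c * (Re A ^ 2 + Im A ^ 2))%R by nra.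
  assert (0 <= h * (Re c * (Re A ^ 2 + Im A ^ 2)))%R by nra.
  assert (0 <= h * (Re Y1 ^ 2 + Im Y1 ^ 2))%R by nra. lra.
Qed.

Lemma wderiv_lin (a b : R) (f g : R -> C) (x : R) (d e m : C) :
  wderiv a b f x d -> wderiv a b g x e -> wderiv a b (fun t => f t + m * g t) x (d + m * e).
Proof.
  intros Hf Hg eps Heps. pose proof (Cmod_ge_0 m) as Hm.
  destruct (Hf (eps / 2)%R ltac:(lra)) as [d1 [Hd1 K1]].
  destruct (Hg (eps / (2 * (Cmod m + 1)))%R ltac:(apply Rdiv_lt_0_compat; lra)) as [d2 [Hd2 K2]].
  exists (Rmin d1 d2). split; [apply Rmin_pos; assumption |]. intros s Hs Hs'.
  pose proof (Rmin_l d1 d2). pose proof (Rmin_r d1 d2).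
  specialize (K1 s Hs ltac:(lra)). specialize (K2 s Hs ltac:(lra)).
  replace (f x + m * g x - (f s + m * g s) - (d + m * e) * RtoC (x - s)) with
    ((f x - f s - d * RtoC (x - s)) + m * (g x - g s - e * RtoC (x - s))) by ring.
  eapply Rle_trans; [apply Cmod_triangle |]. rewrite Cmod_mult.
  set (h := Rabs (x - s)) in *. assert (Hh : (0 <= h)%R) by apply Rabs_pos.
  assert (Cmod m * Cmod (g x - g s - e * RtoC (x - s)) <= eps / 2 * h)%R; [| lra].
  apply Rle_trans with ((Cmod m + 1) * (eps / (2 * (Cmod m + 1)) * h))%R.
  - apply Rmult_le_compat; [exact Hm | apply Cmod_ge_0 | lra | exact K2].
  - right; field; lra.
Qed.

Lemma piecewise_lin (j N : nat) (a b : nat -> R) (c Y Y1 Z Z1 : R -> C) (m : C) :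
  piecewise_sol j N a b c Y Y1 -> piecewise_sol j N a b c Z Z1 ->
  piecewise_sol j N a b c (fun x => Y x + m * Z x) (fun x => Y1 x + m * Z1 x).
Proof.
  intros [HY JY] [HZ JZ]. split.
  - intros k Hk x Hx. destruct (HY k Hk x Hx) as [A B]. destruct (HZ k Hk x Hx) as [A' B'].
    split; [apply wderiv_lin; assumption |].
    replace (c x * (Y x + m * Z x)) with (c x * Y x + m * (c x * Z x)) by ring.
    apply wderiv_lin; assumption.
  - intros k Hk. destruct (JY k Hk) as [A B]. destruct (JZ k Hk) as [A' B'].
    split.
    + rewrite A, A'. ring.
    + rewrite B, B'. ring.
Qed.

(** * Induction along the intervals *)

Section Assembly.
Variables (N : nat) (a b : nat -> R).
Hypothesis HN : (1 <= N)%nat.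
Hypothesis Hab : forall k, (1 <= k <= N)%nat -> (a k < b k)%R.
Hypothesis Hgap : forall k, (1 <= k < N)%nat -> (b k < a (S k))%R.
Let T := intervals N a b.

Lemma bounded_on_T (q : R -> C) : continuous_on T q ->
  exists Q, forall x, T x -> (Cmod (q x) <= Q)%R.
Proof.
  intro Hq.
  assert (H : forall n, (n <= N)%nat -> exists Q, forall k x, (1 <= k <= n)%nat -> (a k <= x <= b k)%R -> (Cmod (q x) <= Q)%R).
  { induction n as [| n IH]; intro Hn; [exists 0%R; intros; lia |].
    destruct (IH ltac:(lia)) as [Q0 H0]. pose proof (Hab (S n) ltac:(lia)).
    destruct (clamp_extension T q (a (S n)) (b (S n)) ltac:(lra) Hq) as [qc [Hc1 Hc2]].
    { intros x Hx. exists (S n). split; [lia | exact Hx]. }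
    destruct (continuity_ab_maj (fun x => Cmod (qc x)) (a (S n)) (b (S n)) ltac:(lra)) as [xm [Hm _]].
    { intros x _. apply ccont_Cmod, Hc1. }
    exists (Rmax Q0 (Cmod (qc xm))). intros k x Hk Hx.
    destruct (Nat.eq_dec k (S n)) as [-> | n0].
    - rewrite <- (Hc2 x Hx). eapply Rle_trans; [apply Hm, Hx | apply Rmax_r].
    - eapply Rle_trans; [apply (H0 k x); [lia | exact Hx] | apply Rmax_l]. }
  destruct (H N (le_n N)) as [Q HQ]. exists Q. intros x [k [Hk Hx]]. apply (HQ k); assumption.
Qed.

Section Decaying.
Variables (q : R -> C) (Q k : R).
Hypothesis HQ : forall x, T x -> (Cmod (q x) <= Q)%R.
Hypothesis Hk : (0 < k)%R.
Hypothesis HkQ : (4 * Q <= k ^ 2)%R.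
Variables (j : nat) (Y Y1 : R -> C).
Hypothesis Hj : (1 <= j)%nat.
Hypothesis HY : piecewise_sol j N a b (fun x => q x - RtoC (- k ^ 2)) Y Y1.
Hypothesis Hend : Y (b N) = 0.

Lemma piecewise_ode (i : nat) : (j <= i <= N)%nat ->
  exists F F1, (forall x, (a i <= x <= b i)%R -> F x = Y x /\ F1 x = Y1 x) /\
    ode (a i) (b i) (fun x => q x + RtoC (k ^ 2)) F F1.
Proof.
  intro Hi. destruct HY as [H _].
  destruct (wderiv_ode (a i) (b i) (fun x => q x - RtoC (- k ^ 2)) Y Y1 (Hab i ltac:(lia)) (H i Hi))
    as [F [F1 [E D]]].
  exists F, F1. split; [exact E |]. intros x Hx. destruct (D x Hx) as [D1 D2]. split; [exact D1 |].
  eapply cderiv_eq; [exact D2 |]. rewrite RtoC_opp. ring.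
Qed.

Lemma interval_Q (i : nat) : (j <= i <= N)%nat -> forall x, (a i <= x <= b i)%R -> (Cmod (q x) <= Q)%R.
Proof. intros Hi x Hx. apply HQ. exists i. split; [lia | exact Hx]. Qed.

(** Induction from the right: the energy vanishes at [b N], and neither an interval nor a gap lets
    it increase on the way to the left. *)
Lemma energy_nonpos (r : nat) : (j <= r <= N)%nat -> (Re (Y1 (b r) * Cconj (Y (b r))) <= 0)%R.
Proof.
  assert (H : forall n, (n <= N - j)%nat -> (j <= N)%nat ->
     (Re (Y1 (b (N - n)%nat) * Cconj (Y (b (N - n)%nat))) <= 0)%R).
  { induction n as [| n IH]; intros Hn HjN.
    - rewrite Nat.sub_0_r, Hend. simpl. right. ring.
    - specialize (IH ltac:(lia) HjN).
      set (i := (N - S n)%nat) in *. replace (N - n)%nat with (S i) in IH by lia.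
      assert (Hi : (j <= i < N)%nat) by lia.
      destruct (piecewise_ode (S i) ltac:(lia)) as [F [F1 [E D]]].
      pose proof (Hab (S i) ltac:(lia)) as Hl.
      destruct (E (b (S i)) ltac:(lra)) as [Eb Eb1]. destruct (E (a (S i)) ltac:(lra)) as [Ea Ea1].
      pose proof (energy_incr (a (S i)) (b (S i)) Q k q F F1 (interval_Q (S i) ltac:(lia)) D HkQ
        (a (S i)) ltac:(lra)) as En.
      rewrite Ea, Ea1, Eb, Eb1 in En.
      destruct HY as [_ HJ]. destruct (HJ i Hi) as [J1 J2].
      pose proof (Hgap i ltac:(lia)) as Hg. pose proof (Hab i ltac:(lia)) as Hli.
      apply (gap_energy (Y (a (S i))) (Y1 (a (S i))) (Y (b i)) (Y1 (b i)) (q (b i) - RtoC (- k ^ 2)) (a (S i) - b i)%R);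
        [lra | | exact J1 | exact J2 | lra].
      pose proof (interval_Q i ltac:(lia) (b i) ltac:(lra)) as Hq.
      pose proof (re_le_Cmod (q (b i))) as Hre. pose proof (Rle_abs (- Re (q (b i)))) as Habs.
      rewrite Rabs_Ropp in Habs. unfold Re in *. simpl in *. nra. }
  intro Hr. specialize (H (N - r)%nat ltac:(lia) ltac:(lia)).
  replace (N - (N - r))%nat with r in H by lia. exact H.
Qed.

Variable i : nat.
Hypothesis Hi : (j <= i <= N)%nat.
Hypothesis Hlen : (2 * Q * (b i - a i) <= k)%R.
Hypothesis Hlen2 : (4 <= k * (b i - a i))%R.
Hypothesis Hnz : Y (a i) <> 0 \/ Y1 (a i) <> 0.

Lemma piecewise_decay :
  (exists F F1, (forall x, (a i <= x <= b i)%R -> F x = Y x /\ F1 x = Y1 x) /\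
     ode (a i) (b i) (fun x => q x + RtoC (k ^ 2)) F F1) /\
  Y (a i) <> 0 /\ Y1 (a i) <> 0 /\ (Y (b i) <> 0 \/ Y1 (b i) <> 0) /\
  (Cmod (Y1 (b i) + RtoC k * Y (b i)) <= 8 * k * exp (- k * (b i - a i)) * Cmod (Y (a i)))%R.
Proof.
  destruct (piecewise_ode i Hi) as [F [F1 [E D]]].
  pose proof (Hab i ltac:(lia)) as Hl.
  destruct (E (b i) ltac:(lra)) as [Eb Eb1]. destruct (E (a i) ltac:(lra)) as [Ea Ea1].
  pose proof (energy_nonpos i Hi) as En. rewrite <- Eb, <- Eb1 in En.
  rewrite <- Ea, <- Ea1 in Hnz.
  split; [exists F, F1; split; assumption |].
  rewrite <- Ea, <- Ea1, <- Eb, <- Eb1.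
  pose proof (decay_nonzero _ _ Q k q F F1 Hl (interval_Q i Hi) D Hk HkQ En Hlen Hlen2 Hnz) as [X1 X2].
  split; [exact X1 | split; [exact X2 | split]].
  - apply (decay_nonzero_end _ _ Q k q F F1 Hl (interval_Q i Hi) D Hk HkQ En Hlen Hlen2 Hnz).
  - apply (growing_small_end _ _ Q k q F F1 Hl (interval_Q i Hi) D Hk HkQ En Hlen Hlen2).
Qed.
End Decaying.

Variables (q qt : R -> C).
Hypothesis Hq : continuous_on T q.
Hypothesis Hqt : continuous_on T qt.

(** The induction invariant: the Weyl functions of the problems restricted to the intervals from [j]
    on agree for large [k]. The cross product avoids division, and [k0] may grow with [j]. *)
Definition proportional_solutions (j : nat) : Prop :=
  exists k0 : R, forall k : R, (k0 <= k)%R -> exists Y Y1 Z Z1 : R -> C,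
    piecewise_sol j N a b (fun x => q x - RtoC (- k ^ 2)) Y Y1 /\
    piecewise_sol j N a b (fun x => qt x - RtoC (- k ^ 2)) Z Z1 /\
    Y (b N) = 0 /\ Z (b N) = 0 /\
    (Y (a j) <> 0 \/ Y1 (a j) <> 0) /\ (Z (a j) <> 0 \/ Z1 (a j) <> 0) /\
    Y (a j) * Z1 (a j) = Y1 (a j) * Z (a j).

(** A sum of nonnegative terms in place of a maximum: each term secures one conclusion of
    [threshold_spec]. *)
Definition threshold (Q l k0 : R) : R := (1 + 4 * Q + 2 * Q * l + 4 / l + Rabs k0)%R.

Lemma threshold_spec (Q l k0 k : R) : (0 <= Q)%R -> (0 < l)%R -> (threshold Q l k0 <= k)%R ->
  (1 <= k /\ 4 * Q <= k ^ 2 /\ 2 * Q * l <= k /\ 4 <= k * l /\ k0 <= k)%R.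
Proof.
  intros HQ Hl H. unfold threshold in H.
  pose proof (Rle_abs k0). pose proof (Rabs_pos k0).
  assert (0 < 4 / l)%R by (apply Rdiv_lt_0_compat; lra).
  assert (0 <= Q * l)%R by nra.
  assert (1 <= k)%R by lra. assert (4 * Q <= k)%R by lra.
  split; [lra |]. split; [nra |]. split; [lra |]. split; [| lra].
  assert (4 / l <= k)%R by lra.
  replace 4%R with (4 / l * l)%R by (field; lra). apply Rmult_le_compat_r; lra.
Qed.

Lemma common_bound : exists Q, (0 <= Q)%R /\
  (forall x, T x -> (Cmod (q x) <= Q)%R) /\ (forall x, T x -> (Cmod (qt x) <= Q)%R).
Proof.
  destruct (bounded_on_T q Hq) as [Q1 H1]. destruct (bounded_on_T qt Hqt) as [Q2 H2].
  exists (Rmax 0 (Rmax Q1 Q2)). split; [apply Rmax_l | split]; intros x Hx.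
  - eapply Rle_trans; [apply H1, Hx |]. eapply Rle_trans; [apply Rmax_l | apply Rmax_r].
  - eapply Rle_trans; [apply H2, Hx |]. eapply Rle_trans; [apply Rmax_r | apply Rmax_r].
Qed.

Lemma interval_step (j : nat) : (1 <= j <= N)%nat -> proportional_solutions j ->
  (forall x, (a j <= x <= b j)%R -> q x = qt x).
Proof.
  intros Hj [k0 Hyp]. destruct common_bound as [Q [HQ0 [HQ HQt]]].
  pose proof (Hab j Hj) as Hl.
  assert (HT : forall x, (a j <= x <= b j)%R -> T x) by (intros x Hx; exists j; split; assumption).
  destruct (clamp_extension T q (a j) (b j) ltac:(lra) Hq HT) as [qc [Hc1 Hc2]].
  destruct (clamp_extension T qt (a j) (b j) ltac:(lra) Hqt HT) as [qtc [Hct1 Hct2]].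
  set (k1 := threshold Q (b j - a j) k0).
  intros x Hx. rewrite <- (Hc2 x Hx), <- (Hct2 x Hx). revert x Hx.
  apply (interval_uniqueness (a j) (b j) Q k1); try assumption.
  - destruct (threshold_spec Q (b j - a j) k0 k1) as [H1 _]; unfold k1 in *; lra.
  - intros x Hx. rewrite (Hc2 x Hx). apply HQ, HT, Hx.
  - intros x Hx. rewrite (Hct2 x Hx). apply HQt, HT, Hx.
  - intros k Hk.
    destruct (threshold_spec Q (b j - a j) k0 k HQ0 ltac:(lra) Hk) as [K1 [K2 [K3 [K4 K5]]]].
    destruct (Hyp k K5) as [Y [Y1 [Z [Z1 [SY [SZ [EY [EZ [NY [NZ W]]]]]]]]]].
    destruct (piecewise_decay q Q k HQ ltac:(lra) K2 j Y Y1 ltac:(lia) SY EY j ltac:(lia) K3 K4 NY)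
      as [[F [F1 [EF OF]]] [F2 [_ [_ F3]]]].
    destruct (piecewise_decay qt Q k HQt ltac:(lra) K2 j Z Z1 ltac:(lia) SZ EZ j ltac:(lia) K3 K4 NZ)
      as [[G [G1 [EG OG]]] [G2 [_ [_ G3]]]].
    exists F, F1, G, G1.
    destruct (EF (b j) ltac:(lra)) as [-> ->]. destruct (EF (a j) ltac:(lra)) as [-> ->].
    destruct (EG (b j) ltac:(lra)) as [-> ->]. destruct (EG (a j) ltac:(lra)) as [-> ->].
    split; [intros x Hx; cbv beta; rewrite (Hc2 x Hx); apply OF, Hx |].
    split; [intros x Hx; cbv beta; rewrite (Hct2 x Hx); apply OG, Hx |].
    repeat split; assumption.
Qed.

(** Where the potentials agree, [Y * Z1 - Y1 * Z] is constant, hence zero at [b j]. The jump depends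
    on the potential only through its value at [b j], so both pairs undergo the same linear map. *)
Lemma gap_step (j : nat) : (1 <= j < N)%nat -> proportional_solutions j ->
  (forall x, (a j <= x <= b j)%R -> q x = qt x) -> proportional_solutions (S j).
Proof.
  intros Hj [k0 Hyp] Eq. destruct common_bound as [Q [HQ0 [HQ HQt]]].
  pose proof (Hab j ltac:(lia)) as Hl.
  exists (threshold Q (b j - a j) k0). intros k Hk.
  destruct (threshold_spec Q (b j - a j) k0 k HQ0 ltac:(lra) Hk) as [K1 [K2 [K3 [K4 K5]]]].
  destruct (Hyp k K5) as [Y [Y1 [Z [Z1 [SY [SZ [EY [EZ [NY [NZ W]]]]]]]]]].
  destruct (piecewise_decay q Q k HQ ltac:(lra) K2 j Y Y1 ltac:(lia) SY EY j ltac:(lia) K3 K4 NY)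
    as [[F [F1 [EF OF]]] [_ [_ [NYb _]]]].
  destruct (piecewise_decay qt Q k HQt ltac:(lra) K2 j Z Z1 ltac:(lia) SZ EZ j ltac:(lia) K3 K4 NZ)
    as [[G [G1 [EG OG]]] [_ [_ [NZb _]]]].
  assert (Wb : Y (b j) * Z1 (b j) - Y1 (b j) * Z (b j) = 0).
  { destruct (EF (b j) ltac:(lra)) as [<- <-]. destruct (EG (b j) ltac:(lra)) as [<- <-].
    rewrite (cderiv_zero_const (fun x => F x * G1 x - F1 x * G x) (a j) (b j) ltac:(lra)).
    - destruct (EF (a j) ltac:(lra)) as [-> ->]. destruct (EG (a j) ltac:(lra)) as [-> ->].
      rewrite W. ring.
    - intros x Hx. destruct (OF x Hx) as [D0 D1]. destruct (OG x Hx) as [D2 D3].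
      eapply cderiv_eq; [apply cderiv_minus; apply cderiv_mult; eassumption |].
      cbv beta. rewrite (Eq x Hx). ring. }
  destruct SY as [SY1 SY2]. destruct SZ as [SZ1 SZ2].
  destruct (SY2 j ltac:(lia)) as [JY JY1]. destruct (SZ2 j ltac:(lia)) as [JZ JZ1].
  exists Y, Y1, Z, Z1.
  split; [split; intros i Hi; [apply SY1 | apply SY2]; lia |].
  split; [split; intros i Hi; [apply SZ1 | apply SZ2]; lia |].
  split; [exact EY |]. split; [exact EZ |].
  (* The jump map is invertible, so a nonzero pair stays nonzero. *)
  assert (NZJ : forall U U1 A A1 c h : C, A = U + U1 * h -> A1 = U1 + c * A * h ->
     (U <> 0 \/ U1 <> 0) -> A <> 0 \/ A1 <> 0).
  { intros U U1 A A1 c h E1 E2 H.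
    destruct (excluded_middle_informative (A = 0)) as [A0 | A0]; [right | now left].
    intro A10. assert (U10 : U1 = 0).
    { rewrite A0, A10 in E2. replace U1 with (U1 + c * 0 * h) by ring. now rewrite <- E2. }
    assert (U0 : U = 0).
    { rewrite A0, U10 in E1. replace U with (U + 0 * h) by ring. now rewrite <- E1. }
    destruct H; contradiction. }
  split; [eapply NZJ; [exact JY | exact JY1 | exact NYb] |].
  split; [eapply NZJ; [exact JZ | exact JZ1 | exact NZb] |].
  rewrite JY1, JZ1. rewrite (Eq (b j) ltac:(lra)).
  assert (X : Y (a (S j)) * Z1 (b j) = Y1 (b j) * Z (a (S j))).
  { rewrite JY, JZ.
    transitivity ((Y (b j) * Z1 (b j) - Y1 (b j) * Z (b j))
      + Y1 (b j) * (Z (b j) + Z1 (b j) * RtoC (a (S j) - b j))); [ring | rewrite Wb; ring]. }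
  rewrite Cmult_plus_distr_l, X. ring.
Qed.

Lemma potentials_agree : proportional_solutions 1 -> forall x, T x -> q x = qt x.
Proof.
  intro H.
  assert (Hall : forall n, (n < N)%nat -> proportional_solutions (S n)).
  { induction n as [| n IH]; intro Hn; [exact H |].
    apply gap_step; [lia | apply IH; lia |]. apply interval_step; [lia | apply IH; lia]. }
  intros x [k [Hk Hx]]. apply (interval_step k); [exact Hk | | exact Hx].
  replace k with (S (k - 1)) by lia. apply Hall. lia.
Qed.
End Assembly.

(** * The Weyl solution at large negative spectral parameter *)

Section Weyl.
Variables (N : nat) (a b : nat -> R).
Hypothesis HN : (1 <= N)%nat.
Hypothesis Hab : forall k, (1 <= k <= N)%nat -> (a k < b k)%R.
Hypothesis Hgap : forall k, (1 <= k < N)%nat -> (b k < a (S k))%R.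
Let T := intervals N a b.
Variables (q : R -> C) (Q k : R).
Hypothesis Hq : continuous_on T q.
Hypothesis HQ : forall x, T x -> (Cmod (q x) <= Q)%R.
Hypothesis Hk : (0 < k)%R.
Hypothesis HkQ : (4 * Q <= k ^ 2)%R.
Hypothesis Hlen : (2 * Q * (b 1%nat - a 1%nat) <= k)%R.
Hypothesis Hlen2 : (4 <= k * (b 1%nat - a 1%nat))%R.
Let lam := RtoC (- k ^ 2).

Lemma start_in_T : T (a 1%nat).
Proof. exists 1%nat. split; [lia |]. pose proof (Hab 1%nat ltac:(lia)); lra. Qed.

Lemma cosine_spec : is_solution T q lam (cosine_solution N a b q lam) /\
  cosine_solution N a b q lam (a 1%nat) = 1 /\
  delta_deriv T (cosine_solution N a b q lam) (a 1%nat) = 0.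
Proof.
  unfold cosine_solution. apply epsilon_spec.
  destruct (piecewise_exists N a b HN Hab Hgap q lam Hq 1 0) as [Y [Y1 [P [E E1]]]].
  destruct (piecewise_solution N a b HN Hab Hgap q lam Y Y1 P) as [S D].
  exists Y. split; [exact S | split; [exact E |]]. rewrite <- E1. apply D, start_in_T.
Qed.

(** Otherwise the cosine solution would vanish at [b N], and by [piecewise_decay] its derivative at
    [a 1] could not be zero. Hence the equality of Weyl functions may be used at every such
    [lam]. *)
Lemma Delta1_nonzero : Delta1 N a b q lam <> 0.
Proof.
  intro E. destruct cosine_spec as [S [E0 E1]].
  pose proof (solution_piecewise N a b HN Hab Hgap q lam Hq _ S) as P.
  destruct (piecewise_decay N a b HN Hab Hgap q Q k HQ Hk HkQ 1 _ _ ltac:(lia) P E 1 ltac:(lia) Hlen Hlen2)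
    as [_ [_ [X _]]].
  - left. rewrite E0. apply RtoC_neq_0. lra.
  - apply X. exact E1.
Qed.

(** The choice by [epsilon] is meaningful because [S - (S (b N) / C (b N)) C] qualifies, where [S]
    and [C] are the sine and cosine solutions. *)
Lemma weyl_spec : is_solution T q lam (weyl_solution N a b q lam) /\
  delta_deriv T (weyl_solution N a b q lam) (a 1%nat) = 1 /\
  weyl_solution N a b q lam (b N) = 0.
Proof.
  unfold weyl_solution. apply epsilon_spec.
  destruct cosine_spec as [S [E0 E1]].
  pose proof (solution_piecewise N a b HN Hab Hgap q lam Hq _ S) as P.
  destruct (piecewise_exists N a b HN Hab Hgap q lam Hq 0 1) as [Y [Y1 [P' [F0 F1]]]].
  set (c := cosine_solution N a b q lam) in *.
  pose proof Delta1_nonzero as ND. unfold Delta1 in ND. fold c in ND.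
  pose proof (piecewise_lin _ _ _ _ _ _ _ _ _ (- (Y (b N) / c (b N))) P' P) as PL.
  destruct (piecewise_solution N a b HN Hab Hgap q lam _ _ PL) as [SL DL].
  exists (fun x => Y x + - (Y (b N) / c (b N)) * c x). split; [exact SL | split].
  - transitivity (Y1 (a 1%nat) + - (Y (b N) / c (b N)) * delta_deriv T c (a 1%nat)); [exact (DL _ start_in_T) |].
    rewrite F1, E1. ring.
  - field. exact ND.
Qed.
End Weyl.

Theorem theorem1 (N : nat) (a b : nat -> R) (q qt : R -> C)
  (HN : (2 <= N)%nat)
  (Hab : forall k : nat, (1 <= k <= N - 1)%nat ->
     (a k < b k /\ b k < a (S k) /\ a (S k) < b (S k))%R)
  (Hq : continuous_on (intervals N a b) q)
  (Hqt : continuous_on (intervals N a b) qt)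
  (HM : weyl_function_eq N a b q qt) :
  forall x : R, intervals N a b x -> q x = qt x.
Proof.
  assert (H1 : (1 <= N)%nat) by lia.
  assert (Hlt : forall k, (1 <= k <= N)%nat -> (a k < b k)%R).
  { intros k Hk. destruct (Nat.eq_dec k N) as [-> | n]; [| apply Hab; lia].
    replace N with (S (N - 1)) by lia. apply Hab. lia. }
  assert (Hgap : forall k, (1 <= k < N)%nat -> (b k < a (S k))%R) by (intros k Hk; apply Hab; lia).
  apply (potentials_agree N a b H1 Hlt Hgap q qt Hq Hqt).
  destruct (common_bound N a b H1 Hlt q qt Hq Hqt) as [Q [HQ0 [HQ HQt]]].
  pose proof (Hlt 1%nat ltac:(lia)) as Hl.
  exists (threshold Q (b 1%nat - a 1%nat) 0). intros k Hk.
  destruct (threshold_spec Q (b 1%nat - a 1%nat) 0 k HQ0 ltac:(lra) Hk) as [K1 [K2 [K3 [K4 _]]]].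
  set (lam := RtoC (- k ^ 2)).
  destruct (weyl_spec N a b H1 Hlt Hgap q Q k Hq HQ ltac:(lra) K2 K3 K4) as [S [D E]].
  destruct (weyl_spec N a b H1 Hlt Hgap qt Q k Hqt HQt ltac:(lra) K2 K3 K4) as [St [Dt Et]].
  specialize (HM lam
    (Delta1_nonzero N a b H1 Hlt Hgap q Q k Hq HQ ltac:(lra) K2 K3 K4)
    (Delta1_nonzero N a b H1 Hlt Hgap qt Q k Hqt HQt ltac:(lra) K2 K3 K4)).
  unfold weyl_function in HM. fold lam in S, D, E, St, Dt, Et.
  exists (weyl_solution N a b q lam), (delta_deriv (intervals N a b) (weyl_solution N a b q lam)),
    (weyl_solution N a b qt lam), (delta_deriv (intervals N a b) (weyl_solution N a b qt lam)).
  split; [apply (solution_piecewise N a b H1 Hlt Hgap q lam Hq _ S) |].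
  split; [apply (solution_piecewise N a b H1 Hlt Hgap qt lam Hqt _ St) |].
  split; [exact E |]. split; [exact Et |].
  (* Both derivatives at [a 1] are 1, so proportionality there is exactly the equality of the Weyl
     functions. *)
  rewrite D, Dt, HM.
  split; [right; apply RtoC_neq_0; lra |].
  split; [right; apply RtoC_neq_0; lra | ring].
Qed.
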